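(* Let $A=(a_{i,j})$ be a non-negative $n\times n$ matrix and let $\nu(A)=\max\{k:\ \mathrm{per}_k(A)>0\}$. For every integer $0\le k\leq \nu(A)$, \[ \mathrm{per}_k(A) \geq b_{\nu(A),k}\big(k/\nu(A)\big)\exp\Big( \max_{\mathbf{x}\in M_{n,k}} S^B(A,\mathbf{x})\Big), \] where $b_{m,k}(p) = \binom{m}{k}p^k(1-p)^{m-k}$. Moreover, there exists a sequence of non-negative matrices $(A_\ell)_{\ell\in\mathbb{N}}$, $A_\ell$ of size $2^\ell n\times 2^\ell n$, such that $A_0=A$, $A_\ell$ is a $2$-lift of $A_{\ell-1}$ for every $\ell\geq 1$, and for all $z>0$, \[ \lim_{\ell\to \infty}\frac{1}{2^\ell }\ln \Big(\sum_{k=0}^{\nu(A_\ell)} \mathrm{per}_k(A_{\ell})z^k\Big) = \max_{\mathbf{x}\in M_{n,\leq}}\Big\{ \Big(\sum_{i,j} x_{i,j}\Big)\ln z+S^B(A,\mathbf{x})\Big\}. \]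
   Context: For a square matrix $A$, $\mathrm{per}(A)=\sum_{\sigma}\prod_i a_{i,\sigma(i)}$ is the permanent; for $1\le k\le n$, $\mathrm{per}_k(A)$ is the sum of the permanents of all $k\times k$ submatrices (minors) of $A$, and $\mathrm{per}_0(A)=1$. $M_{n,\leq}$ is the set of $n\times n$ matrices $\mathbf{x}=(x_{i,j})$ with $x_{i,j}\ge0$, all row sums $\le 1$ and all column sums $\le 1$; $M_{n,k}$ is the subset of $M_{n,\le}$ with $\sum_{i,j}x_{i,j}=k$. For $A$ non-negative and $\mathbf{x}\in M_{n,\le}$, \[ S^B(A,\mathbf{x}) = \sum_{i,j}\Big( x_{i,j}\ln\frac{a_{i,j}}{x_{i,j}}+(1-x_{i,j})\ln(1-x_{i,j})\Big) -\sum_i\Big( 1-\sum_jx_{i,j}\Big)\ln\Big( 1-\sum_jx_{i,j}\Big)-\sum_j\Big( 1-\sum_ix_{i,j}\Big)\ln\Big(1-\sum_ix_{i,j}\Big), \] valued in $\mathbb{R}\cup\{-\infty\}$, with the conventions $0\ln 0=0$ and $\ln\frac{0}{0}=1$ (so a term with $a_{i,j}=0<x_{i,j}$ gives $-\infty$). A $2n\times 2n$ non-negative matrix $B$ is a $2$-lift of the $n\times n$ matrix $A$ if for all $i,j\in\{1,\dots,n\}$, either $b_{i,j}=b_{i+n,j+n}=a_{i,j}$ and $b_{i,j+n}=b_{i+n,j}=0$, or $b_{i,j+n}=b_{i+n,j}=a_{i,j}$ and $b_{i,j}=b_{i+n,j+n}=0$. *)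

(* Defs.v *)
From HB Require Import structures.
From mathcomp Require Import all_boot all_order all_algebra all_fingroup.
From mathcomp Require Import all_classical all_reals all_analysis.
Set Implicit Arguments. Unset Strict Implicit. Unset Printing Implicit Defensive.
Import Order.TTheory GRing.Theory Num.Theory.
Local Open Scope ring_scope.
Local Open Scope classical_set_scope.

Section Defs.
Variable R : realType.

Definition per (n : nat) (A : 'M[R]_n) : R :=
  \sum_(s : 'S_n) \prod_(i < n) A i (s i).

(* permanent of a matrix whose two dimensions are equal (0 otherwise,
   only used when they are equal) *)
Definition per_sq (m1 m2 : nat) (B : 'M[R]_(m1, m2)) : R :=
  match m1 =P m2 with
  | ReflectT e => per (castmx (erefl m1, esym e) B)
  | ReflectF _ => 0
  end.

Definition minor (n : nat) (A : 'M[R]_n) (I J : {set 'I_n}) :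
  'M[R]_(#|I|, #|J|) :=
  \matrix_(a < #|I|, b < #|J|) A (enum_val a) (enum_val b).

Definition per_k (n : nat) (A : 'M[R]_n) (k : nat) : R :=
  if k == 0%N then 1 else
  \sum_(I : {set 'I_n} | #|I| == k) \sum_(J : {set 'I_n} | #|J| == k)
     per_sq (minor A I J).

(* nu(A) = max { k : per_k(A) > 0 } (per_k A = 0 for k > n) *)
Definition nu (n : nat) (A : 'M[R]_n) : nat :=
  \max_(k < n.+1 | 0 < per_k A k) k.

Definition bin_b (m k : nat) (p : R) : R :=
  'C(m, k)%:R * p ^+ k * (1 - p) ^+ (m - k).

Definition Mle (n : nat) : set 'M[R]_n :=
  [set x | (forall i j, 0 <= x i j) /\
           (forall i, \sum_j x i j <= 1) /\
           (forall j, \sum_i x i j <= 1)].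

Definition Mk (n k : nat) : set 'M[R]_n :=
  [set x | Mle x /\ \sum_i \sum_j x i j = k%:R].

Definition xlnx (t : R) : R := if t == 0 then 0 else t * ln t.

Definition xlnax (a x : R) : R := if x == 0 then 0 else x * ln (a / x).

Definition SB (n : nat) (A : 'M[R]_n) (x : 'M[R]_n) : \bar R :=
  if [exists i, exists j, (A i j == 0) && (0 < x i j)] then -oo%E
  else (\sum_i \sum_j (xlnax (A i j) (x i j) + xlnx (1 - x i j))
        - \sum_i xlnx (1 - \sum_j x i j)
        - \sum_j xlnx (1 - \sum_i x i j))%:E.

Definition entry (p : nat) (B : 'M[R]_p) (i j : nat) : R :=
  match @insub nat (fun t => t < p)%N 'I_p i, @insub nat (fun t => t < p)%N 'I_p j with
  | Some i', Some j' => B i' j'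
  | _, _ => 0
  end.

Definition is_2lift (m : nat) (A : 'M[R]_m) (p : nat) (B : 'M[R]_p) : Prop :=
  p = (2 * m)%N /\
  forall i j : 'I_m,
    (entry B i j = A i j /\ entry B (i + m) (j + m) = A i j /\
     entry B i (j + m) = 0 /\ entry B (i + m) j = 0) \/
    (entry B i (j + m) = A i j /\ entry B (i + m) j = A i j /\
     entry B i j = 0 /\ entry B (i + m) (j + m) = 0).

End Defs.
Arguments Mle {R} n.
Arguments Mk {R} n k.

(* Main.v *)
Require Import Defs.
From HB Require Import structures.
From mathcomp Require Import all_boot all_order all_algebra all_fingroup.
From mathcomp Require Import ring lra.
From mathcomp Require Import all_classical all_reals all_analysis.
From mathcomp.real_closed Require Import complex.
Import Order.TTheory GRing.Theory Num.Theory.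
Import numFieldNormedType.Exports.
Set Implicit Arguments. Unset Strict Implicit. Unset Printing Implicit Defensive.
Local Open Scope ring_scope.

(* Write P(z) = sum_k per_k(A) z^k, the matching generating function of the weighted
   bipartite graph A.

   Lower bound: P(z) >= z^|x| exp(S^B(A, x)) for x in M_{n,<=}.  Cut every edge into two
   half-edges with free weights.  The graph becomes a union of stars, for which
   the bound is Gibbs' inequality; gluing the half-edges back one edge at a time
   preserves it, by the Heilmann-Lieb correlation inequality.

   Coefficients: P has only real roots (Heilmann-Lieb), so by Newton's inequalities
   per_k(A) / binom(nu, k) is log-concave, hence is dominated by a geometric sequence
   touching it at k.  Thus P(z) <= c (1 + r z)^nu with equality of the k-th coefficients,
   and evaluating at the z for which the binomial law has mean k gives
   per_k(A) >= b_{nu,k}(k / nu) inf_z P(z) / z^k.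

   Limit: each step of the sequence of 2-lifts twists the fiber of one edge of some
   earlier level, and every edge of every level gets its turn, so the girth tends to
   infinity.  The belief propagation map is a contraction for the logarithmic sup
   distance, so in lifts of large girth the probability that a vertex is unmatched is
   close to the value given by the fixed point on A.  Hence the derivative in
   t = ln z of 2^-l ln P_{A_l} converges to that of the Bethe free energy B(t) at
   the fixed point.  Both vanish as t -> -oo, so 2^-l ln P_{A_l} is eventually at most
   B(t) + eps; and B(t) is a value of |x| t + S^B(A, x), so the lower bound for
   A_l, applied to the lifts of x, shows that B(t) is both the limit and the maximum. *)

(** * Weighted matching sums *)

(** One recursion, deletion of a vertex, is read in three ways. Over the complex numbers it keeps
    the ratios P(U) / P(U \ v) in the right half-plane, which gives the real roots; with the
    bipartition it gives the correlation inequality; in logarithms it is belief propagation on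
    shrinking vertex sets. The obstacle to the limit is that large girth controls local ratios and
    not P itself. The free energy is therefore recovered through finite increments in t: convexity
    of ln P bounds each increment above by the occupation at the new point, stationarity of the
    Bethe function bounds its increment below up to a square, and both are summed over a fine grid.
    The lifts are taken of the complete bipartite graph on n + n vertices, a zero of A giving edges
    of weight 0, so the adjacency depends on n only. *)

Section MatchingSum.
Variables (K : comNzRingType) (V : finType).
Implicit Types (h : V -> K) (w : V -> V -> K) (U : {set V}).

(* [msum h w U] is the sum over the matchings of [U] of the product of the weights
   [w] of the matched pairs and [h] of the unmatched vertices.  It is defined by
   expansion at some vertex of U; by [msumE] every vertex gives the same value. *)
Fixpoint msum_rec h w (m : nat) U : K :=
  if m isn't m'.+1 then 1 else
  if [pick v in U] is Some v then
    h v * msum_rec h w m' (U :\ v)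
    + \sum_(u in U :\ v) w v u * msum_rec h w m' (U :\ v :\ u)
  else 1.

Definition msum h w U : K := msum_rec h w #|U| U.

Lemma msum_rec_fuel h w m U : (#|U| <= m)%N -> msum_rec h w m U = msum h w U.
Proof.
suff H k : forall U, (#|U| <= k)%N -> forall m m', (#|U| <= m)%N -> (#|U| <= m')%N ->
    msum_rec h w m U = msum_rec h w m' U by move=> le; exact: (H #|U|).
elim: k => [|k IH] {U} U leU {}m m'.
  have -> : U = finset.set0 by apply/eqP; rewrite -cards_eq0 -leqn0.
  by case: m m' => [|m] [|m'] _ _ //=; case: pickP => // v; rewrite inE.
case: m m' => [|m] [|m'] //=.
- by rewrite leqn0 cards_eq0 => /eqP -> _; case: pickP => // v; rewrite inE.
- by rewrite leqn0 cards_eq0 => _ /eqP ->; case: pickP => // v; rewrite inE.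
case: pickP => // v vU; rewrite (cardsD1 v) [v \in U]vU !ltnS => lem lem'.
have lek : (#|U :\ v| <= k)%N by move: leU; rewrite (cardsD1 v) [v \in U]vU.
have le1 u : (#|U :\ v :\ u| <= #|U :\ v|)%N by exact/subset_leq_card/subD1set.
congr (_ * _ + _); first exact: IH.
apply: eq_bigr => u _; congr (_ * _).
by apply: IH; apply: leq_trans (le1 u) _.
Qed.

Lemma msum0 h w : msum h w finset.set0 = 1.
Proof. by rewrite /msum cards0. Qed.

Lemma msum_pick h w U : U != finset.set0 -> exists2 v, v \in U &
  msum h w U = h v * msum h w (U :\ v)
               + \sum_(u in U :\ v) w v u * msum h w (U :\ v :\ u).
Proof.
move=> U0; rewrite {1}/msum; case E: #|U| => [|m].
  by move/eqP: E; rewrite cards_eq0 (negbTE U0).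
rewrite /=; case: pickP => [v vU|U0'].
  have cv : #|U :\ v| = m by move: E; rewrite (cardsD1 v) [v \in U]vU => -[].
  exists v => //; rewrite /msum cv; congr (_ + _).
  apply: eq_bigr => u _; rewrite msum_rec_fuel//.
  by rewrite -cv; exact/subset_leq_card/subD1set.
by case/negP: U0; apply/eqP/setP => v; rewrite U0' inE.
Qed.

Lemma setD1C U u v : U :\ u :\ v = U :\ v :\ u.
Proof. by apply/setP => x; rewrite !inE andbCA. Qed.

(** Expand at the vertex chosen by [pick] and at v, then each remaining set at the other of the two
    by induction. Both results run over the possible partners of the two vertices, and differ only
    by an exchange of sums. *)
Lemma msumE h w (ws : forall u v, w u v = w v u) U v : v \in U ->
  msum h w U = h v * msum h w (U :\ v)
               + \sum_(u in U :\ v) w v u * msum h w (U :\ v :\ u).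
Proof.
have [m] := ubnP #|U|; elim: m => // m IH in U v *; rewrite ltnS => leU vU.
have [|v' v'U ->] := @msum_pick h w U; first by apply/set0Pn; exists v.
have [->//|nv] := eqVneq v' v.
have card_lt (U' : {set V}) x : U' \subset U -> x \in U -> x \notin U' -> (#|U'| < m)%N.
  move=> sU xU xU'; apply: leq_trans leU; apply: proper_card.
  by apply/properP; split => //; exists x.
have S1 x : U :\ x \subset U by exact: subD1set.
have S2 x y : U :\ x :\ y \subset U by exact: fintype.subset_trans (subD1set _ _) (S1 x).
have key x y : x \in U -> y \in U -> y != x ->
    h x * msum h w (U :\ x)
      + \sum_(u in U :\ x) w x u * msum h w (U :\ x :\ u) =
    h x * (h y * msum h w (U :\ x :\ y))
    + h x * (\sum_(u in U :\ x :\ y) w y u * msum h w (U :\ x :\ y :\ u))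
    + (w x y * msum h w (U :\ x :\ y)
    + \sum_(u in U :\ x :\ y) (h y * (w x u * msum h w (U :\ x :\ y :\ u)) +
       \sum_(z in U :\ x :\ y :\ u) w x u * w y z *
          msum h w (U :\ x :\ y :\ u :\ z))).
  move=> xU yU yx; rewrite (IH (U :\ x) y); last 2 first.
  - by apply: (card_lt _ x); rewrite // !inE eqxx.
  - by rewrite !inE yx.
  rewrite mulrDr; congr (_ + _).
  rewrite (big_setD1 y) /=; last by rewrite !inE yx.
  congr (_ + _); apply: eq_bigr => u; rewrite !inE => /and3P[uy ux uU].
  rewrite (IH (U :\ x :\ u) y); last 2 first.
  - by apply: (card_lt _ x); rewrite // !inE eqxx andbF.
  - by rewrite !inE eq_sym uy yx.
  rewrite mulrDr (setD1C (U :\ x) u y); congr (_ + _); first by rewrite mulrCA.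
  by rewrite mulr_sumr; apply: eq_bigr => z _; rewrite mulrA.
rewrite (key v' v) 1?eq_sym// (key v v') // (setD1C U v v') (ws v v').
rewrite !big_split/= -!mulr_sumr.
rewrite (_ : \sum_(i in U :\ v' :\ v) \sum_(z in U :\ v' :\ v :\ i) _ =
  \sum_(i in U :\ v' :\ v) \sum_(z in U :\ v' :\ v :\ i)
   w v i * w v' z * msum h w (U :\ v' :\ v :\ i :\ z)).
  by rewrite mulrCA; ring.
rewrite (exchange_big_dep (fun z => z \in U :\ v' :\ v)) /=; last first.
  by move=> i j _; rewrite inE => /andP[].
apply: eq_bigr => z zU; rewrite [LHS](eq_bigl (fun i => i \in U :\ v' :\ v :\ z)).
  by apply: eq_bigr => i _; rewrite setD1C (mulrC (w v' i)).
move=> i; rewrite !inE; rewrite !inE in zU; rewrite zU.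
by rewrite !andbT (eq_sym z i) andbC.
Qed.

Lemma eq_msum h h' w w' U :
  {in U, h =1 h'} -> {in U &, w =2 w'} -> msum h w U = msum h' w' U.
Proof.
have [m] := ubnP #|U|; elim: m => // m IH in U *; rewrite ltnS /msum => leU hh ww.
case E : #|U| => [//|k] /=; case: pickP => // v vU.
have cv : #|U :\ v| = k by move: E; rewrite (cardsD1 v) [v \in U]vU => -[].
have lem (U' : {set V}) : U' \subset U :\ v -> (#|U'| < m)%N.
  by move/subset_leq_card; rewrite cv => /leq_ltn_trans; apply; rewrite -E.
have aux (U' : {set V}) : U' \subset U :\ v -> msum_rec h w k U' = msum_rec h' w' k U'.
  move=> sU; have leU' := subset_leq_card sU; rewrite cv in leU'.
  rewrite !msum_rec_fuel//; apply: IH (lem _ sU) _ _.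
    by move=> x /(fintype.subsetP sU); rewrite inE => /andP[_]; apply: hh.
  move=> x y /(fintype.subsetP sU); rewrite inE => /andP[_ xU] /(fintype.subsetP sU).
  by rewrite inE => /andP[_ yU]; apply: ww.
rewrite hh// aux//; congr (_ + _); apply: eq_bigr => u.
by rewrite inE => /andP[_ uU]; rewrite ww// aux// subD1set.
Qed.

(** A matching covers every vertex once, an unmatched vertex paying l and a pair l ^+ 2. This turns
    a factor on the edges into vertex weights, where the half-plane argument applies. *)
Lemma msum_scale h w (l : K) U :
  msum (fun v => l * h v) (fun u v => l ^+ 2 * w u v) U = l ^+ #|U| * msum h w U.
Proof.
have [m] := ubnP #|U|; elim: m => // m IH in U *; rewrite ltnS /msum => leU.
case E : #|U| => [|k] /=; first by rewrite mulr1.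
case: pickP => [v vU|U0]; last first.
  by move: E; rewrite (_ : U = finset.set0) ?cards0//; apply/setP => x; rewrite inE U0.
have cv : #|U :\ v| = k by move: E; rewrite (cardsD1 v) [v \in U]vU => -[].
have ltk : (k < m)%N by rewrite -E.
rewrite -{1 4}cv -!/(msum _ _ _) IH ?cv// mulrDr; congr (_ + _).
  by rewrite exprS; ring.
rewrite mulr_sumr; apply: eq_bigr => u uU.
have cu : #|U :\ v :\ u|.+1 = k by rewrite -cv (cardsD1 u (U :\ v)) uU.
rewrite !msum_rec_fuel -?cu// IH ?(ltn_trans _ ltk) -?cu// !exprS; ring.
Qed.

End MatchingSum.

Section MatchingSumOrder.
Variables (R : realFieldType) (V : finType).
Variables (h : V -> R) (w : V -> V -> R).
Hypothesis h0 : forall v, 0 < h v.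
Hypothesis w0 : forall u v, 0 <= w u v.
Hypothesis ws : forall u v, w u v = w v u.
Implicit Types U : {set V}.
Notation P := (msum h w).

Lemma msum_gt0 U : 0 < P U.
Proof.
have [m] := ubnP #|U|; elim: m => // m IH in U *; rewrite ltnS => leU.
have [->|/set0Pn[v vU]] := eqVneq U finset.set0; first by rewrite msum0.
have lt1 : (#|U :\ v| < m)%N by apply: leq_trans leU; rewrite [leqRHS](cardsD1 v) vU.
rewrite (msumE _ ws vU) ltr_wpDr// ?mulr_gt0 ?IH//.
apply: sumr_ge0 => u uU; rewrite mulr_ge0// ltW// IH//.
by apply: leq_ltn_trans lt1; exact/subset_leq_card/subD1set.
Qed.

(** Deleting one more vertex can only decrease P, so expansion at v costs at most a factor 1 plus
    the weighted degree of v. *)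
Lemma msum_le_prod U : (forall v, h v = 1) ->
  P U <= \prod_(v in U) (1 + \sum_u w v u).
Proof.
move=> h1; have [m] := ubnP #|U|; elim: m => // m IH in U *; rewrite ltnS => leU.
have [->|/set0Pn[v vU]] := eqVneq U finset.set0; first by rewrite msum0 big_set0.
have lt1 : (#|U :\ v| < m)%N by apply: leq_trans leU; rewrite [leqRHS](cardsD1 v) vU.
rewrite (msumE _ ws vU) [leRHS](big_setD1 v)//= h1 mul1r.
apply: (@le_trans _ _ ((1 + \sum_u w v u) * P (U :\ v))); last first.
  by rewrite ler_wpM2l ?IH// addr_ge0// sumr_ge0.
rewrite mulrDl mul1r lerD2l mulr_suml [leRHS](bigID (fun u => u \in U :\ v))/=.
rewrite -[leLHS]addr0 lerD//; last by rewrite sumr_ge0// => u _; rewrite mulr_ge0// ltW ?msum_gt0.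
apply: ler_sum => u uU; rewrite ler_wpM2l// [leRHS](msumE _ ws uU) h1 mul1r lerDl.
by rewrite sumr_ge0// => z _; rewrite mulr_ge0// ltW ?msum_gt0.
Qed.

Variable c : V -> bool.
Hypothesis wc : forall u v, c u = c v -> w u v = 0.

(* Heilmann and Lieb: expanding at [u] reduces the inequality for U to the one for
   U :\ u, with the two sides of the bipartition, hence the sign, exchanged. *)
Lemma msum_corr U u v : u \in U -> v \in U -> u != v ->
  if c u == c v then P U * P (U :\ u :\ v) <= P (U :\ u) * P (U :\ v)
  else P (U :\ u) * P (U :\ v) <= P U * P (U :\ u :\ v).
Proof.
have [m] := ubnP #|U|; elim: m => // m IH in U u v *; rewrite ltnS => leU uU vU uv.
have lt1 : (#|U :\ u| < m)%N by apply: leq_trans leU; rewrite [leqRHS](cardsD1 u) uU.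
have vW : v \in U :\ u by rewrite !inE eq_sym uv.
have uW : u \in U :\ v by rewrite !inE uv.
(* Expand P U and P (U :\ v) at u. The partner v yields the square; every other partner k yields the
   same kind of difference for U :\ u and the pair v, k, whose sign is known by induction. *)
have E : P U * P (U :\ u :\ v) - P (U :\ u) * P (U :\ v) =
   w u v * P (U :\ u :\ v) ^+ 2 + \sum_(k in U :\ u :\ v) w u k *
    (P (U :\ u :\ k) * P (U :\ u :\ v) - P (U :\ u) * P (U :\ u :\ v :\ k)).
  rewrite (msumE _ ws uU) (msumE _ ws uW) (setD1C U v u) (big_setD1 v vW) /=.
  under [in RHS]eq_bigr do rewrite mulrBr.
  rewrite sumrB.
  have -> : \sum_(i in U :\ u :\ v) w u i * (P (U :\ u :\ i) * P (U :\ u :\ v)) =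
     (\sum_(i in U :\ u :\ v) w u i * P (U :\ u :\ i)) * P (U :\ u :\ v).
    by rewrite mulr_suml; apply: eq_bigr => k _; rewrite mulrA.
  have -> : \sum_(i in U :\ u :\ v) w u i * (P (U :\ u) * P (U :\ u :\ v :\ i)) =
     P (U :\ u) * \sum_(i in U :\ u :\ v) w u i * P (U :\ u :\ v :\ i).
    by rewrite mulr_sumr; apply: eq_bigr => k _; rewrite mulrCA.
  by ring.
have B k : k \in U :\ u :\ v -> if c v == c k then
    P (U :\ u) * P (U :\ u :\ v :\ k) <= P (U :\ u :\ k) * P (U :\ u :\ v)
   else P (U :\ u :\ k) * P (U :\ u :\ v) <= P (U :\ u) * P (U :\ u :\ v :\ k).
  move=> kW; have kv : v != k by move: kW; rewrite !inE eq_sym => /andP[].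
  have kU : k \in U :\ u by move: kW; rewrite !inE => /and3P[_ -> ->].
  by have := IH _ _ _ lt1 vW kU kv; rewrite (mulrC (P (U :\ u :\ v))).
case: eqP => cuv.
  rewrite -subr_le0 E wc// mul0r add0r sumr_le0// => k kW.
  have [ckv|ckv] := eqVneq (c u) (c k); first by rewrite wc// mul0r.
  rewrite mulr_ge0_le0// subr_le0.
  by have := B _ kW; rewrite -cuv (negbTE ckv).
rewrite -subr_ge0 E addr_ge0//; first by rewrite mulr_ge0// sqr_ge0.
rewrite sumr_ge0// => k kW.
have [ckv|ckv] := eqVneq (c u) (c k); first by rewrite wc// mul0r.
rewrite mulr_ge0// subr_ge0.
have := B _ kW; rewrite ifT//.
by move: cuv ckv; case: (c u); case: (c v); case: (c k).
Qed.

End MatchingSumOrder.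

Section MatchingSumAffine.
Variables (K : comNzRingType) (V : finType).
Variables (h : V -> K) (w : V -> V -> K).
Hypothesis ws : forall u v, w u v = w v u.
Implicit Types U : {set V}.

Lemma msum_addh h' (y : K) U v : v \in U -> h' v = h v + y ->
  (forall u, u != v -> h' u = h u) ->
  msum h' w U = msum h w U + y * msum h w (U :\ v).
Proof.
move=> vU hv hu; rewrite (msumE _ ws vU) [in RHS](msumE _ ws vU) hv.
have E U' : msum h' w (U' :\ v) = msum h w (U' :\ v).
  by apply: eq_msum => // x; rewrite !inE => /andP[xv _]; apply: hu.
rewrite E; under eq_bigr do rewrite (setD1C U v) E -(setD1C U v).
by ring.
Qed.

Lemma msum_addw w' (y : K) U u v : u \in U -> v \in U -> u != v ->
  (forall a b, w' a b = w' b a) ->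
  w' u v = w u v + y ->
  (forall a b, (a, b) != (u, v) -> (a, b) != (v, u) -> w' a b = w a b) ->
  msum h w' U = msum h w U + y * msum h w (U :\ u :\ v).
Proof.
move=> uU vU uv ws' wv wu; have vW : v \in U :\ u by rewrite !inE eq_sym uv.
rewrite (msumE _ ws' uU) [in RHS](msumE _ ws uU).
have E (U' : {set V}) : U' \subset U :\ u -> msum h w' U' = msum h w U'.
  move=> sU; apply: eq_msum => // a b /(fintype.subsetP sU); rewrite !inE => /andP[au _].
  by move=> /(fintype.subsetP sU); rewrite !inE => /andP[bu _]; rewrite wu// xpair_eqE negb_and ?au// bu orbT.
rewrite E//; rewrite !(big_setD1 v vW) /= wv E ?subD1set//.
rewrite (eq_bigr (fun k => w u k * msum h w (U :\ u :\ k))); first by ring.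
move=> k; rewrite !inE => /and3P[kv ku kU]; rewrite E ?subD1set// wu// xpair_eqE negb_and.
  by rewrite kv orbT.
by rewrite uv.
Qed.

End MatchingSumAffine.

(** * Non-vanishing of the matching sum for vertex weights in the right half-plane *)

Section MatchingSumStable.
Variables (C : numClosedFieldType) (V : finType).
Variables (h : V -> C) (w : V -> V -> C).
Hypothesis h0 : forall v, 0 < 'Re (h v).
Hypothesis w0 : forall u v, 0 <= w u v.
Hypothesis ws : forall u v, w u v = w v u.

Lemma Re_inv_gt0 (z : C) : 0 < 'Re z -> 0 < 'Re z^-1.
Proof.
move=> z0; have zn0 : z != 0 by apply: contraTneq z0 => ->; rewrite raddf0 ltxx.
rewrite invC_norm mulrC ReMr ?Re_conj; last by rewrite rpredV rpredX// normr_real.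
by rewrite divr_gt0 ?exprn_gt0 ?normr_gt0.
Qed.

(** Dividing the expansion at v by P (U :\ v) gives h v plus nonnegative multiples of inverses of
    smaller ratios. Inversion preserves the right half-plane, hence so does the recursion, and P
    cannot vanish. *)
Lemma msum_stable (U : {set V}) : msum h w U != 0 /\
  forall v, v \in U -> 0 < 'Re (msum h w U / msum h w (U :\ v)).
Proof.
have [m] := ubnP #|U|; elim: m => // m IH in U *; rewrite ltnS => leU.
have ReP v : v \in U -> 0 < 'Re (msum h w U / msum h w (U :\ v)).
  move=> vU.
  have lt1 : (#|U :\ v| < m)%N by apply: leq_trans leU; rewrite [leqRHS](cardsD1 v) vU.
  have [W0 W1] := IH _ lt1.
  rewrite (msumE _ ws vU) mulrDl mulfK// raddfD/= ltr_wpDr//.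
  rewrite mulr_suml raddf_sum/= sumr_ge0// => u uW.
  have := Re_inv_gt0 (W1 _ uW); rewrite invf_div => r0.
  by rewrite -mulrA ReMl ?ger0_real// mulr_ge0// ltW.
split => //; have [->|/set0Pn[v vU]] := eqVneq U finset.set0; first by rewrite msum0 oner_eq0.
by apply: contraTneq (ReP _ vU) => ->; rewrite mul0r raddf0 ltxx.
Qed.

End MatchingSumStable.

(** * Permanents of minors as matching sums *)

Section Bipartite.
Variables (S T : finType).

Definition bip (K : nmodType) (b : S -> T -> K) (u v : S + T) : K :=
  match u, v with inl i, inr j | inr j, inl i => b i j | _, _ => 0 end.

Lemma bip_sym (K : nmodType) (b : S -> T -> K) u v : bip b u v = bip b v u.
Proof. by case: u v => [i|j] [i'|j']. Qed.

Definition bset (I : {set S}) (J : {set T}) : {set S + T} :=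
  [set u | match u with inl i => i \in I | inr j => j \in J end]%SET.

(* The matchings between I and J, as partial injections. *)
Definition pinj (I : {set S}) (J : {set T}) (f : {ffun S -> option T}) :=
  [forall i, if f i is Some j then (i \in I) && (j \in J) else true] &&
  [forall i, forall i', (f i != None) ==> (f i == f i') ==> (i == i')].

Lemma pinjP (I : {set S}) (J : {set T}) (f : {ffun S -> option T}) : reflect
  ((forall i j, f i = Some j -> (i \in I) /\ (j \in J)) /\
   (forall i i' j, f i = Some j -> f i' = Some j -> i = i')) (pinj I J f).
Proof.
apply: (iffP andP) => -[H1 H2]; split.
- by move=> i j fi; move/forallP/(_ i): H1; rewrite fi => /andP[].
- move=> i i' j fi fi'; move/forallP/(_ i)/forallP/(_ i'): H2.
  by rewrite fi fi' eqxx /= => /eqP.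
- by apply/forallP => i; case E : (f i) => [j|//]; apply/andP/H1.
- apply/forallP => i; apply/forallP => i'; apply/implyP; case E : (f i) => [j|//] _.
  by apply/implyP => /eqP/esym E'; apply/eqP; apply: H2 E E'.
Qed.

Definition ffun_upd (f : {ffun S -> option T}) i (o : option T) : {ffun S -> option T} :=
  [ffun k => if k == i then o else f k].

Variable K : comNzRingType.
Variable b : S -> T -> K.

Definition pwt (f : {ffun S -> option T}) : K :=
  \prod_i (if f i is Some j then b i j else 1).

(** Partial injections sorted by their value at a fixed i obey the expansion of [msum] at the vertex
    [inl i]. Once I is empty, the vertices of J are removed one at a time, each with factor 1. *)
Lemma msum_pinj I J :
  msum (fun=> 1) (bip b) (bset I J) = \sum_(f | pinj I J f) pwt f.
Proof.
have [m] := ubnP #|I|; elim: m => // m IH in I J *; rewrite ltnS => leI.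
have [->|/set0Pn[i iI]] := eqVneq I finset.set0.
  rewrite (big_pred1 [ffun=> None]); last first.
    move=> f; apply/pinjP/eqP => [[H1 H2]|->]; last first.
      by split => [i j|i i' j]; rewrite ffunE.
    by apply/ffunP => i; rewrite ffunE; case E: (f i) => [j|//]; case: (H1 _ _ E); rewrite inE.
  rewrite /pwt big1; last by move=> i _; rewrite ffunE.
  elim: {J}#|J| {-2}J (erefl #|J|) => [|k IHk] J cJ.
    by rewrite (_ : bset _ _ = finset.set0) ?msum0//; apply/setP => -[i|j]; rewrite !inE// (cards0_eq cJ) inE.
  have /card_gt0P[j jJ] : (0 < #|J|)%N by rewrite cJ.
  rewrite (@msumE _ _ _ _ (bip_sym b) _ (inr j)) ?inE// mul1r big1 ?addr0; last first.
    by move=> [i|j']; rewrite !inE //= mul0r.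
  rewrite (_ : bset _ _ :\ _ = bset finset.set0 (J :\ j)); last first.
    by apply/setP => -[i|j']; rewrite !inE.
  by apply: IHk; move: cJ; rewrite (cardsD1 j) jJ => -[].
have ltI : (#|I :\ i| < m)%N by move: leI; rewrite (cardsD1 i) iI.
rewrite (@msumE _ _ _ _ (bip_sym b) _ (inl i)) ?inE// mul1r.
rewrite (_ : bset _ _ :\ _ = bset (I :\ i) J); last first.
  by apply/setP => -[i'|j']; rewrite !inE.
rewrite (bigID (fun f : {ffun _} => f i == None))/=; congr (_ + _).
  rewrite IH//; apply: eq_bigl => f; apply/pinjP/andP.
    move=> [H1 H2]; split.
      by apply/pinjP; split => // i' j' /H1; rewrite inE => -[/andP[]].
    by case E: (f i) => [j|//]; have := H1 _ _ E; rewrite !inE eqxx => -[].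
  move=> [/pinjP[H1 H2] /eqP E]; split => // i' j' fi'; have [iI' jJ] := H1 _ _ fi'.
  by rewrite !inE iI' andbT; split => //; apply: contra_eq_neq fi' => ->; rewrite E.
rewrite (partition_big (fun f : {ffun _} => f i) (fun o => o != None)) /=; last by move=> f /andP[].
rewrite (reindex_omap Some id) /=; last by case.
rewrite [RHS](eq_bigl xpredT); last by move=> j; rewrite eqxx.
rewrite [RHS](bigID (fun j => j \in J)) /= addrC [X in _ = X + _]big1 ?add0r; last first.
  move=> j jJ; rewrite big1// => f /andP[/andP[/pinjP[H1 _] _] /eqP fi].
  by case: (H1 _ _ fi) => _; rewrite (negbTE jJ).
rewrite (bigID (fun u : S + T => if u is inr _ then true else false)) /= addrC big1 ?add0r; last first.
  by move=> [i'|j]; rewrite ?andbF//= mul0r.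
rewrite (reindex_omap inr (fun u : S + T => if u is inr j then Some j else None)) /=; last by case=> // i'; rewrite andbF.
apply: eq_big => [j|j]; rewrite !inE /= ?eqxx ?andbT// => jJ.
rewrite (_ : bset _ _ :\ _ = bset (I :\ i) (J :\ j)); last first.
  by apply/setP => -[i'|j']; rewrite !inE.
rewrite IH// mulr_sumr.
(* Erasing the value at i is a bijection from the injections with i sent to j onto those between I
   :\ i and J :\ j. *)
rewrite [RHS](reindex_onto (fun f => ffun_upd f i (Some j)) (fun f => ffun_upd f i None)) /=; last first.
  move=> f /andP[_ /eqP fi]; apply/ffunP => k; rewrite !ffunE.
  by case: eqP => // ->.
apply: eq_big => [f|f /pinjP[H1 H2]]; last first.
  have fi : f i = None by case E: (f i) => [j'|//]; have := H1 _ _ E; rewrite !inE eqxx => -[].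
  rewrite /pwt (bigD1 i)//= fi mul1r [in RHS](bigD1 i)//= ffunE eqxx; congr (_ * _).
  by apply: eq_bigr => k ki; rewrite ffunE (negbTE ki).
apply/pinjP/andP.
  move=> [H1 H2].
  have fi : f i = None by case E: (f i) => [j'|//]; have := H1 _ _ E; rewrite !inE eqxx => -[].
  rewrite !ffunE eqxx; split; last first.
    by apply/eqP/ffunP => k; rewrite !ffunE; case: eqP => // ->.
  rewrite eqxx !andbT; apply/pinjP; split.
    move=> k j'; rewrite ffunE; case: eqP => [-> [<-]//|_ /H1].
    by rewrite !inE => -[/andP[_ ?] /andP[_ ?]].
  move=> k k' j'; rewrite !ffunE; case: eqP => [->|_]; case: eqP => [->|_] //.
  - by move=> [<-] /H1; rewrite !inE eqxx => -[].
  - by move=> /[swap] -[<-] /H1; rewrite !inE eqxx => -[].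
  - exact: H2.
move=> [/andP[/andP[/pinjP[H1 H2] _] _] /eqP fe].
have fk k : f k = if k == i then None else f k.
  by rewrite -{1}fe !ffunE; case: eqP.
split.
  move=> k j'; rewrite fk; case: eqP => // /eqP ki fkj.
  have [] := H1 k j'; first by rewrite ffunE (negbTE ki).
  rewrite !inE ki => -> ->; split => //; rewrite andbT.
  apply: contraNneq ki => jj'; apply/eqP.
  by apply: (H2 _ _ j); rewrite !ffunE ?eqxx//; case: eqP => // _; rewrite fkj jj'.
move=> k k' j'; rewrite (fk k) (fk k'); case: eqP => // /eqP ki; case: eqP => // /eqP ki' f1 f2.
by apply: (H2 _ _ j'); rewrite ffunE ?(negbTE ki) ?(negbTE ki').
Qed.

End Bipartite.

Section PermMinor.
Variables (R : realType) (n : nat).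
Implicit Types (A : 'M[R]_n) (f : {ffun 'I_n -> option 'I_n}).

Definition pdom f : {set 'I_n} := [set i | f i != None]%SET.
Definition pimg f : {set 'I_n} := [set j | [exists i, f i == Some j]]%SET.

Local Notation pall := (pinj [set: 'I_n]%SET [set: 'I_n]%SET).

Lemma pallP f : reflect (forall i i' j, f i = Some j -> f i' = Some j -> i = i') (pall f).
Proof.
by apply: (iffP (pinjP _ _ _)) => [[]//|H]; split => // i j _; rewrite !inE.
Qed.

Lemma card_pimg f : pall f -> #|pimg f| = #|pdom f|.
Proof.
move=> /pallP H.
have -> : #|pdom f| = #|[set f i | i in pdom f]%SET|.
  rewrite card_in_imset// => i i'; rewrite !inE; case E: (f i) => [j|//] _ _ /esym E'.
  exact: H E E'.
have SI : injective (@Some 'I_n) by move=> ? ? [].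
rewrite -(card_imset (pimg f) SI); apply: eq_card => o.
apply/imsetP/imsetP => -[x xin ->].
  move: xin; rewrite inE => /existsP[i /eqP fi]; exists i; rewrite ?fi//.
  by rewrite inE fi.
move: xin; rewrite inE; case E: (f x) => [j|//] _; exists j => //.
by rewrite inE; apply/existsP; exists x; rewrite E.
Qed.

Lemma per_sq_minor A (I J : {set 'I_n}) : (0 < #|I|)%N -> #|I| = #|J| ->
  per_sq (minor A I J) =
  \sum_(f | pall f && (pdom f == I) && (pimg f == J)) pwt (fun i j => A i j) f.
Proof.
move=> I0 eIJ; rewrite /per_sq; case: eqP => // e; rewrite /per.
have /card_gt0P[x0 x0I] := I0; have /card_gt0P[y0 y0J] : (0 < #|J|)%N by rewrite -e.
pose h (s : 'S_#|I|) : {ffun 'I_n -> option 'I_n} :=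
  [ffun i => if i \in I then Some (enum_val (cast_ord e (s (enum_rank_in x0I i)))) else None].
pose g f (a : 'I_#|I|) : 'I_#|I| :=
   cast_ord (esym e) (enum_rank_in y0J (odflt y0 (f (enum_val a)))).
(* The identity is a default value: g f is injective for every f in the sum. *)
pose h' f : 'S_#|I| := if injectiveP (g f) is ReflectT gi then perm gi else 1%g.
have hP s : pall (h s) && (pdom (h s) == I) && (pimg (h s) == J).
  have sd i : i \in I -> h s i = Some (enum_val (cast_ord e (s (enum_rank_in x0I i)))).
    by move=> iI; rewrite ffunE iI.
  have sN i : i \notin I -> h s i = None by move=> iI; rewrite ffunE (negbTE iI).
  rewrite -andbA; apply/and3P; split.
  - apply/pallP => i i' j; have [iI|/sN->//] := boolP (i \in I).
    have [iI'|/sN->//] := boolP (i' \in I).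
    rewrite !sd// => -[<-] [] /enum_val_inj/cast_ord_inj/perm_inj.
    by move/(congr1 enum_val); rewrite !enum_rankK_in.
  - apply/eqP/setP => i; rewrite inE; have [iI|/sN->//] := boolP (i \in I).
    by rewrite sd.
  - apply/eqP/setP => j; rewrite inE; apply/existsP/idP => [[i +]|jJ].
      have [iI|/sN->//] := boolP (i \in I).
      by rewrite sd// => /eqP[<-]; exact: enum_valP.
    exists (enum_val ((s^-1)%g (cast_ord (esym e) (enum_rank_in y0J j)))).
    rewrite sd ?enum_valP// enum_valK_in permKV cast_ordKV.
    by rewrite enum_rankK_in.
rewrite (reindex_onto h h') /=; last first.
  move=> f /andP[/andP[/pallP finj /eqP fI] /eqP fJ].
  have fS i : i \in I -> exists2 j, j \in J & f i = Some j.
    rewrite -fI inE; case E: (f i) => [j|//] _; exists j => //.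
    by rewrite -fJ inE; apply/existsP; exists i; rewrite E.
  have gi : injective (g f).
    move=> a a'; rewrite /g; have [j jJ fa] := fS _ (enum_valP a).
    have [j' jJ' fa'] := fS _ (enum_valP a').
    rewrite fa fa' /= => /cast_ord_inj /(congr1 enum_val).
    rewrite !enum_rankK_in// => jj'; apply: enum_val_inj.
    by apply: finj fa _; rewrite fa' jj'.
  rewrite /h' /h; case: injectiveP => // gi'; apply/ffunP => i; rewrite ffunE.
  case: ifPn => iI; last first.
    by move: iI; rewrite -fI inE negbK => /eqP.
  have [j jJ fi] := fS _ iI.
  by rewrite permE /g cast_ordKV (enum_rankK_in x0I iI) fi /= enum_rankK_in.
apply: eq_big => [s|s _].
  rewrite hP /=; apply/esym/eqP.
  have gE a : g (h s) a = s a.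
    rewrite /g ffunE enum_valP /= enum_valK_in enum_valK_in.
    by rewrite cast_ordK.
  rewrite /h'; case: injectiveP => [gi|[]].
    by apply/permP => a; rewrite permE gE.
  by move=> a a'; rewrite !gE; apply: perm_inj.
rewrite /pwt [RHS](bigID (fun i => i \in I)) /= [X in _ = _ * X]big1 ?mulr1; last first.
  by move=> i iI; rewrite ffunE (negbTE iI).
rewrite [RHS](reindex_onto (@enum_val _ (mem I)) (enum_rank_in x0I)) /=; last first.
  by move=> i iI; rewrite enum_rankK_in.
apply: eq_big => [a|a _]; first by rewrite enum_valP enum_valK_in eqxx.
by rewrite ffunE enum_valP enum_valK_in castmxE mxE /= esymK cast_ord_id.
Qed.

Lemma per_kE A k : per_k A k =
  \sum_(f | pall f && (#|pdom f| == k)) pwt (fun i j => A i j) f.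
Proof.
rewrite /per_k; case: eqP => [->|/eqP k0].
  rewrite (big_pred1 [ffun=> None]); last first.
    move=> f; apply/andP/eqP => [[_ /eqP/cards0_eq d0]|->].
      apply/ffunP => i; rewrite ffunE; case E: (f i) => [j|//].
      by have/setP/(_ i) := d0; rewrite !inE E.
    split; first by apply/pallP => i i' j; rewrite ffunE.
    by rewrite cards_eq0; apply/eqP/setP => i; rewrite !inE ffunE.
  by rewrite /pwt big1// => i _; rewrite ffunE.
rewrite [RHS](partition_big pdom (fun I : {set _} => #|I| == k)) /=; last by move=> f /andP[].
apply: eq_bigr => I /eqP cI.
rewrite [RHS](partition_big pimg (fun I : {set _} => #|I| == k)) /=; last first.
  by move=> f /andP[/andP[pf /eqP cf] _]; rewrite card_pimg// cf.
apply: eq_bigr => J /eqP cJ.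
rewrite per_sq_minor ?cI ?cJ ?lt0n//; apply: eq_bigl => f.
by case: (pdom f =P I) => [->|]; rewrite ?cI ?eqxx ?andbT// !andbF.
Qed.

Lemma per_k_ge0 A k : (forall i j, 0 <= A i j) -> 0 <= per_k A k.
Proof.
move=> A0; rewrite per_kE sumr_ge0// => f _; rewrite /pwt prodr_ge0// => i _.
by case: (f i).
Qed.

Lemma per_k_gt A k : (n < k)%N -> per_k A k = 0.
Proof.
move=> nk; rewrite per_kE big_pred0// => f; apply/negbTE; rewrite negb_and.
apply/orP; right; rewrite neq_ltn; apply/orP; left; apply: leq_ltn_trans nk.
by rewrite -[leqRHS]card_ord max_card.
Qed.

Lemma per_k0 A : per_k A 0 = 1.
Proof. by []. Qed.

Lemma pwt_scale (K : comNzRingType) (b b' : 'I_n -> 'I_n -> K) (z : K) f :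
  (forall i j, b i j = z * b' i j) ->
  pwt b f = z ^+ #|pdom f| * pwt b' f.
Proof.
move=> bz; rewrite /pwt (bigID (fun i => i \in pdom f)) /=.
rewrite [in RHS](bigID (fun i => i \in pdom f)) /=.
rewrite [X in _ * X]big1 ?mulr1; last by move=> i; rewrite inE negbK => /eqP ->.
rewrite [X in _ = _ * (_ * X)]big1 ?mulr1; last by move=> i; rewrite inE negbK => /eqP ->.
rewrite -prodr_const -big_split /=; apply: eq_bigr => i.
by rewrite inE; case: (f i) => [j|//]; rewrite bz.
Qed.

(** The morphism allows evaluation of the same polynomial at real and at complex z. *)
Lemma msum_per_k (K : comNzRingType) (phi : {rmorphism R -> K}) A (z : K) :
  msum (fun=> 1) (bip (fun i j => z * phi (A i j))) [set: 'I_n + 'I_n]%SET =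
  \sum_(k < n.+1) phi (per_k A k) * z ^+ k.
Proof.
rewrite (_ : [set: _]%SET = bset [set: 'I_n]%SET [set: 'I_n]%SET); last first.
  by apply/setP => -[i|j]; rewrite !inE.
rewrite msum_pinj (partition_big (fun f => inord #|pdom f| : 'I_n.+1) xpredT) //=.
apply: eq_bigr => k _; rewrite per_kE rmorph_sum/= mulr_suml; apply: eq_big => [f|f].
  congr (_ && _); rewrite -val_eqE /= inordK// ltnS -[leqRHS]card_ord max_card//.
move=> /andP[_ /eqP <-]; rewrite (pwt_scale (b' := fun i j => phi (A i j)) (z := z))//.
rewrite inordK ?ltnS -1?[leqRHS]card_ord ?max_card// mulrC; congr (_ * _).
by rewrite /pwt rmorph_prod; apply: eq_bigr => i _; case: (f i) => //; rewrite rmorph1.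
Qed.

Definition matching_gen A (z : R) : R := \sum_(k < n.+1) per_k A k * z ^+ k.

Lemma nu_sum A (z : R) : (forall i j, 0 <= A i j) ->
  \sum_(k < (nu A).+1) per_k A k * z ^+ k = matching_gen A z.
Proof.
move=> A0; rewrite /matching_gen.
have len : (nu A <= n)%N by apply/bigmax_leqP => k _; rewrite -ltnS.
rewrite (big_ord_widen n.+1 (fun k => per_k A k * z ^+ k)) ?ltnS//.
rewrite [RHS](bigID (fun k : 'I__ => (k < (nu A).+1)%N)) /= [X in _ = _ + X]big1 ?addr0// => k.
rewrite -leqNgt => nuk; have [Ak|] := ltP 0 (per_k A k).
  by have := @leq_bigmax_cond _ (fun k : 'I_n.+1 => 0 < per_k A k) (fun k => nat_of_ord k) k Ak; rewrite -/(nu A) leqNgt nuk.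
by move=> Ak; rewrite (_ : per_k A k = 0) ?mul0r//; apply/eqP; rewrite eq_le Ak per_k_ge0.
Qed.

End PermMinor.

(** * Real-rootedness and ultra log-concavity *)

Section RealRooted.
Variables (R : realType) (n : nat) (A : 'M[R]_n).
Hypothesis A0 : forall i j, 0 <= A i j.
Local Open Scope complex_scope.

Definition matching_poly : {poly R} := \poly_(k < n.+1) per_k A k.

(** If s ^+ 2 = z^-1, scaling by s turns the edge weights z A into A and the vertex weights 1 into
    s, so P(z) = 0 forbids a positive real part of s. This holds for both square roots, which are
    therefore imaginary, and z is negative. *)
Lemma matching_poly_root (z : R[i]) : root (map_poly (real_complex R) matching_poly) z -> z < 0.
Proof.
have E : (map_poly (real_complex R) matching_poly).[z] =
    msum (fun=> 1) (bip (fun i j => z * (A i j)%:C)) [set: 'I_n + 'I_n]%SET.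
  rewrite (msum_per_k (real_complex R : {rmorphism R -> R[i]})).
  rewrite /matching_poly poly_def rmorph_sum horner_sum; apply: eq_bigr => k _.
  by rewrite /= map_polyZ map_polyXn hornerZ hornerXn.
rewrite /root E => /eqP P0.
have z0 : z != 0.
  apply/eqP => z0; move: P0; rewrite z0 (msum_per_k (real_complex R : {rmorphism R -> R[i]})).
  rewrite big_ord_recl /= expr0 mulr1 big1 ?addr0.
    by move=> /eqP; rewrite rmorph1 oner_eq0.
  by move=> i _; rewrite expr0n mulr0.
have S (s : R[i]) : s ^+ 2 = z^-1 -> ~~ (0 < 'Re s).
  move=> sz; apply/negP => s0.
  have [] := @msum_stable _ _ (fun=> s) (bip (fun i j => (A i j)%:C)) _ _ _ [set: 'I_n + 'I_n]%SET.
  - by [].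
  - by move=> [i|j] [i'|j'] //=; rewrite ler0c.
  - exact: bip_sym.
  rewrite (@eq_msum _ _ _ (fun=> s * 1) _ (fun u v => s ^+ 2 * bip (fun i j => z * (A i j)%:C) u v)).
  - by rewrite (msum_scale (fun=> 1)) P0 mulr0 eqxx.
  - by move=> u _; rewrite mulr1.
  - by move=> [i|j] [i'|j'] _ _ //=; rewrite ?mulr0// sz mulKf.
have Re0 : 'Re (sqrtC z^-1) = 0.
  have := Creal_Re (sqrtC z^-1).
  case/real_ltgt0P => // H.
    by have := S _ (sqrtCK _); rewrite H.
  by have := S (- sqrtC z^-1); rewrite sqrrN raddfN/= oppr_gt0 H => /(_ (sqrtCK _)).
have : z^-1 <= 0.
  rewrite -[z^-1]sqrtCK [sqrtC _]Crect Re0 add0r exprMn sqrCi mulN1r oppr_le0.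
  by rewrite -realEsqr Creal_Im.
by rewrite le_eqVlt invr_eq0 (negbTE z0) /= invr_lt0.
Qed.

(** The roots are negative reals, so l is minus the inverse of a root; the constant coefficient 1
    fixes the scalar in front. *)
Lemma matching_poly_factor : exists s : seq R, all (fun l => 0 < l) s /\
  matching_poly = \prod_(l <- s) (1 + l *: 'X).
Proof.
pose f := real_complex R : {rmorphism R -> R[i]}.
have [r pr] := closed_field_poly_normal (map_poly f matching_poly).
have p0 : matching_poly`_0 = 1 by rewrite coef_poly.
have lc0 : lead_coef (map_poly f matching_poly) != 0.
  by rewrite lead_coef_eq0 map_poly_eq0; apply: contra_eq_neq p0 => ->; rewrite coef0 eq_sym oner_eq0.
have rneg z : z \in r -> z < 0.
  move=> zr; apply: matching_poly_root; rewrite pr /root hornerZ horner_prod mulf_eq0.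
  apply/orP; right.
  by rewrite prodf_seq_eq0; apply/hasP; exists z => //=; rewrite !hornerE subrr.
have rC z : z \in r -> exists2 k : R, z = k%:C & k < 0.
  move=> zr; have zn := rneg _ zr; have /complex_realP[k zk] := ltr0_real zn.
  by exists k => //; rewrite -ltcR -zk.
pose s := [seq - (complex.Re z)^-1 | z <- r].
exists s; split.
  apply/allP => _ /mapP[z zr ->]; have [k -> k0] := rC _ zr.
  by rewrite /= oppr_gt0 invr_lt0.
have fac (z : R[i]) : z \in r -> 'X - z%:P = (- z)%:P * map_poly f (1 + (- (complex.Re z)^-1) *: 'X).
  move=> zr; have [k -> k0] := rC _ zr; rewrite rmorphD rmorph1 /= map_polyZ map_polyX.
  rewrite polyCN mulrDr mulr1 addrC; congr (_ + _).
  rewrite -polyCN mul_polyC scalerA rmorphN mulrNN fmorphV/= divff ?scale1r//.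
  by rewrite fmorph_eq0 lt_eqF.
have E : map_poly f matching_poly = (lead_coef (map_poly f matching_poly) * \prod_(z <- r) - z)
    *: map_poly f (\prod_(l <- s) (1 + l *: 'X)).
  rewrite [LHS]pr -scalerA; congr (_ *: _).
  rewrite big_map rmorph_prod/= -mul_polyC rmorph_prod/= -big_split/=.
  by rewrite big_seq [RHS]big_seq; apply: eq_bigr => z /fac.
have C1 : lead_coef (map_poly f matching_poly) * \prod_(z <- r) - z = 1.
  have q0 : (\prod_(l <- s) (1 + l *: 'X))`_0 = 1.
    rewrite -horner_coef0 horner_prod big1// => l _.
    by rewrite !hornerE.
  move/(congr1 (fun q : {poly _} => q.[0])): E.
  by rewrite hornerZ !horner_coef0 !coef_map/= p0 q0 rmorph1 mulr1.
by move: E; rewrite C1 scale1r => /map_poly_inj.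
Qed.

End RealRooted.

(** * Newton's inequalities and the extraction of a coefficient *)

Section UltraLogConcave.
Variable R : realType.
Implicit Types (s : seq R) (k m : nat).

(* [ncoef s k] is the coefficient of degree k of the product of the
   [1 + l 'X], l in s, divided by 'C(size s, k) *)
Fixpoint ncoef s k : R :=
  if s isn't l :: s' then (k == 0)%:R else
  (((size s)%:R - k%:R) * ncoef s' k + k%:R * l * ncoef s' k.-1) / (size s)%:R.

Lemma ncoef_gt s k : (size s < k)%N -> ncoef s k = 0.
Proof.
elim: s k => [|l s IH] k /=; first by case: k.
move=> lt; rewrite (IH k) 1?(ltn_trans _ lt)// IH; last by case: k lt.
by rewrite !mulr0 addr0 mul0r.
Qed.

Lemma ncoefE s k : (\prod_(l <- s) (1 + l *: 'X))`_k = 'C(size s, k)%:R * ncoef s k.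
Proof.
elim: s k => [|l s IH] k; first by rewrite big_nil coef1 /=; case: k => [|k]; rewrite ?bin0 ?mulr1 ?mulr0.
rewrite big_cons mulrDl mul1r coefD -scalerAl coefZ coefXM !IH.
set N := (size s).+1; have N0 : N%:R != 0 :> R by rewrite pnatr_eq0.
have [le|lt] := leqP k N; last first.
  rewrite (@ncoef_gt (l :: s))// (@ncoef_gt s k) 1?(ltn_trans _ lt)//.
  by case: k lt => // k lt; rewrite /= (@ncoef_gt s k)// !mulr0 addr0.
rewrite /= -/N.
have E1 : 'C(size s, k)%:R = 'C(N, k)%:R * (N%:R - k%:R) / N%:R :> R.
  have := mul_bin_down N k; rewrite /= => /(congr1 (fun x => x%:R : R)).
  rewrite !natrM natrB// => e; apply: (mulfI N0); rewrite e; field; exact: N0.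
rewrite E1; case: k le E1 => [|k] le E1 /=.
  by rewrite subr0 !mul0r !mulr0 !addr0; field; exact: N0.
have E2 : 'C(size s, k)%:R = 'C(N, k.+1)%:R * k.+1%:R / N%:R :> R.
  have := mul_bin_diag N k; rewrite /= => /(congr1 (fun x => x%:R : R)).
  rewrite !natrM => e; apply: (mulfI N0); rewrite e; field; exact: N0.
by rewrite E2; field; exact: N0.
Qed.

Lemma ncoef_gt0 s k : all (fun l => 0 < l) s -> (k <= size s)%N -> 0 < ncoef s k.
Proof.
elim: s k => [|l s IH] k /=; first by case: k.
move=> /andP[l0 s0] le; rewrite divr_gt0 ?ltr0n//.
have [lt|] := ltnP k (size s).+1.
  rewrite ltr_wpDr ?mulr_gt0 ?IH ?subr_gt0 ?ltr_nat//.
  case: k lt le => [|k] lt le /=; first by rewrite !mul0r.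
  by rewrite !mulr_ge0// ltW ?IH// ltnW.
move=> lek; have -> : k = (size s).+1 by apply/eqP; rewrite eqn_leq le.
by rewrite subrr mul0r add0r /= !mulr_gt0 ?ltr0n// IH.
Qed.

(** Induction on the factors. With bm, b0, b1, b2 the normalized coefficients of s in degrees k - 1
    to k + 2, x = k and q = N - (k + 1), the defect times N ^+ 2 is a nonnegative combination of
    three defects of s plus the square of b1 - l b0. *)
Lemma ncoef_newton s k : all (fun l => 0 < l) s ->
  ncoef s k * ncoef s k.+2 <= ncoef s k.+1 ^+ 2.
Proof.
elim: s k => [|l s IH] k; first by rewrite /= mulr0 sqr_ge0.
move=> /[dup] ls0 /andP[/= l0 s0].
have [lt|ge] := ltnP (size s) k.+1.
  have [/= ->] : ncoef (l :: s) k.+2 = 0 by rewrite ncoef_gt.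
  by rewrite mulr0 sqr_ge0.
set N := (size s).+1; have N0 : 0 < N%:R :> R by rewrite ltr0n.
have b1 := ncoef_gt0 s0 ge; have b0 := ncoef_gt0 s0 (ltnW ge).
have lc1 := IH k s0; rewrite /= -/N.
set q : R := N%:R - k.+1%:R.
have q1 : 1 <= q by rewrite /q lerBrDr addrC natr1 ler_nat ltnS.
have -> : N%:R - k%:R = q + 1 by rewrite /q -natr1; ring.
have -> : N%:R - k.+2%:R = q - 1 by rewrite /q -[k.+2]addn1 natrD; ring.
have b2 : 0 <= ncoef s k.+2.
  by have [/ncoef_gt->//|/(ncoef_gt0 s0)/ltW] := ltnP (size s) k.+2.
(* bm is the coefficient of degree k - 1, taken to be 0 when k = 0, where the recursion multiplies
   it by 0. The crossed inequality is the product of two consecutive Newton inequalities, with the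
   positive factor b0 b1 cancelled. *)
have [bm [bm0 lc0 lcx kbm]] : exists bm : R, [/\ 0 <= bm, bm * ncoef s k.+1 <= ncoef s k ^+ 2,
    bm * ncoef s k.+2 <= ncoef s k * ncoef s k.+1 & k%:R * ncoef s k.-1 = k%:R * bm].
  case: k => [|k] in ge b1 b0 lc1 b2 q q1 *.
    exists 0; rewrite !mul0r; split => //; first exact: sqr_ge0.
    by rewrite mulr_ge0 ?ltW.
  exists (ncoef s k); have bk := ncoef_gt0 s0 (ltnW (ltnW ge)); have lc0 := IH k s0.
  split => //; first exact: ltW.
  rewrite -(ler_pM2l (mulr_gt0 b0 b1)).
  apply: (@le_trans _ _ ((ncoef s k.+1 ^+ 2) * (ncoef s k.+2 ^+ 2))); last first.
    by rewrite expr2 expr2 le_eqVlt; apply/orP; left; apply/eqP; ring.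
  rewrite [leLHS](_ : _ = (ncoef s k * ncoef s k.+2) * (ncoef s k.+1 * ncoef s k.+3)); last by ring.
  by apply: ler_pM => //; apply: mulr_ge0 => //; exact: ltW.
have kE : k%:R * l * ncoef s k.-1 = k%:R * l * bm by rewrite mulrAC kbm mulrAC.
rewrite kE; move: (ncoef s k.+2) (ncoef s k.+1) (ncoef s k) b0 b1 b2 lc1 lc0 lcx => b2 b1 b0.
move=> p0 p1 p2 lc1 lc0 lcx.
rewrite [leLHS](_ : _ = ((q + 1) * b0 + k%:R * l * bm) *
   ((q - 1) * b2 + k.+2%:R * l * b1) / N%:R ^+ 2); last by field; rewrite gt_eqF.
rewrite expr_div_n ler_pM2r ?invr_gt0 ?exprn_gt0// -subr_ge0.
rewrite -[k.+2]addn2 -[k.+1]addn1 !natrD.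
have : 0 <= k%:R :> R by []; move: (k%:R) => x x0.
have h1 : 0 <= (q^+2 - 1) * (b1 ^+ 2 - b0 * b2).
  by rewrite mulr_ge0// subr_ge0// exprn_ege1.
have h2 : 0 <= l ^+2 * (x * (x+2)) * (b0 ^+ 2 - bm * b1).
  apply: mulr_ge0; last by rewrite subr_ge0.
  by apply: mulr_ge0; [exact: sqr_ge0 | rewrite mulr_ge0// addr_ge0].
have h3 : 0 <= l * x * (q - 1) * (b0 * b1 - bm * b2).
  apply: mulr_ge0; last by rewrite subr_ge0.
  by apply: mulr_ge0; [apply: mulr_ge0 => //; exact: ltW | rewrite subr_ge0].
have h4 : 0 <= (b1 - l * b0) ^+ 2 by exact: sqr_ge0.
rewrite [X in 0 <= X](_ : _ = (q^+2 - 1) * (b1 ^+ 2 - b0 * b2) +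
  l ^+2 * (x * (x+2)) * (b0 ^+ 2 - bm * b1) + l * x * (q - 1) * (b0 * b1 - bm * b2)
  + (b1 - l * b0) ^+ 2); last by ring.
by rewrite !addr_ge0.
Qed.

Lemma ncoef_ratio s i j : all (fun l => 0 < l) s -> (i <= j)%N -> (j <= size s)%N ->
  ncoef s j.+1 * ncoef s i <= ncoef s i.+1 * ncoef s j.
Proof.
move=> s0 ij js; elim: j ij js => [|j IH] ij js.
  by move: ij; rewrite leqn0 => /eqP ->.
move: ij; rewrite leq_eqVlt => /predU1P[->//|]; rewrite ltnS => ij.
have {}IH := IH ij (ltnW js); have lc := ncoef_newton j s0.
have bj := ncoef_gt0 s0 (ltnW js); have bj1 := ncoef_gt0 s0 js.
have bi := ncoef_gt0 s0 (leq_trans ij (ltnW js)).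
rewrite -(ler_pM2l bj).
apply: (@le_trans _ _ (ncoef s j.+1 ^+ 2 * ncoef s i)).
  by rewrite mulrA ler_pM2r.
rewrite [leLHS](_ : _ = ncoef s j.+1 * ncoef s i * ncoef s j.+1); last by ring.
rewrite [leRHS](_ : _ = ncoef s i.+1 * ncoef s j * ncoef s j.+1); last by ring.
by rewrite ler_pM2r.
Qed.

(** r is the ratio of the coefficients at k + 1 and k, or at k and k - 1 when k is the last index.
    Ratios decrease, so r is above the later ones and below the earlier ones. *)
Lemma ncoef_geom s k : all (fun l => 0 < l) s -> (k <= size s)%N ->
  exists2 r : R, 0 < r &
  forall j, (j <= size s)%N -> ncoef s j * r ^+ k <= ncoef s k * r ^+ j.
Proof.
move=> s0 ks.
have pos j : (j <= size s)%N -> 0 < ncoef s j by exact: ncoef_gt0.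
have [r r0 [rup rdown]] : exists2 r : R, 0 < r &
    (forall j, (k <= j < size s)%N -> ncoef s j.+1 <= r * ncoef s j) /\
    (forall j, (j < k)%N -> r * ncoef s j <= ncoef s j.+1).
  have [klt|kge] := ltnP k (size s).
    exists (ncoef s k.+1 / ncoef s k); first by rewrite divr_gt0 ?pos.
    split => j.
      move=> /andP[kj js]; rewrite mulrAC ler_pdivlMr ?pos//.
      by apply: ncoef_ratio => //; exact: ltnW.
    move=> jk; rewrite mulrAC ler_pdivrMr ?pos//.
    by apply: ncoef_ratio => //; exact: ltnW.
  have {kge} ks' : k = size s by apply/eqP; rewrite eqn_leq ks.
  case: k ks ks' => [|k] ks ks'; first by exists 1 => //; split => j; rewrite -?ks'// andbC.
  exists (ncoef s k.+1 / ncoef s k); first by rewrite divr_gt0 ?pos// ltnW.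
  split => j; first by rewrite -ks' => /andP[]; rewrite leqNgt => /negbTE ->.
  rewrite ltnS => jk; rewrite mulrAC ler_pdivrMr ?pos 1?ltnW//.
  by apply: ncoef_ratio => //; exact: ltnW.
exists r => // j js; have [kj|jk] := leqP k j.
  elim: j kj js => [|j IH] kj js; first by move: kj; rewrite leqn0 => /eqP ->.
  move: kj; rewrite leq_eqVlt => /predU1P[<-//|]; rewrite ltnS => kj.
  apply: (@le_trans _ _ (r * ncoef s j * r ^+ k)).
    by rewrite ler_pM2r ?exprn_gt0// rup// kj.
  by rewrite -mulrA [in leRHS]exprS [leRHS]mulrCA ler_pM2l// IH// ltnW.
suff H d : (d + j <= k)%N -> ncoef s j * r ^+ (d + j) <= ncoef s (d + j) * r ^+ j.
  by have := H (k - j)%N; rewrite subnK ?leqnn; [exact | exact: ltnW].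
elim: d => [//|d IH] le; rewrite addSn exprS mulrCA.
apply: (@le_trans _ _ (r * (ncoef s (d + j) * r ^+ j))).
  by rewrite ler_pM2l// IH// ltnW.
by rewrite mulrA ler_pM2r ?exprn_gt0// rdown.
Qed.

(** The limit x -> 0, made explicit by (1 + x) ^+ m <= 1 + 3 ^+ m * x on [0, 1]. It is used for k =
    0 and k = N, where the best z is 0 or infinite. *)
Lemma le_of_le_mul_expr (K b : R) m : 0 <= b ->
  (forall x, 0 < x -> K <= b * (1 + x) ^+ m) -> K <= b.
Proof.
move=> b0 H; apply/ler_addgt0Pr => e e0.
have expr_le (x : R) : 0 < x -> x <= 1 -> (1 + x) ^+ m <= 1 + 3 ^+ m * x.
  move=> x0 x1; elim: m {H} => [|k IH]; first by rewrite !expr0 mul1r lerDl ltW.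
  rewrite exprS; apply: (@le_trans _ _ ((1 + x) * (1 + 3 ^+ k * x))).
    by rewrite ler_pM2l// addr_gt0.
  rewrite exprS; have : 1 <= 3 ^+ k :> R by rewrite exprn_ege1// ler1n.
  move: (3 ^+ k) => t t1.
  have h1 : 0 <= x * (t - 1) by rewrite mulr_ge0 ?subr_ge0// ltW.
  have h2 : 0 <= t * x * (1 - x).
    by rewrite mulr_ge0 ?subr_ge0// mulr_ge0// ?ltW// (lt_le_trans ltr01).
  lra.
have t0 : 0 < 3 ^+ m :> R by rewrite exprn_gt0.
pose x := Num.min 1 (e / ((b + 1) * 3 ^+ m)).
have b1 : 0 < b + 1 by rewrite ltr_wpDl.
have x0 : 0 < x by rewrite lt_min ltr01 divr_gt0// mulr_gt0.
apply: (le_trans (H x x0)).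
apply: (@le_trans _ _ (b * (1 + 3 ^+ m * x))).
  by rewrite ler_wpM2l// expr_le// ge_min lexx.
rewrite mulrDr mulr1 lerD2l.
apply: (@le_trans _ _ ((b + 1) * (3 ^+ m * (e / ((b + 1) * 3 ^+ m))))).
  apply: ler_pM => //; first by rewrite mulr_ge0 ?ltW.
    by rewrite lerDl.
  by rewrite ler_pM2l// ge_min lexx orbT.
by rewrite le_eqVlt; apply/orP; left; apply/eqP; field; rewrite !gt_eqF.
Qed.

Lemma coef_bound s k (K : R) : all (fun l => 0 < l) s -> (k <= size s)%N ->
  (forall z, 0 < z -> K * z ^+ k <= (\prod_(l <- s) (1 + l *: 'X)).[z]) ->
  bin_b (size s) k (k%:R / (size s)%:R) * K <= (\prod_(l <- s) (1 + l *: 'X))`_k.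
Proof.
move=> s0 ks H; set N := size s.
have bk := ncoef_gt0 s0 ks; have [r r0 Hr] := ncoef_geom s0 ks.
have Hz z : 0 < z -> K * z ^+ k * r ^+ k <= ncoef s k * (1 + r * z) ^+ N.
  move=> z0; apply: (@le_trans _ _ ((\prod_(l <- s) (1 + l *: 'X)).[z] * r ^+ k)).
    by rewrite ler_pM2r ?exprn_gt0// H.
  rewrite (@horner_coef_wide _ N.+1); last first.
    apply/leq_sizeP => j Nj; rewrite ncoefE ncoef_gt ?mulr0//.
  rewrite exprDn mulr_suml mulr_sumr; apply: ler_sum => j _.
  rewrite ncoefE expr1n mul1r exprMn -mulr_natl.
  rewrite [leLHS](_ : _ = ('C(N, j)%:R * z ^+ j) * (ncoef s j * r ^+ k)); last by ring.
  rewrite [leRHS](_ : _ = ('C(N, j)%:R * z ^+ j) * (ncoef s k * r ^+ j)); last by ring.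
  by rewrite ler_wpM2l ?Hr -1?ltnS// mulr_ge0// exprn_ge0// ltW.
have Hx x : 0 < x -> K * x ^+ k <= ncoef s k * (1 + x) ^+ N.
  move=> x0; have := Hz (x / r); rewrite divr_gt0// => /(_ isT).
  rewrite -mulrA -exprMn divfK ?gt_eqF// mulrCA divff ?mulr1// gt_eqF//.
rewrite ncoefE -/N /bin_b -!mulrA ler_wpM2l//.
have [k0|k0] := posnP k.
  rewrite k0 mul0r expr0 mul1r subr0 expr1n mul1r -k0.
  apply: (@le_of_le_mul_expr _ _ N); first exact: ltW.
  by move=> x /Hx; rewrite k0 expr0 mulr1.
have [ltk|gek] := ltnP k N; last first.
  have kN : k = N by apply/eqP; rewrite eqn_leq ks.
  rewrite kN divff ?pnatr_eq0 -?kN -?lt0n// subrr subnn expr0 expr1n !mul1r.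
  apply: (@le_of_le_mul_expr _ _ N); first exact: ltW.
  move=> x x0; have := Hx x^-1; rewrite invr_gt0 => /(_ x0).
  rewrite -(ler_pM2r (exprn_gt0 N x0)) kN -!mulrA -!exprMn mulVf ?gt_eqF//.
  by rewrite expr1n mulr1 mulrDl mul1r mulVf ?gt_eqF// addrC.
have N0 : 0 < N%:R :> R by rewrite ltr0n (leq_trans _ ltk).
have c0 : 0 < (N - k)%:R :> R by rewrite ltr0n subn_gt0.
have kp : 0 < k%:R :> R by rewrite ltr0n.
(* At x = k / (N - k) the binomial law of parameter x / (1 + x) = k / N has mean k. *)
have := Hx (k%:R / (N - k)%:R); rewrite divr_gt0// => /(_ isT).
have NE : N%:R = k%:R + (N - k)%:R :> R by rewrite -natrD subnKC// ltnW.
have -> : 1 + k%:R / (N - k)%:R = N%:R / (N - k)%:R :> R.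
  by rewrite NE; field; rewrite gt_eqF.
have -> : 1 - k%:R / N%:R = (N - k)%:R / N%:R :> R.
  by rewrite NE; field; rewrite -NE gt_eqF.
rewrite !expr_div_n => le.
have q0 : 0 < (N - k)%:R ^+ N / N%:R ^+ N :> R by rewrite divr_gt0 ?exprn_gt0.
rewrite -(ler_pM2r q0) in le.
have EN : N = (k + (N - k))%N by rewrite subnKC// ltnW.
have e1 : (N - k)%:R ^+ N = (N - k)%:R ^+ k * (N - k)%:R ^+ (N - k) :> R by rewrite -exprD -EN.
have e2 : N%:R ^+ N = N%:R ^+ k * N%:R ^+ (N - k) :> R by rewrite -exprD -EN.
apply: le_trans (le_trans le _); rewrite le_eqVlt; apply/orP; left; apply/eqP.
  by rewrite e1 e2; field; rewrite !expf_neq0 ?gt_eqF.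
by field; rewrite !expf_neq0 ?gt_eqF.
Qed.

End UltraLogConcave.

Section PerKBound.
Variables (R : realType) (n : nat) (A : 'M[R]_n).
Hypothesis A0 : forall i j, 0 <= A i j.

Lemma matching_polyE z : (matching_poly A).[z] = matching_gen A z.
Proof.
rewrite /matching_poly horner_poly; exact: eq_bigr.
Qed.

Lemma per_k_bound k (K : R) : (k <= nu A)%N ->
  (forall z, 0 < z -> K * z ^+ k <= matching_gen A z) ->
  bin_b (nu A) k (k%:R / (nu A)%:R) * K <= per_k A k.
Proof.
have [s [s0 ps]] := matching_poly_factor A0.
have cf j : per_k A j = (\prod_(l <- s) (1 + l *: 'X))`_j.
  rewrite -ps /matching_poly coef_poly; case: ltnP => // nj; exact: per_k_gt.
(* All the l are positive, so the coefficients are positive exactly up to the number of factors. *)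
have nuE : nu A = size s.
  apply/eqP; rewrite eqn_leq; apply/andP; split.
    apply/bigmax_leqP => j; rewrite cf ncoefE; apply: contraTT.
    by rewrite -ltnNge => /ncoef_gt ->; rewrite mulr0 ltxx.
  have ps0 : 0 < per_k A (size s).
    by rewrite cf ncoefE binn mul1r ncoef_gt0.
  have lt : (size s < n.+1)%N.
    by rewrite ltnNge; apply/negP => /per_k_gt pk; rewrite pk ltxx in ps0.
  exact: (@leq_bigmax_cond _ (fun k : 'I_n.+1 => 0 < per_k A k) (fun k => nat_of_ord k) (Ordinal lt)).
move=> kn H; rewrite nuE cf; apply: coef_bound => //; first by rewrite -nuE.
by move=> z /H; rewrite -matching_polyE ps.
Qed.

End PerKBound.

(** * The Bethe lower bound *)

Section EntropyBound.
Variable R : realType.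
Implicit Types (a x K : R).

Lemma xlnx0 : xlnx (0 : R) = 0. Proof. by rewrite /xlnx eqxx. Qed.
Lemma xlnx1 : xlnx (1 : R) = 0. Proof. by rewrite /xlnx oner_eq0 ln1 mulr0. Qed.
Lemma xlnxE x : xlnx x = x * ln x.
Proof. by rewrite /xlnx; case: eqP => // ->; rewrite mul0r. Qed.

(** One term of Gibbs' inequality, from 1 + y <= expR y; summed over a probability vector a, the
    right-hand sides cancel. *)
Lemma gibbs1 a q Z : 0 <= a -> 0 < Z -> a * q - xlnx a - a * ln Z <= expR q / Z - a.
Proof.
rewrite le_eqVlt => /predU1P[<-|a0] Z0.
  by rewrite !mul0r xlnx0 !subr0 ltW// divr_gt0 ?expR_gt0.
rewrite xlnxE -!mulrBr.
have := expR_ge1Dx (q - ln a - ln Z); rewrite -(ler_pM2l a0) mulrDr mulr1 -lerBrDl => h.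
apply: (le_trans h); rewrite lerD2r !expRD !expRN !lnK//.
by rewrite mulrCA mulrA -(mulrA (expR q)) mulVf ?gt_eqF// mulr1.
Qed.

(** The star: the right-hand side is its matching sum, and the outcome where the centre is unmatched
    has weight 1 and probability 1 - \sum_i al i. *)
Lemma gibbs_sum (I : finType) (al p : I -> R) :
  (forall i, 0 <= al i) -> \sum_i al i <= 1 ->
  expR (\sum_i al i * p i - \sum_i xlnx (al i) - xlnx (1 - \sum_i al i))
  <= 1 + \sum_i expR (p i).
Proof.
move=> al0 al1; set Z := 1 + \sum_i expR (p i); set s := \sum_i al i in al1 *.
have Z0 : 0 < Z.
  by rewrite /Z ltr_wpDr ?ltr01//; apply: sumr_ge0 => i _; exact: expR_ge0.
rewrite -[leRHS](lnK Z0) ler_expR -subr_le0.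
have h i := gibbs1 (p i) (al0 i) Z0.
have h0 : (1 - s) * 0 - xlnx (1 - s) - (1 - s) * ln Z <= expR 0 / Z - (1 - s).
  by apply: gibbs1; rewrite ?subr_ge0.
have hs : \sum_i (al i * p i - xlnx (al i) - al i * ln Z) <= \sum_i (expR (p i) / Z - al i).
  exact: ler_sum.
have e1 : \sum_i (expR (p i) / Z - al i) = (Z - 1) / Z - s.
  by rewrite sumrB -mulr_suml /Z addrAC subrr add0r.
rewrite e1 !sumrB -mulr_suml -/s in hs.
rewrite mulr0 sub0r expR0 in h0.
have e2 : (Z - 1) / Z - s + (1 / Z - (1 - s)) = 0.
  by field; rewrite gt_eqF.
by have := lerD hs h0; rewrite e2; apply: le_trans; rewrite le_eqVlt; apply/orP; left; apply/eqP; ring.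
Qed.

Lemma le_of_expR_tail a x K : (forall t, expR (K / 2) <= expR (a / 2) + expR (x + t)) -> K <= a.
Proof.
move=> H; suff : expR (K / 2) <= expR (a / 2) by rewrite ler_expR ler_pM2r.
apply/ler_addgt0Pr => e e0; apply: (le_trans (H (ln e - x))).
by rewrite (addrC x) subrK lnK.
Qed.

(* One joining step: two half-edges carrying e^p and e^q are glued into one edge
   of weight [om].  With p - q chosen to balance b e^p and c e^q, the condition
   bc <= ad turns the hypothesis into e^(K/2 + al t) <= sqrt a + sqrt d e^t. *)
Lemma join_edge (a b c d al om K : R) : 0 < a -> 0 < b -> 0 < c -> 0 < d ->
  b * c <= a * d -> 0 <= al <= 1 -> 0 <= om -> (om = 0 -> al = 0) ->
  (forall p q, expR (K + al * (p + q)) <=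
     a + expR p * b + expR q * (c + expR p * d)) ->
  expR (K + (xlnx al + xlnx (1 - al) + al * ln om)) <= a + om * d.
Proof.
move=> a0 b0 c0 d0 bcad /andP[al0 al1] om0 om_al H.
move: (lnK a0) (lnK b0) (lnK c0) (lnK d0).
move: (ln a) (ln b) (ln c) (ln d) => la lb lc ld Ea Eb Ec Ed.
have bc : lb + lc <= la + ld by rewrite -ler_expR !expRD Ea Eb Ec Ed.
have {}H t : expR (K / 2 + al * t) <= expR (la / 2) + expR (ld / 2 + t).
  have := H (t + (lc - lb) / 2) (t - (lc - lb) / 2).
  rewrite -Ea -Eb -Ec -Ed [in leRHS]mulrDr -!expRD => h.
  rewrite -(@ler_pXn2r _ 2) ?nnegrE ?addr_ge0 ?expR_ge0// -expRM_natr sqrrD -!expRM_natr -expRD.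
  have -> : (K / 2 + al * t) * 2 = K + al * (t + (lc - lb) / 2 + (t - (lc - lb) / 2)).
    by field.
  apply: (le_trans h); rewrite addrA addrAC.
  have -> : t + (lc - lb) / 2 + lb = la / 2 + (ld / 2 + t) + (lb + lc - la - ld) / 2 by field.
  have -> : t - (lc - lb) / 2 + lc = la / 2 + (ld / 2 + t) + (lb + lc - la - ld) / 2 by field.
  have -> : t - (lc - lb) / 2 + (t + (lc - lb) / 2 + ld) = (ld / 2 + t) * 2 by field.
  have -> : la / 2 * 2 = la by field.
  rewrite addrAC lerD2r -addrA lerD2l -mulr2n lerMn2r /= ler_expR.
  by move: bc; lra.
(* At the ends the best t is infinite: t -> +oo for al = 1 leaves K <= ln d, and t -> -oo for al = 0
   leaves K <= ln a. *)
move: al1; rewrite le_eqVlt => /predU1P[al1|al1].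
  have om1 : 0 < om.
    rewrite lt_neqAle om0 andbT eq_sym; apply/eqP => /om_al.
    by rewrite al1 => /eqP; rewrite oner_eq0.
  rewrite al1 subrr xlnx0 xlnx1 !add0r mul1r expRD lnK// mulrC.
  suff : K <= ld by rewrite -ler_expR Ed => /(ler_wpM2l om0)/le_trans; apply; rewrite lerDr ltW.
  apply: (@le_of_expR_tail _ (la / 2)) => t; have := H (- t).
  rewrite al1 mul1r -(ler_pM2r (expR_gt0 t)) mulrDl -!expRD !addrNK.
  by rewrite addrC.
move: al0; rewrite le_eqVlt => /predU1P[al0|al0].
  rewrite -al0 subr0 xlnx0 xlnx1 !add0r mul0r addr0.
  suff : K <= la by rewrite -ler_expR Ea => /le_trans; apply; rewrite lerDl mulr_ge0// ltW.
  apply: (@le_of_expR_tail _ (ld / 2)) => t; have := H t.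
  by rewrite -al0 mul0r addr0.
have om1 : 0 < om.
  rewrite lt_neqAle om0 andbT eq_sym; apply/eqP => /om_al.
  by move=> al_0; rewrite al_0 ltxx in al0.
have al1' : 0 < 1 - al by rewrite subr_gt0.
(* The optimal t, where sqrt d e^t is the fraction al of sqrt a + sqrt d e^t. What remains is Gibbs'
   inequality for two outcomes of weights a and om d. *)
have := H (la / 2 - ld / 2 + ln al - ln (1 - al)).
have -> : ld / 2 + (la / 2 - ld / 2 + ln al - ln (1 - al)) = la / 2 + (ln al - ln (1 - al)) by ring.
have -> : expR (la / 2) + expR (la / 2 + (ln al - ln (1 - al))) = expR (la / 2 - ln (1 - al)).
  by rewrite !expRD !expRN !lnK//; field; rewrite gt_eqF.
rewrite ler_expR => {}H.
have Z0 : 0 < a + om * d by rewrite addr_gt0// mulr_gt0.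
have g1 := gibbs1 la (ltW al1') Z0; have g2 := gibbs1 (ld + ln om) (ltW al0) Z0.
rewrite -[leRHS](lnK Z0) ler_expR.
rewrite expRD Ed lnK// in g2; rewrite Ea in g1.
have e : a / (a + om * d) - (1 - al) + (d * om / (a + om * d) - al) = 0.
  by field; rewrite gt_eqF.
have := lerD g1 g2; rewrite e !xlnxE.
move: H; lra.
Qed.

End EntropyBound.

(** * Gluing half-edges: the Bethe bound for a bipartite graph *)

Section BetheLower.
Variables (R : realType) (S T : finType).

Lemma msum_prod (K : comNzRingType) (V : finType) (h : V -> K) (U : {set V}) :
  msum h (fun _ _ => 0) U = \prod_(v in U) h v.
Proof.
have [m] := ubnP #|U|; elim: m => // m IH in U *; rewrite ltnS => leU.
have [->|/set0Pn[v vU]] := eqVneq U finset.set0; first by rewrite msum0 big_set0.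
have lt1 : (#|U :\ v| < m)%N by apply: leq_trans leU; rewrite [leqRHS](cardsD1 v) vU.
rewrite (@msumE _ _ h (fun _ _ => 0) _ U v)// big1 ?addr0 => [|u _]; last by rewrite mul0r.
by rewrite IH// [RHS](big_setD1 v).
Qed.

Variables (b x : S -> T -> R).
Hypothesis b0 : forall i j, 0 <= b i j.
Hypothesis x0 : forall i j, 0 <= x i j.
Hypothesis xrow : forall i, \sum_j x i j <= 1.
Hypothesis xcol : forall j, \sum_i x i j <= 1.
Hypothesis bx : forall i j, b i j = 0 -> x i j = 0.

(** A pendant half-edge has no other use than to match its vertex, so its weight is absorbed into
    the vertex weight. *)
Let hE (E : {set S * T}) (p q : S -> T -> R) (v : S + T) : R :=
  match v with
  | inl i => 1 + \sum_(j | (i, j) \notin E) expR (p i j)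
  | inr j => 1 + \sum_(i | (i, j) \notin E) expR (q i j)
  end.

Let wE (E : {set S * T}) := bip (fun i j => if (i, j) \in E then b i j else 0).

Let c0 : R :=
  \sum_i (- \sum_j xlnx (x i j) - xlnx (1 - \sum_j x i j)) +
  \sum_j (- \sum_i xlnx (x i j) - xlnx (1 - \sum_i x i j)).

(** The stars at both ends of an edge contribute - x ln x, while S^B has it only once; gluing gives
    one copy back, together with (1 - x) ln (1 - x) and the energy x ln b. *)
Let ke (e : S * T) : R :=
  xlnx (x e.1 e.2) + xlnx (1 - x e.1 e.2) + x e.1 e.2 * ln (b e.1 e.2).

Let hE_gt0 E p q v : 0 < hE E p q v.
Proof.
by case: v => k; rewrite /= ltr_pwDl// sumr_ge0// => l _; exact: expR_ge0.
Qed.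

Let wE_ge0 E u v : 0 <= wE E u v.
Proof. by case: u v => [i|j] [i'|j'] //=; case: ifP. Qed.

Let x_le1 i j : 0 <= x i j <= 1.
Proof.
rewrite x0 /=; apply: le_trans (xrow i); rewrite (bigD1 j)//= lerDl.
by apply: sumr_ge0.
Qed.

(* The edges in [E] are joined; an edge (i, j) outside [E] is cut into two pendant
   half-edges of weights expR (p i j) at i and expR (q i j) at j. *)
Lemma half_edges_bound (E : {set S * T}) (p q : S -> T -> R) :
  expR (c0 + \sum_(e in E) ke e + \sum_(e in ~: E) x e.1 e.2 * (p e.1 e.2 + q e.1 e.2))
  <= msum (hE E p q) (wE E) [set: S + T]%SET.
Proof.
have [m] := ubnP #|E|; elim: m => // m IH in E p q *; rewrite ltnS => leE.
have [->|/set0Pn[[i0 j0] eE]] := eqVneq E finset.set0.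
  rewrite (@eq_msum _ _ _ (hE finset.set0 p q) _ (fun _ _ => 0)) //; last first.
    by move=> [i|j] [i'|j'] _ _ //=; rewrite inE.
  rewrite msum_prod big_set0 addr0 finset.setC0 (eq_bigl xpredT); last by move=> v; rewrite inE.
  rewrite big_sumType /=.
  have -> : \sum_(e in [set: S * T]%SET) x e.1 e.2 * (p e.1 e.2 + q e.1 e.2) =
      \sum_i \sum_j x i j * p i j + \sum_j \sum_i x i j * q i j.
    rewrite (eq_bigl xpredT); last by move=> v; rewrite inE.
    under eq_bigr do rewrite mulrDr.
    rewrite big_split /=; congr (_ + _); first by rewrite pair_bigA.
    by rewrite exchange_big pair_bigA.
  rewrite /c0 addrACA -!big_split /= expRD !expR_sum.
  apply: ler_pM; [by apply: prodr_ge0 => i _; exact: expR_ge0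
                 |by apply: prodr_ge0 => i _; exact: expR_ge0 | |].
    apply: ler_prod => i _; rewrite expR_ge0 /=.
    have -> : \sum_(j | (i, j) \notin finset.set0) expR (p i j) = \sum_j expR (p i j).
      by apply: eq_bigl => j; rewrite inE.
    have := gibbs_sum (p i) (x0 i) (xrow i).
    by apply: le_trans; rewrite ler_expR le_eqVlt; apply/orP; left; apply/eqP; ring.
  apply: ler_prod => j _; rewrite expR_ge0 /=.
  have -> : \sum_(i | (i, j) \notin finset.set0) expR (q i j) = \sum_i expR (q i j).
    by apply: eq_bigl => i; rewrite inE.
  have := gibbs_sum (q^~ j) (x0^~ j) (xcol j).
  by apply: le_trans; rewrite ler_expR le_eqVlt; apply/orP; left; apply/eqP; ring.
pose E1 := E :\ (i0, j0).
have eE1 : (i0, j0) \notin E1 by rewrite !inE eqxx.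
have ltE : (#|E1| < m)%N by move: leE; rewrite (cardsD1 (i0, j0)) eE.
have wEs E' u v : wE E' u v = wE E' v u by exact: bip_sym.
set TT := [set: S + T]%SET.
have iT : inl i0 \in TT by rewrite inE.
have jT : inr j0 \in TT by rewrite inE.
have ij : inr j0 != inl i0 :> S + T by [].
have jT' : inr j0 \in TT :\ inl i0 by rewrite !inE.
have iT' : inl i0 \in TT :\ inr j0 by rewrite !inE.
set H := hE E p q; set P := msum H (wE E1).
have -> : msum H (wE E) TT = P TT + b i0 j0 * P (TT :\ inr j0 :\ inl i0).
  apply: msum_addw => //=; first by rewrite (negbTE eE1) eE add0r.
  move=> [i|j] [i'|j'] //= n1 n2; rewrite /E1 !inE xpair_eqE.
    case: eqP => [ii|//]; case: eqP => [jj|//]; move: n2; rewrite ii jj eqxx //.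
  case: eqP => [ii|//]; case: eqP => [jj|//]; move: n1; rewrite ii jj eqxx //.
rewrite (big_setD1 (i0, j0) eE) /= -/E1.
rewrite -addrA [X in expR X](_ : _ = c0 + \sum_(e in E1) ke e +
   \sum_(e in ~: E) x e.1 e.2 * (p e.1 e.2 + q e.1 e.2) + ke (i0, j0)); last by ring.
have Pgt U : 0 < P U by exact: msum_gt0 (hE_gt0 E p q) (wE_ge0 E1) (wEs E1) U.
(* a, b, c, d are the sums without neither end, without i0, without j0, and without both. The ends
   lie on opposite sides, so the correlation inequality reads b c <= a d. *)
apply: (@join_edge _ _ (P (TT :\ inl i0)) (P (TT :\ inr j0))) => //.
- have := @msum_corr _ _ H (wE E1) (wE_ge0 E1) (wEs E1)
    (fun v => if v is inl _ then true else false) _ TT _ _ jT iT ij.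
  by rewrite /= mulrC; apply; move=> [i|j] [i'|j'].
- exact: bx.
move=> s t.
(* The newly cut edge receives free weights s and t; since P is affine in each vertex weight, the
   induction hypothesis becomes the premise of [join_edge]. *)
pose p' i j := if (i, j) == (i0, j0) then s else p i j.
pose q' i j := if (i, j) == (i0, j0) then t else q i j.
have := IH E1 p' q' ltE.
pose H1 v := if v == inl i0 then H v + expR s else H v.
have hpE i : hE E1 p' q' (inl i) = H1 (inl i).
  rewrite /H1 /H /= (inj_eq (@inl_inj _ _)); case: eqP => [->|/eqP ii].
    rewrite (bigD1 j0)//= /p' eqxx addrCA addrC; congr (_ + _ + _).
    apply: eq_big => [j|j].
      rewrite !inE xpair_eqE eqxx /=; case: eqP => [->|_]; by rewrite ?eE ?andbT.
    by move=> /andP[_ jj]; rewrite xpair_eqE (negbTE jj) andbF.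
  congr (_ + _); apply: eq_big => [j|j _]; first by rewrite !inE xpair_eqE (negbTE ii).
  by rewrite /p' xpair_eqE (negbTE ii).
have hqE j : hE E1 p' q' (inr j) = if j == j0 then H1 (inr j) + expR t else H1 (inr j).
  rewrite /H1 /H /=; case: eqP => [->|/eqP ii].
    rewrite (bigD1 i0)//= /q' eqxx addrCA addrC; congr (_ + _ + _).
    apply: eq_big => [i|i].
      rewrite !inE xpair_eqE eqxx andbT; case: eqP => [->|_]; by rewrite ?eE ?andbT.
    by move=> /andP[_ jj]; rewrite xpair_eqE (negbTE jj).
  congr (_ + _); apply: eq_big => [i|i _]; first by rewrite !inE xpair_eqE (negbTE ii) andbF.
  by rewrite /q' xpair_eqE (negbTE ii) andbF.
rewrite (@msum_addh _ _ H1 (wE E1) (wEs E1) _ (expR t) TT (inr j0))//; last 2 first.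
- by rewrite hqE eqxx.
- by move=> [i _|j]; [rewrite hpE | rewrite hqE (inj_eq (@inr_inj _ _)) => /negbTE ->].
rewrite (@msum_addh _ _ H (wE E1) (wEs E1) _ (expR s) TT (inl i0))//; last 2 first.
- by rewrite /H1 eqxx.
- by move=> u ui; rewrite /H1 (negbTE ui).
rewrite (@msum_addh _ _ H (wE E1) (wEs E1) _ (expR s) (TT :\ inr j0) (inl i0))//; last 2 first.
- by rewrite /H1 eqxx.
- by move=> u ui; rewrite /H1 (negbTE ui).
apply: le_trans; rewrite ler_expR -!addrA !lerD2l [leLHS]addrC.
rewrite [leRHS](bigD1 (i0, j0)) /=; last by rewrite inE.
rewrite /p' /q' eqxx lerD2l le_eqVlt; apply/orP; left; apply/eqP.
apply: eq_big => [[i j]|[i j] eC].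
  by rewrite !inE; case: eqP => [->|_]; rewrite ?eE ?andbT.
by move: eC; rewrite inE /=; case: eqP => // -[-> ->]; rewrite eE.
Qed.

Lemma bethe_lower :
  expR (\sum_i \sum_j (x i j * ln (b i j) - xlnx (x i j) + xlnx (1 - x i j))
        - \sum_i xlnx (1 - \sum_j x i j) - \sum_j xlnx (1 - \sum_i x i j))
  <= msum (fun=> 1) (bip b) [set: S + T]%SET.
Proof.
have := @half_edges_bound [set: S * T]%SET (fun _ _ => 0) (fun _ _ => 0).
rewrite finset.setCT big_set0 addr0.
rewrite (@eq_msum _ _ _ (fun=> 1) _ (bip b)); first last.
- by move=> [i|j] [i'|j'] _ _ //=; rewrite inE.
- by move=> [i|j] _; rewrite /= big_pred0 ?addr0// => k; rewrite inE.
apply: le_trans; rewrite ler_expR le_eqVlt; apply/orP; left; apply/eqP.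
rewrite /c0 !sumrB !sumrN [in RHS](exchange_big _ _ _ _ _ (fun j i => xlnx (x i j))) /=.
rewrite [X in _ = _ + X](_ : _ = \sum_i \sum_j ke (i, j)); last first.
  by rewrite pair_bigA /=; apply: eq_big => [e|[i j] _]; rewrite ?inE.
rewrite /ke /=; under [X in _ = _ + X]eq_bigr do rewrite !big_split /=.
rewrite !big_split /=; under eq_bigr do rewrite !big_split /=.
rewrite !big_split /=.
have -> : \sum_i \sum_j - xlnx (x i j) = - \sum_i \sum_j xlnx (x i j).
  by rewrite -sumrN; apply: eq_bigr => i _; rewrite sumrN.
by ring.
Qed.

End BetheLower.

Section BetheMatrix.
Variables (R : realType) (n : nat) (A : 'M[R]_n).
Hypothesis A0 : forall i j, 0 <= A i j.

Definition SBr (x : 'M[R]_n) : R :=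
  \sum_i \sum_j (xlnax (A i j) (x i j) + xlnx (1 - x i j))
  - \sum_i xlnx (1 - \sum_j x i j) - \sum_j xlnx (1 - \sum_i x i j).

Lemma SB_cases (x : 'M[R]_n) : (forall i j, 0 <= x i j) ->
  (SB A x = -oo)%E \/ (SB A x = (SBr x)%:E /\ forall i j, A i j = 0 -> x i j = 0).
Proof.
move=> x0; rewrite /SB; case: ifPn => H; [by left|right; split => //].
move=> i j a0; apply/eqP; apply: contraNT H => xn0.
by apply/existsP; exists i; apply/existsP; exists j; rewrite a0 eqxx /= lt_neqAle eq_sym xn0 x0.
Qed.

Lemma matching_genE (z : R) :
  matching_gen A z = msum (fun=> 1) (bip (fun i j => z * A i j)) [set: 'I_n + 'I_n]%SET.
Proof. exact/esym/(@msum_per_k R n R idfun). Qed.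

Lemma bethe_matching_gen (z : R) (x : 'M[R]_n) : 0 < z -> Mle n x ->
  (forall i j, A i j = 0 -> x i j = 0) ->
  expR ((\sum_i \sum_j x i j) * ln z + SBr x) <= matching_gen A z.
Proof.
move=> z0 [x0 [xr xc]] Ax; rewrite matching_genE.
have zA i j : 0 <= z * A i j by rewrite mulr_ge0// ltW.
have zx i j : z * A i j = 0 -> x i j = 0.
  by move=> /eqP; rewrite mulf_eq0 gt_eqF//= => /eqP/Ax.
apply: le_trans (bethe_lower zA x0 xr xc zx); rewrite ler_expR le_eqVlt; apply/orP; left; apply/eqP.
rewrite /SBr !addrA; congr (_ - _ - _).
rewrite mulr_suml -big_split/=; apply: eq_bigr => i _.
rewrite mulr_suml -big_split/=; apply: eq_bigr => j _.
rewrite addrA; congr (_ + _); rewrite /xlnax xlnxE; case: eqP => [->|/eqP xn0].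
  by rewrite !mul0r subr0 addr0.
have Ap : 0 < A i j.
  by rewrite lt_neqAle A0 andbT eq_sym; apply: contra_neq xn0; exact: Ax.
have xp : 0 < x i j by rewrite lt_neqAle x0 andbT eq_sym.
by rewrite ln_div ?posrE// lnM ?posrE//; ring.
Qed.

Lemma per_k_bethe k : (k <= nu A)%N ->
  ((per_k A k)%:E >= (bin_b (nu A) k (k%:R / (nu A)%:R))%:E *
      expeR (ereal_sup [set SB A x | x in (Mk n k : set 'M[R]_n)]%classic))%E.
Proof.
move=> kn; set b := bin_b _ _ _; set c := per_k A k.
have c0 : 0 <= c by exact: per_k_ge0.
have p1 : k%:R / (nu A)%:R <= 1 :> R.
  have [->|nu0] := eqVneq (nu A) 0%N; first by rewrite invr0 mulr0.
  by rewrite ler_pdivrMr ?ltr0n ?lt0n// mul1r ler_nat.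
have b0 : 0 <= b by rewrite /b /bin_b !mulr_ge0// ?exprn_ge0// ?subr_ge0// divr_ge0.
have key x : Mk n k x -> (SB A x = -oo)%E \/
    exists2 F, SB A x = F%:E & b * expR F <= c.
  move=> [Mx xk]; have [x0 _] := Mx; have [->|[-> Ax]] := SB_cases x0; [by left|right].
  exists (SBr x) => //; apply: per_k_bound => // z z0.
  have := bethe_matching_gen z0 Mx Ax; rewrite xk expRD mulrC => /(le_trans _); apply.
  by rewrite expRM_natl lnK.
move: b0; rewrite le_eqVlt => /predU1P[<-|b0]; first by rewrite mul0e lee_fin.
rewrite -lee_pdivlMl// -EFinM mulrC; set y := c / b.
have y0 : 0 <= y by rewrite divr_ge0// ltW.
(* [ln] is 0 at 0 by default, so a zero quotient needs its own bound -oo. *)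
have key' x : Mk n k x -> (SB A x <= if y == 0%R then -oo else (ln y)%:E)%E.
  move=> /key[->|[F -> le]]; first by rewrite leNye.
  have Fy : expR F <= y by rewrite ler_pdivlMr// mulrC.
  have yp : 0 < y by exact: lt_le_trans (expR_gt0 _) Fy.
  by rewrite gt_eqF// lee_fin -ler_expR lnK.
have : (ereal_sup [set SB A x | x in Mk n k]%classic <= if y == 0%R then -oo else (ln y)%:E)%E.
  by apply: ge_ereal_sup => _ [x Mx <-]; exact: key'.
case: eqP => [->|/eqP yn0]; first by rewrite leeNy_eq => /eqP ->; rewrite /= lexx.
by rewrite -lee_expeR => /le_trans; apply; rewrite /= lnK// posrE lt_neqAle eq_sym yn0.
Qed.

End BetheMatrix.

(** * Iterated 2-lifts of unbounded girth *)

Section Lift.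
Variable n : nat.
Local Open Scope nat_scope.
Implicit Types (l k r c : nat).

Definition lsize l := 2 ^ l * n.
Definition lbit l r := odd (r %/ lsize l).

(* Level [l] twists exactly the edges that project, at level [L], to the edge
   (i, j), where [:: L; i; j] is the list coded by [l]. *)
Definition twist l r c :=
  if CodeSeq.decode l is [:: L; i; j] then
    [&& L <= l, r %% lsize L == i & c %% lsize L == j]
  else false.

(** Digit k of an index is its sheet in the step from level k to level k + 1. Adjacent indices lie
    on different sheets exactly at the steps that twist the edge below them. *)
Definition ladj l r c := all (fun k => lbit k r (+) lbit k c == twist k r c) (iota 0 l).

Lemma lsize_dvd k l : k <= l -> lsize k %| lsize l.
Proof. by move=> kl; rewrite /lsize dvdn_mul// dvdn_exp2l. Qed.

Lemma modn_lsize k l r : k <= l -> r %% lsize l %% lsize k = r %% lsize k.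
Proof. by move=> kl; rewrite modn_dvdm// lsize_dvd. Qed.

Lemma modn_base l r : r %% lsize l %% n = r %% n.
Proof. by rewrite modn_dvdm// /lsize dvdn_mull. Qed.

Lemma twist_mod k l r c : k <= l -> twist k (r %% lsize l) (c %% lsize l) = twist k r c.
Proof.
move=> kl; rewrite /twist; case: (CodeSeq.decode k) => [|L [|i [|j []]]] //.
by case: leqP => //= Lk; rewrite !modn_lsize// (leq_trans Lk).
Qed.

Lemma lbit_mod k l r : k < l -> lbit k (r %% lsize l) = lbit k r.
Proof.
case: (posnP n) => [n0|n0] kl.
  by rewrite /lbit /lsize n0 !muln0 !divn0.
have lk0 : 0 < lsize k by rewrite muln_gt0 expn_gt0 n0.
rewrite /lbit {2}(divn_eq r (lsize l)).
have -> : lsize l = 2 ^ (l - k) * lsize k by rewrite /lsize mulnA -expnD subnK// ltnW.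
rewrite mulnA divnMDl// oddD oddM oddX subn_eq0 leqNgt kl /= andbF.
by [].
Qed.

Lemma ladj_mod k l r c : k <= l -> ladj k (r %% lsize l) (c %% lsize l) = ladj k r c.
Proof.
move=> kl; apply: eq_in_all => i; rewrite mem_iota add0n => /= ik.
by rewrite !lbit_mod ?twist_mod ?(leq_trans ik)// ltnW// (leq_trans ik).
Qed.

Lemma ladj_le k l r c : k <= l -> ladj l r c -> ladj k r c.
Proof.
move=> kl /allP H; apply/allP => i; rewrite mem_iota add0n /= => ik; apply: H.
by rewrite mem_iota add0n /= (leq_trans ik).
Qed.

Lemma ladjS l r c :
  ladj l.+1 r c = ladj l r c && (lbit l r (+) lbit l c == twist l r c).
Proof. by rewrite /ladj -addn1 iotaD all_cat /= andbT. Qed.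

(** The neighbour of row r in the fiber of column j: adjacency determines its digits successively.
    Existence and uniqueness make every level a covering of the base. *)
Fixpoint ncol l r j := if l isn't l'.+1 then j else
  let c := ncol l' r j in c + (lbit l' r (+) twist l' r c) * lsize l'.
Fixpoint nrow l c i := if l isn't l'.+1 then i else
  let r := nrow l' c i in r + (lbit l' c (+) twist l' r c) * lsize l'.

Lemma lsizeS l : lsize l.+1 = lsize l + lsize l.
Proof. by rewrite /lsize expnS -mulnA mul2n addnn. Qed.

Lemma lt_lift l c (b : bool) : c < lsize l -> c + b * lsize l < lsize l.+1.
Proof. by rewrite lsizeS; case: b; rewrite ?mul1n ?mul0n ?addn0 ?ltn_add2r// => /ltn_addr. Qed.

Lemma mod_lift l c (b : bool) : c < lsize l -> (c + b * lsize l) %% lsize l = c.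
Proof. by move=> cl; rewrite addnC modnMDl modn_small. Qed.

Lemma bit_lift l c (b : bool) : c < lsize l -> lbit l (c + b * lsize l) = b.
Proof.
move=> cl; rewrite /lbit divnDMl ?(leq_ltn_trans _ cl)// divn_small// add0n.
by case: b.
Qed.

Lemma lift_eq l c : c < lsize l.+1 -> c = c %% lsize l + lbit l c * lsize l.
Proof.
rewrite lsizeS => cl; rewrite /lbit addnC {1}(divn_eq c (lsize l)); congr (_ * _ + _).
have l0 : 0 < lsize l by case: (lsize l) cl.
have : c %/ lsize l < 2 by rewrite ltn_divLR// mul2n -addnn.
by case: (c %/ lsize l) => [|[|]].
Qed.

Lemma ncolP l r j : j < n -> [/\ ncol l r j < lsize l, ncol l r j %% n = j & ladj l r (ncol l r j)].
Proof.
move=> jn; elim: l => [|l [lt md ad]] /=.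
  by rewrite /lsize mul1n jn modn_small.
set b := (_ (+) _); split; first exact: lt_lift.
  by rewrite -(modn_base l) mod_lift.
rewrite ladjS -(@ladj_mod l l)// -(@twist_mod l l)// mod_lift//.
rewrite -{1}(modn_small lt) ladj_mod// ad /=.
by rewrite bit_lift// -{1}(modn_small lt) twist_mod// /b addbA addbb addFb.
Qed.

Lemma nrowP l c i : i < n -> [/\ nrow l c i < lsize l, nrow l c i %% n = i & ladj l (nrow l c i) c].
Proof.
move=> jn; elim: l => [|l [lt md ad]] /=.
  by rewrite /lsize mul1n jn modn_small.
set b := (_ (+) _); split; first exact: lt_lift.
  by rewrite -(modn_base l) mod_lift.
rewrite ladjS -(@ladj_mod l l)// -(@twist_mod l l)// mod_lift//.
rewrite -{1}(modn_small lt) ladj_mod// ad /=.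
by rewrite bit_lift// -{1}(modn_small lt) twist_mod// /b addbC addbA addbb addFb.
Qed.

Lemma ncol_uniq l r c : c < lsize l -> ladj l r c -> c = ncol l r (c %% n).
Proof.
elim: l c => [|l IH] c; first by rewrite /lsize mul1n /= => cl _; rewrite modn_small.
move=> cl; rewrite ladjS => /andP[ad /eqP tw].
have l0 : 0 < lsize l by move: cl; rewrite lsizeS; case: (lsize l).
have e : c %% lsize l = ncol l r (c %% n).
  rewrite -(modn_base l c); apply: IH; first exact: ltn_pmod.
  by rewrite -(@ladj_mod l l) // modn_mod ladj_mod.
rewrite /= -e {1}(lift_eq cl); congr (_ + _ * _).
rewrite -(@twist_mod l l)// modn_mod twist_mod// -tw.
by rewrite addbA addbb addFb.
Qed.

Lemma nrow_uniq l r c : r < lsize l -> ladj l r c -> r = nrow l c (r %% n).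
Proof.
elim: l r => [|l IH] r; first by rewrite /lsize mul1n /= => cl _; rewrite modn_small.
move=> cl; rewrite ladjS => /andP[ad /eqP tw].
have l0 : 0 < lsize l by move: cl; rewrite lsizeS; case: (lsize l).
have e : r %% lsize l = nrow l c (r %% n).
  rewrite -(modn_base l r); apply: IH; first exact: ltn_pmod.
  by rewrite -(@ladj_mod l l) // modn_mod ladj_mod.
rewrite /= -e {1}(lift_eq cl); congr (_ + _ * _).
rewrite -(@twist_mod l l)// modn_mod twist_mod// -tw.
by rewrite addbCA addbb addbF.
Qed.

Lemma ladj_uniqr l r c c' : c < lsize l -> c' < lsize l -> ladj l r c -> ladj l r c' ->
  c = c' %[mod n] -> c = c'.
Proof. by move=> cl cl' ad ad' e; rewrite (ncol_uniq cl ad) (ncol_uniq cl' ad') e. Qed.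

Lemma ladj_uniql l r r' c : r < lsize l -> r' < lsize l -> ladj l r c -> ladj l r' c ->
  r = r' %[mod n] -> r = r'.
Proof. by move=> cl cl' ad ad' e; rewrite (nrow_uniq cl ad) (nrow_uniq cl' ad') e. Qed.

End Lift.

(** * Growth of the girth along the sequence of lifts *)

Section Girth.
Variable n : nat.
Local Open Scope nat_scope.
Implicit Types (k l d t : nat) (u v : bool * nat) (p : nat -> bool * nat).

(* Vertices are coded as (side, index), the side [true] being that of the rows. *)
Definition vadj l u v :=
  (u.1 != v.1) && (if u.1 then ladj n l u.2 v.2 else ladj n l v.2 u.2).
Definition vtwist l u v := if u.1 then twist n l u.2 v.2 else twist n l v.2 u.2.
Definition vproj l u := (u.1, u.2 %% lsize n l).

Definition nbwalk l p k :=
  [/\ forall t, t <= k -> (p t).2 < lsize n l,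
      forall t, t < k -> vadj l (p t) (p t.+1) &
      forall t, t.+1 < k -> p t <> p t.+2].

(** The turn at the base point is free, so that any part of a walk between two visits of one vertex
    is covered. *)
Definition girth_gt l d := forall p k, 0 < k <= d -> nbwalk l p k -> p k <> p 0.

Lemma vadj_sym l u v : vadj l u v = vadj l v u.
Proof. by case: u v => [[] x] [[] y]. Qed.

Lemma vadj_uniq l u v v' : v.2 < lsize n l -> v'.2 < lsize n l ->
  vadj l u v -> vadj l u v' -> v.2 = v'.2 %[mod n] -> v = v'.
Proof.
case: u v v' => [[] x] [[] y] [[] y'] //= yl yl' a a' e; congr (_, _).
  exact: ladj_uniqr yl yl' a a' e.
exact: ladj_uniql yl yl' a a' e.
Qed.

Lemma nbwalk_shift l p k s : s <= k -> nbwalk l p k -> nbwalk l (fun t => p (s + t)) (k - s).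
Proof.
move=> sk [H1 H2 H3]; split => t tk; first by apply: H1; rewrite -leq_subRL.
  by rewrite addnS; apply: H2; rewrite -ltn_subRL.
by rewrite !addnS; apply: H3; rewrite -addnS -ltn_subRL.
Qed.

Lemma nbwalk_take l p k k' : k' <= k -> nbwalk l p k -> nbwalk l p k'.
Proof.
move=> sk [H1 H2 H3]; split => t tk; first by apply: H1; exact: leq_trans tk sk.
  by apply: H2; exact: leq_trans tk sk.
by apply: H3; exact: leq_trans tk sk.
Qed.

(** If a projection turns back at t, then p t and p t.+2 are neighbours of p t.+1 in the same fiber,
    hence equal. *)
Lemma nbwalk_proj l l' p k : l <= l' -> nbwalk l' p k -> nbwalk l (vproj l \o p) k.
Proof.
move=> ll [H1 H2 H3].
have l0 : 0 < lsize n l.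
  have := H1 0 isT; rewrite /lsize !muln_gt0 !expn_gt0 /=.
  by case: (n) => //; rewrite muln0 ltn0.
split => t tk; first by rewrite ltn_pmod.
  have := H2 t tk; rewrite /vadj /=; case: ifP => _ /andP[-> ad] /=.
    by rewrite ladj_mod// (ladj_le ll).
  by rewrite ladj_mod// (ladj_le ll).
move=> e; apply: (H3 t tk).
have ok1 := H1 t (ltnW (ltnW tk)); have ok2 := H1 t.+2 tk.
apply: (@vadj_uniq l' (p t.+1)) => //; first by rewrite vadj_sym H2// ltnW.
  exact: H2.
have := congr1 (fun u => u.2 %% n) e; rewrite /= !modn_base.
by [].
Qed.

Lemma girth_le l l' d : l <= l' -> girth_gt l d -> girth_gt l' d.
Proof.
move=> ll G p k kd nb e; apply: (G (vproj l \o p) k kd (nbwalk_proj ll nb)).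
by rewrite /= e.
Qed.

Lemma vadj_bit l l' u v : l < l' -> vadj l' u v ->
  lbit n l v.2 = lbit n l u.2 (+) vtwist l u v.
Proof.
move=> ll; rewrite /vadj /vtwist; case: ifP => _ /andP[_] /(ladj_le ll); rewrite ladjS.
  by move=> /andP[_ /eqP <-]; rewrite addbA addbb addFb.
by move=> /andP[_ /eqP <-]; rewrite addbCA addbb addbF.
Qed.

(* A closed walk after the twists of all edges of level [l] runs an even number
   of times through (the lifts of) its first edge, hence contains a shorter
   closed walk at level [l]. *)
Lemma girth_step l d : girth_gt l d -> exists l', girth_gt l' d.+1.
Proof.
move=> G; pose N := lsize n l.
(* Beyond the codes of all triples (l, i, j), every edge of level l has had its fiber twisted. *)
pose l' := maxn l (\max_(i < N) \max_(j < N) (CodeSeq.code [:: l; val i; val j]).+1).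
have ll' : l <= l' by rewrite leq_maxl.
exists l' => p k /andP[k0 kd] nb; have [H1 H2 H3] := nb; move=> pk.
have N0 : 0 < N.
  have := H1 0 isT; rewrite /N /lsize !muln_gt0 !expn_gt0 /=.
  by case: (n) => //; rewrite muln0 ltn0.
have nq := nbwalk_proj ll' nb; set q := vproj l \o p in nq.
have [Q1 Q2 Q3] := nq.
pose r0 := if (p 0).1 then (p 0).2 else (p 1).2.
pose c0 := if (p 0).1 then (p 1).2 else (p 0).2.
pose i := Ordinal (ltn_pmod r0 N0); pose j := Ordinal (ltn_pmod c0 N0).
pose m := CodeSeq.code [:: l; val i; val j].
have lm : l <= m by have /andP[/ltnW] := CodeSeq.ltn_code [:: l; val i; val j].
have ml' : m < l'.
  apply: leq_trans (leq_maxr _ _); apply: leq_trans (leq_bigmax i).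
  exact: (@leq_bigmax _ (fun j : 'I_N => (CodeSeq.code [:: l; val i; val j]).+1) j).
have twE u v : vtwist m u v = if u.1 then (u.2 %% N == i) && (v.2 %% N == j)
    else (v.2 %% N == i) && (u.2 %% N == j).
  by rewrite /vtwist /twist /m CodeSeq.codeK lm.
have p01 : (p 0).1 != (p 1).1 by have /andP[] := H2 0 k0.
have tw0 : vtwist m (p 0) (p 1).
  by rewrite twE /= /r0 /c0; case: (p 0).1; rewrite !eqxx.
have bitS t : t < k -> lbit n m (p t.+1).2 = lbit n m (p t).2 (+) vtwist m (p t) (p t.+1).
  by move=> /H2; apply: vadj_bit.
have [/existsP[[t tk] /= /andP[t0 tw]]|/existsPn nt] :=
  boolP [exists t : 'I_k, (0 < t) && vtwist m (p t) (p t.+1)]; last first.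
  have bit1 t : t < k -> lbit n m (p t.+1).2 = lbit n m (p 1).2.
    elim: t => // t IH tk; rewrite bitS// IH 1?ltnW//.
    by have := nt (Ordinal tk); rewrite /= => /negbTE ->; rewrite addbF.
  have := bit1 k.-1; rewrite prednK// pk => /(_ (leqnn _)).
  by rewrite (bitS 0)// tw0; case: (lbit _ _ _).
have pt1 : (p t).1 != (p t.+1).1 by have /andP[] := H2 t tk.
(* Second use in the same direction: the projection is back at its start after t < k steps. *)
have [e|ne] := eqVneq (p t).1 (p 0).1.
  have qt : q t = q 0.
    rewrite /q /= /vproj e; congr (_, _).
    move: tw tw0; rewrite !twE e; case: (p 0).1 => /andP[/eqP a /eqP b] /andP[/eqP a' /eqP b'].
      by rewrite -/N a a'.
    by rewrite -/N b b'.
  apply: (G q t) qt; first by rewrite t0 -ltnS (leq_trans tk).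
  exact: nbwalk_take (ltnW tk) nq.
have e1 : (p t.+1).1 = (p 0).1 by move: ne pt1; do 3 case: (_.1).
have e2 : (p t).1 = (p 1).1 by move: ne p01; do 3 case: (_.1).
have qt : q t = q 1 /\ q t.+1 = q 0.
  rewrite /q /= /vproj e1 e2; move: tw tw0; rewrite !twE e2.
  move: p01; case: (p 0).1; case: (p 1).1 => // _ /andP[/eqP a /eqP b] /andP[/eqP a' /eqP b'];
  by rewrite -/N a a' b b'.
(* Second use in the opposite direction: for t = 1 the projection backtracks, and otherwise the part
   from 1 to t is closed. *)
case: t t0 tk tw pt1 ne e1 e2 qt => [//|[|t]] _ tk _ _ _ _ _ [qt qt1].
  exact: (Q3 0 tk).
apply: (G (fun s => q (1 + s)) t.+1); last first.
- by rewrite /= !add1n.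
- rewrite (_ : t.+1 = t.+2 - 1); last by rewrite subn1.
  exact: nbwalk_shift (nbwalk_take (ltnW tk) nq).
by rewrite /= -ltnS ltnW// (leq_trans tk).
Qed.

Lemma girth_unbounded d : exists l, forall l', l <= l' -> girth_gt l' d.
Proof.
suff [l G] : exists l, girth_gt l d by exists l => l' ll'; exact: girth_le G.
elim: d => [|d [l /girth_step//]].
by exists 0 => p k; case: k.
Qed.

End Girth.

(** * Belief propagation *)

Section Messages.
Variable R : realType.

(** As a function of ln X, ln (1 + X) has slope X / (1 + X) <= S / (1 + S). Convexity of the
    exponential gives the bound: with c = X / (1 + X), expR (- c d) is at most (1 - c) + c expR (-
    d). *)
Lemma ln1D_contr1 (X X' S d : R) : 0 <= X -> 0 <= X' -> X <= S -> 0 <= d ->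
  X <= expR d * X' -> ln (1 + X) - ln (1 + X') <= S / (1 + S) * d.
Proof.
move=> X0 X'0 XS d0 le; have S0 : 0 <= S by exact: le_trans XS.
have X1 : 0 < 1 + X by rewrite ltr_wpDr.
have X1' : 0 < 1 + X' by rewrite ltr_wpDr.
have S1 : 0 < 1 + S by rewrite ltr_wpDr.
pose c := X / (1 + X).
have c0 : 0 <= c by rewrite divr_ge0// ltW.
have c1 : 0 <= 1 - c by rewrite subr_ge0 /c ler_pdivrMr// mul1r lerDr.
have cS : c <= S / (1 + S).
  by rewrite /c ler_pdivrMr// mulrAC ler_pdivlMr//; lra.
have h1 : 1 <= expR (c * d) * ((1 - c) + c * expR (- d)).
  rewrite mulrDr mulrCA [X in _ <= X + _]mulrC -expRD.
  have e1 := expR_ge1Dx (c * d); have e2 := expR_ge1Dx (c * d + - d).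
  apply: le_trans (lerD (ler_wpM2l c1 e1) (ler_wpM2l c0 e2)).
  by rewrite le_eqVlt; apply/orP; left; apply/eqP; ring.
have h2 : (1 + X) * ((1 - c) + c * expR (- d)) <= 1 + X'.
  rewrite (_ : _ * _ = 1 + X * expR (- d)); last by rewrite /c; field; rewrite gt_eqF.
  by rewrite lerD2l -(ler_pM2l (expR_gt0 d)) mulrCA -expRD subrr expR0 mulr1.
rewrite lerBlDr -ler_expR expRD !lnK ?posrE//.
have h3 : 1 + X <= expR (c * d) * (1 + X').
  have := ler_wpM2l (expR_ge0 (c * d)) h2.
  apply: le_trans; rewrite mulrCA -[leLHS]mulr1 ler_wpM2l// ltW//.
apply: (le_trans h3); rewrite ler_pM2r// ler_expR.
by rewrite ler_wpM2r.
Qed.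

Lemma ln1D_contr (I : finType) (Q : pred I) (s v v' : I -> R) (S d : R) :
  (forall i, 0 <= s i) -> 0 <= d ->
  \sum_(i | Q i) s i * expR (v i) <= S -> \sum_(i | Q i) s i * expR (v' i) <= S ->
  (forall i, Q i -> s i != 0 -> `|v i - v' i| <= d) ->
  `|ln (1 + \sum_(i | Q i) s i * expR (v i)) - ln (1 + \sum_(i | Q i) s i * expR (v' i))|
    <= S / (1 + S) * d.
Proof.
move=> s0 d0 XS XS' H.
have aux (y y' : I -> R) : (forall i, Q i -> s i != 0 -> y i - y' i <= d) ->
    \sum_(i | Q i) s i * expR (y i) <= expR d * \sum_(i | Q i) s i * expR (y' i).
  move=> Hy; rewrite mulr_sumr; apply: ler_sum => i Qi.
  have [->|si] := eqVneq (s i) 0; first by rewrite !mul0r mulr0.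
  by rewrite mulrCA -expRD ler_wpM2l// ler_expR -lerBlDr Hy.
have ge0 (y : I -> R) : 0 <= \sum_(i | Q i) s i * expR (y i).
  by apply: sumr_ge0 => i _; rewrite mulr_ge0// expR_ge0.
rewrite ler_norml lerNl opprB; apply/andP; split; apply: ln1D_contr1 => //; apply: aux => i Qi si.
  by have := H i Qi si; rewrite distrC; apply: le_trans; exact: ler_norm.
by have := H i Qi si; apply: le_trans; exact: ler_norm.
Qed.

Lemma expR_lip (x y : R) : x <= 0 -> y <= 0 -> `|expR x - expR y| <= `|x - y|.
Proof.
wlog xy : x y / y <= x => [H|x0 y0].
  by have [/H//|/ltW/H h] := leP y x => x0 y0; rewrite distrC (distrC x) h.
rewrite !ger0_norm ?subr_ge0 ?ler_expR//.
have e1 := expR_ge1Dx (y - x); rewrite expRD expRN in e1.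
have e2 : expR x <= 1 by rewrite -expR0 ler_expR.
have := ler_wpM2r (expR_ge0 x) e1; rewrite -mulrA mulVf ?gt_eqF ?expR_gt0// mulr1 => e3.
have : 0 <= (x - y) * (1 - expR x) by rewrite mulr_ge0// subr_ge0.
lra.
Qed.

Lemma cauchy_geom (v : nat -> R) (q M : R) : 0 <= q < 1 -> 0 <= M ->
  (forall k m, `|v (k + m)%N - v k| <= q ^+ k * M) ->
  exists L, forall k, `|L - v k| <= q ^+ k * M.
Proof.
move=> /andP[q0 q1] M0 H.
have small (e : R) : 0 < e -> exists k, q ^+ k * M < e.
  move=> e0.
  have : ((fun k => M * q ^+ k) @ \oo --> (0 : R))%classic.
    by apply: cvg_geometric; rewrite ger0_norm.
  move=> /cvgrPdist_lt /(_ e e0) [k _ /(_ k (leqnn k))] /=.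
  rewrite sub0r normrN => h; exists k; rewrite mulrC; apply: le_lt_trans h.
  exact: ler_norm.
have : cvgn v.
  apply/cauchy_cvgP/cauchy_exP => e e0; have [k hk] := small e e0.
  exists (v k); exists k => //= m km; rewrite /ball /= distrC.
  by apply: le_lt_trans hk; rewrite -(subnKC km).
move=> cv; exists (limn v) => k.
have cv' : ((fun m => `|v (m + k)%N - v k|) @ \oo --> `|limn v - v k|)%classic.
  by apply: cvg_norm; apply: cvgB; [rewrite cvg_shiftn | exact: cvg_cst].
rewrite -(cvg_lim _ cv')//; apply: limr_le; first by apply/cvg_ex; eexists; exact: cv'.
by near=> m; rewrite addnC.
Unshelve. all: by end_near. Qed.

Variable B : finType.
Implicit Types (a u : B -> B -> R).

(* [u x y] is the logarithm of the message from [y] to [x]: in a tree, the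
   probability that [y] is unmatched once [x] is removed. *)
Definition bp_step a u x y : R := - ln (1 + \sum_(c | c != x) a y c * expR (u y c)).

Section FixedPoint.
Variables (a : B -> B -> R) (S : R).
Hypothesis a0 : forall x y, 0 <= a x y.
Hypothesis aS : forall x, \sum_y a x y <= S.
Let M := ln (1 + S).
Let q := S / (1 + S).

Lemma bp_sum_le (Q : pred B) (v : B -> R) x : (forall y, v y <= 0) ->
  0 <= \sum_(c | Q c) a x c * expR (v c) <= S.
Proof.
move=> v0; rewrite sumr_ge0/= => [|c _]; last by rewrite mulr_ge0// expR_ge0.
apply: le_trans (aS x); rewrite [leRHS](bigID Q) /= -[leLHS]addr0 lerD ?sumr_ge0//.
apply: ler_sum => c _; rewrite -[leRHS]mulr1 ler_wpM2l// -expR0 ler_expR//.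
Qed.

Lemma bp_range X : 0 <= X <= S -> - M <= - ln (1 + X) <= 0.
Proof.
move=> /andP[X0 XS]; have S0 : 0 <= S by exact: le_trans XS.
rewrite lerN2 oppr_le0 ln_ge0 ?lerDl// andbT ler_ln ?posrE ?ltr_wpDr//.
by rewrite lerD2l.
Qed.

Lemma bp_step_range u x y : (forall x y, u x y <= 0) -> - M <= bp_step a u x y <= 0.
Proof. by move=> u0; apply: bp_range; apply: bp_sum_le. Qed.

Lemma bp_step_contr u u' d : (forall x y, u x y <= 0) -> (forall x y, u' x y <= 0) ->
  0 <= d -> (forall x y, `|u x y - u' x y| <= d) ->
  forall x y, `|bp_step a u x y - bp_step a u' x y| <= q * d.
Proof.
move=> u0 u'0 d0 H x y; rewrite /bp_step opprK addrC distrC.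
apply: ln1D_contr => //.
  by have /andP[] := bp_sum_le (fun c => c != x) y (u0 y).
by have /andP[] := bp_sum_le (fun c => c != x) y (u'0 y).
Qed.

Hypothesis S0 : 0 <= S.

Lemma bp_rate : 0 <= q < 1.
Proof.
by rewrite /q divr_ge0 ?addr_ge0//= ltr_pdivrMr ?ltr_wpDr// mul1r ltrDr.
Qed.

Lemma bp_M_ge0 : 0 <= M.
Proof. by rewrite /M ln_ge0// lerDl. Qed.

(** Iteration from the zero messages: the first step moves by at most M, and each further step
    contracts by q. *)
Lemma bp_fixed_point : exists u, (forall x y, - M <= u x y <= 0) /\
  forall x y, u x y = bp_step a u x y.
Proof.
pose it k : B -> B -> R := iter k (bp_step a) (fun _ _ => 0).
have /andP[q0 q1] := bp_rate.
have itr k x y : - M <= it k x y <= 0.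
  elim: k x y => [|k IH] x y /=; first by rewrite lexx oppr_le0 bp_M_ge0.
  by apply: bp_step_range => x' y'; have /andP[] := IH x' y'.
have it0 k x y : it k x y <= 0 by have /andP[] := itr k x y.
have itd k m x y : `|it (k + m)%N x y - it k x y| <= q ^+ k * M.
  elim: k x y => [|k IH] x y.
    by rewrite expr0 mul1r add0n /= subr0 ler_norml; have /andP[-> h] := itr m x y;
       rewrite (le_trans h) ?bp_M_ge0.
  rewrite exprS -mulrA; apply: bp_step_contr => //.
  by rewrite mulr_ge0 ?exprn_ge0 ?bp_M_ge0.
have /choice[u hu] : forall xy : B * B, exists L, forall k, `|L - it k xy.1 xy.2| <= q ^+ k * M.
  by move=> [x y]; apply: cauchy_geom; rewrite ?bp_rate ?bp_M_ge0.
pose U x y := u (x, y).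
have hU x y k : `|U x y - it k x y| <= q ^+ k * M by exact: (hu (x, y)).
have squeeze (x y : R) : (forall k, `|x - y| <= q ^+ k * M + q ^+ k * M) -> x = y.
  move=> h; apply/eqP; rewrite -subr_eq0 -normr_le0; apply/ler_addgt0Pr => e e0.
  have : ((fun k => (M + M) * q ^+ k) @ \oo --> (0 : R))%classic.
    by apply: cvg_geometric; rewrite ger0_norm.
  move=> /cvgrPdist_lt /(_ e e0) [k _ /(_ k (leqnn k))] /=.
  rewrite sub0r normrN add0r => h'; apply: le_trans (h k) _; apply: le_trans (ltW h').
  by rewrite -mulrDr mulrC ler_norm.
have UM x y : - M <= U x y <= 0.
  (* The interval [- M, 0] written as a ball, to pass the range to the limit by the triangle
     inequality. *)
  suff : `|U x y + M / 2| <= M / 2 by rewrite ler_norml => /andP[? ?]; apply/andP; split; lra.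
  apply/ler_addgt0Pr => e e0.
  have : ((fun k => M * q ^+ k) @ \oo --> (0 : R))%classic.
    by apply: cvg_geometric; rewrite ger0_norm.
  move=> /cvgrPdist_lt /(_ e e0) [k _ /(_ k (leqnn k))] /=.
  rewrite sub0r normrN => h'.
  rewrite (_ : U x y + M / 2 = (it k x y + M / 2) + (U x y - it k x y)); last by ring.
  apply: le_trans (ler_normD _ _) _; apply: lerD.
    by rewrite ler_norml; have /andP[h1 h2] := itr k x y; apply/andP; split; lra.
  by apply: le_trans (hU x y k) _; apply: le_trans (ltW h'); rewrite mulrC ler_norm.
have U0 x y : U x y <= 0 by have /andP[] := UM x y.
exists U; split => // x y; apply: squeeze => k.
rewrite (_ : U x y - _ = (U x y - it k.+1 x y) + (it k.+1 x y - bp_step a U x y)); last by ring.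
apply: le_trans (ler_normD _ _) _.
have qk : q ^+ k.+1 * M <= q ^+ k * M.
  by rewrite ler_wpM2r ?bp_M_ge0// exprS ler_piMl ?exprn_ge0// ltW.
apply: lerD; first exact: le_trans (hU x y k.+1) qk.
rewrite distrC; apply: le_trans qk; rewrite exprS -mulrA.
apply: bp_step_contr => //; by rewrite mulr_ge0 ?exprn_ge0 ?bp_M_ge0.
Qed.

End FixedPoint.

(** * Comparison of a covering of large girth with the fixed point on the base *)

Section Cover.
Variables (V : finType) (pi : V -> B) (E : rel V) (eB : rel B) (nb : V -> B -> V).
Variables (a : B -> B -> R) (S : R).
Hypothesis a0 : forall x y, 0 <= a x y.
Hypothesis a_sym : forall x y, a x y = a y x.
Hypothesis aS : forall x, \sum_y a x y <= S.
Hypothesis S0 : 0 <= S.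
Hypothesis aE : forall x y, ~~ eB x y -> a x y = 0.
Hypothesis Es : forall v w, E v w = E w v.
Hypothesis Epi : forall v w, E v w -> eB (pi v) (pi w).
Hypothesis nbE : forall v b, eB (pi v) b -> E v (nb v b) /\ pi (nb v b) = b.
Hypothesis nbU : forall v w, E v w -> w = nb v (pi w).
Let M := ln (1 + S).
Let q := S / (1 + S).

Definition cover_wt v w : R := if E v w then a (pi v) (pi w) else 0.

Lemma cover_wt_ge0 v w : 0 <= cover_wt v w.
Proof. by rewrite /cover_wt; case: ifP. Qed.

Lemma cover_wt_sym v w : cover_wt v w = cover_wt w v.
Proof. by rewrite /cover_wt Es a_sym. Qed.

Lemma cover_sum (Q : pred V) (F : V -> R) v :
  \sum_(w | Q w) cover_wt v w * F w =
  \sum_(b | eB (pi v) b && Q (nb v b)) a (pi v) b * F (nb v b).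
Proof.
rewrite (bigID (E v)) /= [X in _ + X]big1 ?addr0; last first.
  by move=> w /andP[_ /negbTE Ew]; rewrite /cover_wt Ew mul0r.
rewrite (reindex_onto (nb v) pi) /=; last by move=> w /andP[_ /nbU].
apply: eq_big => [b|b /andP[/andP[Qb Eb] /eqP pb]]; last by rewrite /cover_wt Eb pb.
have [eb|neb] := boolP (eB (pi v) b).
  by have [-> ->] := nbE eb; rewrite eqxx !andbT.
apply/negP => /andP[/andP[_ /Epi]] /[swap] /eqP -> eb.
by rewrite eb in neb.
Qed.

Notation P := (msum (fun=> 1) cover_wt).
Implicit Types U : {set V}.

Lemma cover_P_gt0 U : 0 < P U.
Proof. apply: msum_gt0 => //; [exact: cover_wt_ge0 | exact: cover_wt_sym]. Qed.

(** The logarithm of the probability that v is unmatched in a random matching of U. Its recursion is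
    that of [bp_step], on any graph, except that the vertex set shrinks. *)
Definition lratio U v : R := ln (P (U :\ v) / P U).

Lemma lratioE U v : v \in U ->
  lratio U v = - ln (1 + \sum_(w in U :\ v) cover_wt v w * expR (lratio (U :\ v) w)).
Proof.
move=> vU; rewrite /lratio -lnV; last first.
  rewrite posrE ltr_wpDr// sumr_ge0// => w _.
  by rewrite mulr_ge0 ?cover_wt_ge0 ?expR_ge0.
congr ln; rewrite -[LHS]invf_div; congr (_^-1).
rewrite (msumE _ cover_wt_sym vU) mul1r mulrDl divff ?gt_eqF ?cover_P_gt0//.
congr (_ + _); rewrite mulr_suml; apply: eq_bigr => w _.
by rewrite lnK ?mulrA// posrE divr_gt0 ?cover_P_gt0.
Qed.

Lemma cover_deg v : \sum_w cover_wt v w <= S.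
Proof.
under eq_bigr do rewrite -[cover_wt _ _]mulr1.
rewrite (cover_sum xpredT (fun=> 1)); apply: le_trans (aS (pi v)).
rewrite [leRHS](bigID (eB (pi v))) /= -[leLHS]addr0 lerD ?sumr_ge0//.
rewrite le_eqVlt; apply/orP; left; apply/eqP.
by apply: eq_big => [b|b _]; rewrite ?andbT ?mulr1.
Qed.

Lemma lratio_le0 U v : v \in U -> lratio U v <= 0.
Proof.
move=> vU; rewrite lratioE// oppr_le0 ln_ge0// lerDl sumr_ge0// => w _.
by rewrite mulr_ge0 ?cover_wt_ge0 ?expR_ge0.
Qed.

Lemma lratio_range U v : v \in U -> - M <= lratio U v <= 0.
Proof.
move=> vU; rewrite lratio_le0// andbT lratioE//.
have h : 0 <= \sum_(w in U :\ v) cover_wt v w * expR (lratio (U :\ v) w) <= S.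
  rewrite sumr_ge0/= => [|w _]; last by rewrite mulr_ge0 ?cover_wt_ge0 ?expR_ge0.
  apply: le_trans (cover_deg v); rewrite [leRHS](bigID (fun w => w \in U :\ v)) /=.
  rewrite -[leLHS]addr0 lerD ?sumr_ge0// => [|w _]; last exact: cover_wt_ge0.
  apply: ler_sum => w wU; rewrite -[leRHS]mulr1 ler_wpM2l ?cover_wt_ge0//.
  by rewrite -expR0 ler_expR lratio_le0.
by have /andP[] := bp_range h.
Qed.

Definition cwalk (p : nat -> V) k :=
  (forall t, (t < k)%N -> E (p t) (p t.+1)) /\
  (forall t, (t.+1 < k)%N -> p t <> p t.+2).

Variable D : nat.
Hypothesis girth : forall p k, (0 < k <= D)%N -> cwalk p k -> p k <> p 0%N.

Variable u : B -> B -> R.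
Hypothesis u_range : forall x y, - M <= u x y <= 0.
Hypothesis u_fix : forall x y, u x y = bp_step a u x y.

Lemma cwalk_simple p k s t : cwalk p k -> (s < t <= k)%N -> (k <= D)%N -> p t <> p s.
Proof.
move=> [H1 H2] /andP[st tk] kD e.
apply: (@girth (fun i => p (s + i)%N) (t - s)%N).
- by rewrite subn_gt0 st /= (leq_trans (leq_subr _ _))// (leq_trans tk).
- split => i it; first by rewrite addnS; apply: H1; apply: leq_trans tk; rewrite -ltn_subRL.
  by rewrite !addnS; apply: H2; apply: leq_trans tk; rewrite -addnS -ltn_subRL.
- by rewrite addn0 subnKC// ltnW.
Qed.

(** The current vertex p k is not yet removed. *)
Definition walk_rest (p : nat -> V) k : {set V} := [set v | [forall t : 'I_k, v != p t]]%SET.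

Lemma walk_rest_in p k : cwalk p k -> (k <= D)%N -> p k \in walk_rest p k.
Proof.
move=> pw kD; rewrite inE; apply/forallP => t; apply/eqP.
by apply: (cwalk_simple pw) => //; rewrite ltn_ord leqnn.
Qed.

Lemma walk_restS p k : walk_rest p k.+1 = walk_rest p k :\ p k.
Proof.
apply/setP => v; rewrite !inE; apply/forallP/andP => [H|[vk /forallP H] [t tk]].
  split; first exact: (H (Ordinal (ltnSn k))).
  by apply/forallP => t; exact: (H (widen_ord (leqnSn k) t)).
by rewrite /=; have := tk; rewrite ltnS leq_eqVlt => /predU1P[->|tk'] //; exact: (H (Ordinal tk')).
Qed.

Lemma eq_walk_rest p p' k : (forall t, (t < k)%N -> p t = p' t) -> walk_rest p k = walk_rest p' k.
Proof.
by move=> H; apply/setP => v; rewrite !inE; apply: eq_forallb => t; rewrite H.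
Qed.

(* Up to the girth, the self-avoiding walks in the cover project to the
   non-backtracking walks of the base, on which [bp_step] is iterated. *)
Lemma lratio_conv d p k : cwalk p k.+1 -> (k.+1 + d <= D)%N ->
  `|lratio (walk_rest p k.+1) (p k.+1) - u (pi (p k)) (pi (p k.+1))| <= q ^+ d * M.
Proof.
elim: d p k => [|d IH] p k pw kD.
  (* With no step left, both values are merely known to lie in [- M, 0]. *)
  rewrite addn0 in kD; rewrite expr0 mul1r.
  have /andP[l1 l2] := lratio_range (walk_rest_in pw kD).
  have /andP[u1 u2] := u_range (pi (p k)) (pi (p k.+1)).
  by rewrite ler_norml; apply/andP; split; lra.
have kD1 : (k.+1 <= D)%N by apply: leq_trans kD; rewrite leq_addr.
have kD2 : (k.+2 <= D)%N by apply: leq_trans kD; rewrite addnS ltnS leq_addr.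
have pin := walk_rest_in pw kD1; have [pw1 pw2] := pw.
rewrite lratioE// u_fix /bp_step opprK addrC distrC exprS -mulrA.
rewrite -walk_restS cover_sum.
set v := p k.+1 in pin *; set U := walk_rest p k.+2.
have ext b : eB (pi v) b -> b != pi (p k) -> exists p',
    [/\ cwalk p' k.+2, p' k.+1 = v, p' k.+2 = nb v b & walk_rest p' k.+2 = U].
  move=> eb bk; have [Eb pb] := nbE eb.
  pose p' t := if (t < k.+2)%N then p t else nb v b.
  exists p'; split; rewrite /p' ?leqnn ?ltnn//; last first.
    by apply: eq_walk_rest => t ->.
  split => t tk.
    rewrite tk; move: tk; rewrite ltnS leq_eqVlt => /predU1P[->|tk].
      by rewrite ltnn.
    by rewrite ltnS tk; exact: pw1.
  rewrite (ltnW tk); move: tk; rewrite !ltnS leq_eqVlt => /predU1P[[->]|tk].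
    by rewrite ltnn => pk; move: bk; rewrite -pb -pk eqxx.
  by rewrite tk; apply: pw2.
(* Among the neighbours of v, the walk has removed only p k: any other would close a walk shorter
   than the girth. *)
have nbU' b : eB (pi v) b -> (nb v b \in U) = (b != pi (p k)).
  move=> eb; apply/idP/idP.
    apply: contraTneq => bk; have := nbU (w := p k) (v := v).
    rewrite -bk Es => <-; last exact: pw1.
    by rewrite inE; apply/forallPn; exists (Ordinal (leqnSn k.+1 : (k < k.+2)%N)); rewrite negbK.
  by move=> bk; have [p' [pw' _ <- <-]] := ext _ eb bk; exact: walk_rest_in pw' kD2.
have lb b : a (pi v) b != 0 -> eB (pi v) b by apply: contraNT => /aE ->.
(* The value 0 elsewhere is harmless: those b are excluded from the sum or have weight 0. *)
pose F b := if (b != pi (p k)) && eB (pi v) b then lratio U (nb v b) else 0.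
rewrite [X in 1 + X](_ : _ = \sum_(c | c != pi (p k)) a (pi v) c * expR (F c)); last first.
  rewrite [RHS](bigID (eB (pi v))) /= [X in _ = _ + X]big1 ?addr0; last first.
    by move=> c /andP[_ /aE ->]; rewrite mul0r.
  apply: eq_big => [c|c /andP[ec]].
    by rewrite andbC; case E1 : (eB (pi v) c); rewrite ?andbT ?andbF ?nbU'.
  by rewrite nbU'// /F ec => ->.
have F0 b : F b <= 0.
  rewrite /F; case: ifP => // /andP[bk eb]; apply: lratio_le0; by rewrite nbU'.
apply: ln1D_contr => //.
- by rewrite mulr_ge0 ?exprn_ge0 ?bp_M_ge0//; have /andP[] := bp_rate S0.
- by have /andP[] := bp_sum_le a0 aS (fun c => c != pi (p k)) (pi v) F0.
- have u0 y : u (pi v) y <= 0 by have /andP[] := u_range (pi v) y.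
  by have /andP[] := bp_sum_le a0 aS (fun c => c != pi (p k)) (pi v) u0.
move=> b bk /lb eb; rewrite /F bk eb /=; have [_ pb] := nbE eb.
have [p' [pw' p1 p2 <-]] := ext _ eb bk.
have := IH p' k.+1 pw'; rewrite p1 p2 pb; apply.
by rewrite addSn -addnS.
Qed.

(** No neighbour is excluded here, and the inverse is the predicted probability that x is
    unmatched. *)
Definition bp_norm x := 1 + \sum_c a x c * expR (u x c).

Lemma unmatched_conv v : (0 < D)%N ->
  `|P ([set: V]%SET :\ v) / P [set: V]%SET - (bp_norm (pi v))^-1| <= q ^+ D.-1 * M.
Proof.
move=> D0; set T := [set: V]%SET; have vT : v \in T by rewrite inE.
have u0 x y : u x y <= 0 by have /andP[] := u_range x y.
have N1 x : 1 <= bp_norm x.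
  by have /andP[] := bp_sum_le a0 aS xpredT x (u0 x); rewrite lerDl.
have N0 x : 0 < bp_norm x by exact: lt_le_trans (N1 x).
have P0 : 0 < P (T :\ v) / P T by rewrite divr_gt0 ?cover_P_gt0.
have /andP[q0 q1] := bp_rate S0; have M0 := bp_M_ge0 S0.
rewrite -(lnK P0) -(lnK (N0 _)) -expRN -/(lratio T v).
apply: le_trans (expR_lip (lratio_le0 vT) _) _; first by rewrite oppr_le0 ln_ge0.
rewrite lratioE// opprK addrC cover_sum.
have nbT b : eB (pi v) b -> nb v b \in T :\ v.
  move=> eb; rewrite !inE andbT; apply/eqP => nv; have [Eb pb] := nbE eb.
  pose p (t : nat) := v.
  apply: (@girth p 1 D0) => //; split => [[|t]|t] //=; by rewrite /p -{2}nv.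
pose F b := if eB (pi v) b then lratio (T :\ v) (nb v b) else 0.
rewrite [X in ln (1 + X)](_ : _ = \sum_(c | xpredT c) a (pi v) c * expR (F c)); last first.
  rewrite [RHS](bigID (eB (pi v))) /= [X in _ = _ + X]big1 ?addr0; last first.
    by move=> c /aE ->; rewrite mul0r.
  apply: eq_big => [c|c /andP[ec _]]; last by rewrite /F ec.
  by case E1 : (eB (pi v) c); rewrite //= nbT.
have F0 b : F b <= 0.
  by rewrite /F; case: ifP => // eb; apply: lratio_le0; exact: nbT.
(* The step at the root contracts once more; this factor q is given up. *)
apply: (@le_trans _ _ (q * (q ^+ D.-1 * M))); last first.
  by rewrite -[leRHS]mul1r ler_wpM2r ?mulr_ge0 ?exprn_ge0// ltW.
rewrite distrC /bp_norm; apply: ln1D_contr => //.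
- by rewrite mulr_ge0 ?exprn_ge0.
- by have /andP[] := bp_sum_le a0 aS xpredT (pi v) F0.
- by have /andP[] := bp_sum_le a0 aS xpredT (pi v) (u0 (pi v)).
move=> b _ ab; have eb : eB (pi v) b by apply: contraNT ab => /aE ->.
rewrite /F eb; have [Eb pb] := nbE eb.
pose p t := if t is 0%N then v else nb v b.
have pw : cwalk p 1 by split => [[|t]|t] //=.
have wr : walk_rest p 1 = T :\ v.
  by rewrite walk_restS; congr (_ :\ _); apply/setP => w; rewrite !inE; apply/forallP => -[].
have := lratio_conv (d := D.-1) pw; rewrite wr add1n prednK// leqnn => /(_ isT).
by rewrite /= pb.
Qed.

End Cover.
End Messages.

(** * Fixed points and the Bethe free energy as functions of t *)

Section BetheFunction.
Variables (R : realType) (B : finType) (a : B -> B -> R) (S0 : R).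
Hypothesis a0 : forall x y, 0 <= a x y.
Hypothesis a_sym : forall x y, a x y = a y x.
Hypothesis aS : forall x, \sum_y a x y <= S0.
Hypothesis S00 : 0 <= S0.

Let wt_at (t : R) x y := expR t * a x y.

Lemma wt_at_ge0 t x y : 0 <= wt_at t x y.
Proof. by rewrite mulr_ge0// expR_ge0. Qed.

Lemma wt_at_deg t t' x : t <= t' -> \sum_y wt_at t x y <= expR t' * S0.
Proof.
move=> tt; rewrite -mulr_sumr ler_pM ?expR_ge0 ?sumr_ge0//.
by rewrite ler_expR.
Qed.

Definition bp_fix (t : R) (u : B -> B -> R) :=
  (forall x y, u x y <= 0) /\ forall x y, u x y = bp_step (wt_at t) u x y.

Lemma bp_fix_ex t : exists u, bp_fix t u.
Proof.
have S1 : 0 <= expR t * S0 by rewrite mulr_ge0// expR_ge0.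
have [u [u0 uf]] := bp_fixed_point (wt_at_ge0 t) (fun x => wt_at_deg x (lexx t)) S1.
by exists u; split => // x y; have /andP[] := u0 x y.
Qed.

Lemma bp_fix_range t t' u x y : t <= t' -> bp_fix t u ->
  - ln (1 + expR t' * S0) <= u x y <= 0.
Proof.
move=> tt [u0 uf]; rewrite uf; apply: bp_step_range => //; first exact: wt_at_ge0.
by move=> x'; exact: wt_at_deg.
Qed.

(** Absorbing expR t into the messages shifts them by t. The largest difference d satisfies d <= q
    (|t - s| + d), and q / (1 - q) is expR T * S0. *)
Lemma bp_fix_lip T t s u u' x y : t <= T -> s <= T -> bp_fix t u -> bp_fix s u' ->
  `|u x y - u' x y| <= expR T * S0 * `|t - s|.
Proof.
move=> tT sT [u0 uf] [u0' uf'].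
pose S := expR T * S0; have S1 : 0 <= S by rewrite mulr_ge0// expR_ge0.
pose d := \big[Order.max/0]_(z : B * B) `|u z.1 z.2 - u' z.1 z.2|.
have d0 : 0 <= d by exact: bigmax_ge_id.
have dP x' y' : `|u x' y' - u' x' y'| <= d by exact: (le_bigmax _ _ (x', y')).
have exp_at r v x' c : wt_at r x' c * expR (v x' c) = a x' c * expR (r + v x' c).
  by rewrite /wt_at expRD mulrCA mulrA.
have step x' y' : `|u x' y' - u' x' y'| <= S / (1 + S) * (`|t - s| + d).
  rewrite uf uf' /bp_step opprK addrC distrC.
  under eq_bigr do rewrite exp_at.
  under [in X in _ - X]eq_bigr do rewrite exp_at.
  apply: ln1D_contr => //.
  - by rewrite addr_ge0.
  - under eq_bigr do rewrite -exp_at.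
    by have /andP[] := bp_sum_le (wt_at_ge0 t) (fun x => wt_at_deg x tT) (fun c => c != x') y' (u0 y').
  - under eq_bigr do rewrite -exp_at.
    by have /andP[] := bp_sum_le (wt_at_ge0 s) (fun x => wt_at_deg x sT) (fun c => c != x') y' (u0' y').
  move=> c _ _; rewrite opprD addrACA; apply: le_trans (ler_normD _ _) _.
  by rewrite lerD2l.
apply: (le_trans (dP x y)).
have : d <= S / (1 + S) * (`|t - s| + d).
  apply: bigmax_le => [|z _]; last exact: step.
  by rewrite !mulr_ge0 ?addr_ge0// invr_ge0 addr_ge0.
rewrite mulrAC ler_pdivlMr ?ltr_wpDr//.
rewrite -/S; lra.
Qed.

(** The odds that the edge is occupied, given the messages along it in both directions; [bp_edge] is
    the corresponding probability. *)
Definition bp_theta (t : R) (u : B -> B -> R) x y := wt_at t x y * expR (u x y + u y x).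

(* The Bethe free energy as a function of the messages; the edge term runs over
   ordered pairs, hence the factor 1/2. *)
Definition bethe_fun t u : R := \sum_x ln (bp_norm (wt_at t) u x)
  - 2^-1 * \sum_x \sum_y ln (1 + bp_theta t u x y).

Definition bp_edge t u x y : R := bp_theta t u x y / (1 + bp_theta t u x y).

Lemma bp_theta_ge0 t u x y : 0 <= bp_theta t u x y.
Proof. by rewrite mulr_ge0 ?wt_at_ge0// expR_ge0. Qed.

Lemma bp_theta_sym t u x y : bp_theta t u x y = bp_theta t u y x.
Proof. by rewrite /bp_theta /wt_at a_sym [u x y + _]addrC. Qed.

Lemma bp_edge_sym t u x y : bp_edge t u x y = bp_edge t u y x.
Proof. by rewrite /bp_edge bp_theta_sym. Qed.

Lemma bp_edge_ge0 t u x y : 0 <= bp_edge t u x y.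
Proof. by rewrite divr_ge0 ?addr_ge0 ?bp_theta_ge0. Qed.

Lemma bp_theta1_gt0 t u x y : 0 < 1 + bp_theta t u x y.
Proof. by rewrite ltr_wpDr// bp_theta_ge0. Qed.

Lemma bp_norm_gt0 t u x : 0 < bp_norm (wt_at t) u x.
Proof.
by rewrite ltr_wpDr// sumr_ge0// => c _; rewrite mulr_ge0 ?wt_at_ge0 ?expR_ge0.
Qed.

Section AtFixedPoint.
Variables (t : R) (u : B -> B -> R).
Hypothesis uf : bp_fix t u.

Lemma bp_normE x y : bp_norm (wt_at t) u y = expR (- u x y) * (1 + bp_theta t u x y).
Proof.
have [u0 /(_ x y) uxy] := uf.
have e : expR (- u x y) = 1 + \sum_(c | c != x) wt_at t y c * expR (u y c).
  rewrite uxy opprK lnK// posrE ltr_wpDr// sumr_ge0// => c _.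
  by rewrite mulr_ge0 ?wt_at_ge0 ?expR_ge0.
rewrite mulrDr mulr1 {1}e /bp_norm (bigD1 x)//= addrCA addrC; congr (_ + _).
by rewrite /bp_theta /wt_at mulrCA -expRD addKr a_sym.
Qed.

Lemma bp_edgeE x y : bp_edge t u x y = wt_at t x y * expR (u x y) / bp_norm (wt_at t) u x.
Proof.
rewrite (bp_normE y x) (bp_theta_sym t u y x) /bp_edge {1}/bp_theta expRD expRN.
by field; rewrite !gt_eqF ?expR_gt0 ?bp_theta1_gt0.
Qed.

Lemma bp_edge_sum x : \sum_y bp_edge t u x y = 1 - (bp_norm (wt_at t) u x)^-1.
Proof.
under eq_bigr do rewrite bp_edgeE.
rewrite -mulr_suml [X in X / _](_ : _ = bp_norm (wt_at t) u x - 1); last first.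
  by rewrite /bp_norm addrAC subrr add0r.
by rewrite mulrBl divff ?mul1r// gt_eqF ?bp_norm_gt0.
Qed.

(* [bethe_fun t] is stationary at its fixed point, so the change of the messages
   only contributes to second order. *)
Lemma bethe_fun_incr s u' (d : R) : `|s - t| <= d ->
  (forall x y, `|u' x y - u x y| <= d) -> 3 * d <= 2^-1 ->
  bethe_fun t u + (s - t) * (2^-1 * \sum_x \sum_y bp_edge t u x y)
    - 2^-1 * (#|B|%:R ^+ 2 * (2 * (3 * d) ^+ 2)) <= bethe_fun s u'.
Proof.
move=> std ud d1.
pose e x y := u' x y - u x y; pose D := s - t.
(* Jensen: the quotient of the two norms is the mean of exponentials under the law of the partner of
   x, no partner having exponent 0. *)
have hN x : ln (bp_norm (wt_at t) u x) + \sum_y bp_edge t u x y * (D + e x y)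
     <= ln (bp_norm (wt_at s) u' x).
  set m := \sum_y _; have N0 := bp_norm_gt0 t u x.
  rewrite -ler_expR expRD !lnK ?posrE ?bp_norm_gt0//.
  rewrite mulrC -ler_pdivlMr//.
  have -> : bp_norm (wt_at s) u' x / bp_norm (wt_at t) u x =
     (bp_norm (wt_at t) u x)^-1 + \sum_y bp_edge t u x y * expR (D + e x y).
    rewrite {1}/bp_norm mulrDl mul1r mulr_suml; congr (_ + _).
    apply: eq_bigr => y _; rewrite bp_edgeE /wt_at /D /e.
    rewrite [expR s](_ : _ = expR t * expR (s - t)); last by rewrite -expRD subrKC.
    rewrite [expR (u' x y)](_ : _ = expR (u x y) * expR (u' x y - u x y)); last by rewrite -expRD subrKC.
    by rewrite !expRD; ring.
  have em := expR_gt0 m; rewrite -[leLHS]mulr1 -ler_pdivlMl// -expRN mulrDr.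
  have g0 : (bp_norm (wt_at t) u x)^-1 * (1 - m) <= expR (- m) * (bp_norm (wt_at t) u x)^-1.
    by rewrite mulrC ler_wpM2r ?expR_ge1Dx// invr_ge0 ltW.
  have g1 : \sum_y bp_edge t u x y * (1 + (D + e x y - m)) <=
      expR (- m) * \sum_y bp_edge t u x y * expR (D + e x y).
    rewrite mulr_sumr; apply: ler_sum => y _.
    by rewrite mulrCA -expRD [- m + _]addrC ler_wpM2l ?bp_edge_ge0// expR_ge1Dx.
  apply: le_trans (lerD g0 g1).
  rewrite [X in _ + X](_ : _ = \sum_y bp_edge t u x y + m - m * \sum_y bp_edge t u x y).
    by rewrite bp_edge_sum le_eqVlt; apply/orP; left; apply/eqP; ring.
  rewrite mulr_sumr -big_split/= -sumrB; apply: eq_bigr => y _; ring.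
(* The edge terms enter with a minus sign and need an upper bound. The quadratic error comes from
   expR w - 1 <= w + 2 w ^+ 2 for w <= 1/2, with |w| <= 3 d. *)
have hT x y : ln (1 + bp_theta s u' x y) <=
   ln (1 + bp_theta t u x y) + bp_edge t u x y * (D + e x y + e y x) + (2 * (3 * d) ^+ 2).
  set p := bp_edge t u x y; set w := D + e x y + e y x.
  have wd : `|w| <= 3 * d.
    have h1 := ler_normD (D + e x y) (e y x); have h2 := ler_normD D (e x y).
    have h3 := ud x y; have h4 := ud y x.
    apply: (le_trans h1); move: h2 h3 h4 std; rewrite /D /e; lra.
  have p0 : 0 <= p by exact: bp_edge_ge0.
  have p1 : p <= 1 by rewrite /p /bp_edge ler_pdivrMr ?bp_theta1_gt0// mul1r lerDr.
  have T0 := bp_theta1_gt0 t u x y.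
  have -> : 1 + bp_theta s u' x y = (1 + bp_theta t u x y) * (1 + p * (expR w - 1)).
    have -> : bp_theta s u' x y = bp_theta t u x y * expR w.
      rewrite /bp_theta /wt_at /w /D /e.
      rewrite [expR s](_ : _ = expR t * expR (s - t)); last by rewrite -expRD subrKC.
      rewrite [expR (u' x y + u' y x)](_ : _ = expR (u x y + u y x) *
         expR (u' x y - u x y + (u' y x - u y x))); last first.
        by rewrite -expRD; congr expR; ring.
      by rewrite -!addrA !expRD; ring.
    by rewrite /p /bp_edge; field; rewrite gt_eqF.
  have w1 : w <= 2^-1 by apply: le_trans (ler_norm _) (le_trans wd d1).
  have ew : expR w - 1 <= w + 2 * w ^+ 2.
    have := expR_ge1Dx (- w); rewrite expRN -(ler_pM2l (expR_gt0 w)) divff ?gt_eqF ?expR_gt0// => h.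
    have w3 : 0 <= w ^+ 2 * (1 - 2 * w) by rewrite mulr_ge0 ?sqr_ge0//; lra.
    have w4 : 0 < 1 - w by lra.
    suff : expR w * (1 - w) <= (1 + w + 2 * w ^+ 2) * (1 - w) by rewrite ler_pM2r//; lra.
    by apply: le_trans h _; move: w3; rewrite [X in 0 <= X -> _](_ : _ = (1 + w + 2 * w ^+ 2) * (1 - w) - 1); [rewrite subr_ge0 | ring].
  have pos : 0 < 1 + p * (expR w - 1).
    rewrite mulrBr mulr1; have [->|pn] := eqVneq p 1.
      by rewrite mul1r addrCA subrr addr0 expR_gt0.
    have p2 : p < 1 by rewrite lt_neqAle pn.
    have h := mulr_ge0 p0 (expR_ge0 w); lra.
  rewrite lnM ?posrE// -addrA lerD2l -[leRHS]expRK ler_ln ?posrE ?expR_gt0//.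
  apply: le_trans (expR_ge1Dx _); rewrite lerD2l.
  apply: (@le_trans _ _ (p * (w + 2 * w ^+ 2))); first by rewrite ler_wpM2l.
  rewrite mulrDr lerD2l; apply: (@le_trans _ _ (2 * w ^+ 2)).
    by rewrite ler_piMl// mulr_ge0 ?sqr_ge0.
  by rewrite ler_pM2l// -[w ^+ 2]real_normK ?num_real// ler_pXn2r ?nnegrE// (le_trans _ wd).
have sN : \sum_x (ln (bp_norm (wt_at t) u x) + \sum_y bp_edge t u x y * (D + e x y)) <=
   \sum_x ln (bp_norm (wt_at s) u' x) by apply: ler_sum => x _; exact: hN.
have sT : \sum_x \sum_y ln (1 + bp_theta s u' x y) <= \sum_x \sum_y
   (ln (1 + bp_theta t u x y) + bp_edge t u x y * (D + e x y + e y x) + (2 * (3 * d) ^+ 2)).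
  by apply: ler_sum => x _; apply: ler_sum => y _; exact: hT.
pose Q := \sum_x \sum_y bp_edge t u x y; pose W := \sum_x \sum_y bp_edge t u x y * e x y.
have E1 : \sum_x \sum_y bp_edge t u x y * (D + e x y) = D * Q + W.
  rewrite /Q mulr_sumr -big_split /=; apply: eq_bigr => x _.
  by rewrite mulr_sumr -big_split /=; apply: eq_bigr => y _; ring.
have E2 : \sum_x \sum_y (ln (1 + bp_theta t u x y) + bp_edge t u x y * (D + e x y + e y x) + (2 * (3 * d) ^+ 2))
   = \sum_x \sum_y ln (1 + bp_theta t u x y) + (D * Q + W + W) + #|B|%:R ^+ 2 * (2 * (3 * d) ^+ 2).
  have -> : #|B|%:R ^+ 2 * (2 * (3 * d) ^+ 2) = \sum_(x : B) \sum_(y : B) (2 * (3 * d) ^+ 2).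
    by rewrite !sumr_const -mulrnA -[RHS]mulr_natl natrM expr2.
  have WE : W = \sum_x \sum_y bp_edge t u x y * e y x.
    rewrite /W exchange_big /=; apply: eq_bigr => x _; apply: eq_bigr => y _.
    by rewrite bp_edge_sym.
  rewrite -E1 {1}WE -!big_split /=; apply: eq_bigr => x _.
  by rewrite -!big_split /=; apply: eq_bigr => y _; ring.
(* Stationarity: the vertices contribute D Q + W and half of the edges (D Q + 2 W) / 2, so the
   message term W cancels. *)
move: sN sT; rewrite E2 big_split /= E1 /bethe_fun -/Q -/D.
lra.
Qed.

End AtFixedPoint.
End BetheFunction.

(** * The Bethe free energy of the lifts *)

Section BetheFixedPoint.
Variables (R : realType) (n : nat) (A : 'M[R]_n).
Hypothesis A0 : forall i j, 0 <= A i j.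

Notation V0 := ('I_n + 'I_n)%type.
Definition base_wt : V0 -> V0 -> R := bip (fun i j => A i j).
(** A crude bound, valid for every weighted row or column degree. *)
Definition base_deg : R := \sum_i \sum_j A i j.

Lemma base_wt_ge0 x y : 0 <= base_wt x y.
Proof. by case: x y => [i|j] [i'|j'] /=. Qed.

Lemma base_wt_sym x y : base_wt x y = base_wt y x.
Proof. exact: bip_sym. Qed.

Lemma base_deg_ge0 : 0 <= base_deg.
Proof. by apply: sumr_ge0 => i _; apply: sumr_ge0. Qed.

Lemma base_wt_deg x : \sum_y base_wt x y <= base_deg.
Proof.
rewrite big_sumType /= /base_deg; case: x => [i|j] /=.
  rewrite big1 ?add0r// [leRHS](bigD1 i)//= lerDl.
  by apply: sumr_ge0 => k _; apply: sumr_ge0.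
rewrite [X in _ + X]big1 ?addr0// exchange_big [leRHS](bigD1 j)//= lerDl.
by apply: sumr_ge0 => k _; apply: sumr_ge0.
Qed.

Variables (t : R) (u : V0 -> V0 -> R).
Hypothesis uf : bp_fix base_wt t u.
Notation N x := (bp_norm (fun v w => expR t * base_wt v w) u x).
Notation theta := (bp_theta base_wt t u).
Notation edge := (bp_edge base_wt t u).

Definition bp_mx : 'M[R]_n := \matrix_(i, j) edge (inl i) (inr j).

Lemma theta_side x y : base_wt x y = 0 -> theta x y = 0.
Proof. by move=> h; rewrite /bp_theta h mulr0 mul0r. Qed.

Lemma edge_side x y : base_wt x y = 0 -> edge x y = 0.
Proof. by move=> h; rewrite /bp_edge theta_side// mul0r. Qed.

Lemma bp_mx_row i : \sum_j bp_mx i j = 1 - (N (inl i))^-1.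
Proof.
rewrite -(bp_edge_sum base_wt_ge0 base_wt_sym uf) big_sumType /= [X in _ = X + _]big1 ?add0r.
  by apply: eq_bigr => j _; rewrite mxE.
by move=> j _; apply: edge_side.
Qed.

Lemma bp_mx_col j : \sum_i bp_mx i j = 1 - (N (inr j))^-1.
Proof.
rewrite -(bp_edge_sum base_wt_ge0 base_wt_sym uf) big_sumType /= [X in _ = _ + X]big1 ?addr0.
  by apply: eq_bigr => i _; rewrite mxE bp_edge_sym//; exact: base_wt_sym.
by move=> i _; apply: edge_side.
Qed.

Let N0 x : 0 < N x. Proof. exact: (bp_norm_gt0 base_wt_ge0). Qed.

Lemma bp_mx_Mle : Mle n bp_mx.
Proof.
split; first by move=> i j; rewrite mxE bp_edge_ge0//; exact: base_wt_ge0.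
by split => k; rewrite ?bp_mx_row ?bp_mx_col gerBl invr_ge0 ltW.
Qed.

Lemma bp_mx_supp i j : A i j = 0 -> bp_mx i j = 0.
Proof. by move=> h; rewrite mxE edge_side. Qed.

(** With 1 - x = 1 / (1 + theta) and A / x = N_i N_j / ((1 + theta) expR t), every entry splits into
    row, column and edge logarithms. The entropies of the unmatched probabilities 1 / N complete the
    first two to ln N. *)
Lemma bethe_fun_SB : (\sum_i \sum_j bp_mx i j) * t + SBr A bp_mx = bethe_fun base_wt t u.
Proof.
have ent i j : bp_mx i j * t + (xlnax (A i j) (bp_mx i j) + xlnx (1 - bp_mx i j)) =
    bp_mx i j * ln (N (inl i)) + bp_mx i j * ln (N (inr j)) - ln (1 + theta (inl i) (inr j)).
  have T0 : 0 < 1 + theta (inl i) (inr j) by exact: (bp_theta1_gt0 base_wt_ge0).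
  have [Aij|An] := eqVneq (A i j) 0.
    by rewrite bp_mx_supp// theta_side// /xlnax eqxx subr0 xlnx1 !mul0r !addr0 ln1 subr0.
  have Ap : 0 < A i j by rewrite lt_neqAle eq_sym An A0.
  have th0 : 0 < theta (inl i) (inr j) by rewrite !mulr_gt0 ?expR_gt0.
  have xp : 0 < bp_mx i j by rewrite mxE divr_gt0.
  have e1 : 1 - bp_mx i j = (1 + theta (inl i) (inr j))^-1.
    by rewrite mxE /bp_edge; field; rewrite gt_eqF.
  rewrite e1 xlnxE lnV ?posrE// -e1 /xlnax gt_eqF//.
  have e2 : A i j / bp_mx i j = N (inl i) * N (inr j) / (1 + theta (inl i) (inr j)) / expR t.
    rewrite mxE (bp_edgeE base_wt_ge0 base_wt_sym uf) /=.
    rewrite (bp_normE base_wt_ge0 base_wt_sym uf (inl i) (inr j)) expRN.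
    by field; rewrite !gt_eqF ?expR_gt0//.
  rewrite e2 !ln_div ?posrE ?divr_gt0 ?mulr_gt0 ?expR_gt0// lnM ?posrE// expRK.
  ring.
have -> : bethe_fun base_wt t u = \sum_i ln (N (inl i)) + \sum_j ln (N (inr j))
    - \sum_i \sum_j ln (1 + theta (inl i) (inr j)).
  rewrite /bethe_fun !big_sumType /=; congr (_ - _).
  have h1 i : \sum_y ln (1 + theta (inl i) y) = \sum_j ln (1 + theta (inl i) (inr j)).
    rewrite big_sumType /= big1 ?add0r// => k _.
    by rewrite theta_side// addr0 ln1.
  have h2 j : \sum_y ln (1 + theta (inr j) y) = \sum_i ln (1 + theta (inl i) (inr j)).
    rewrite big_sumType /= [X in _ + X]big1 ?addr0 => [|k _].
      by apply: eq_bigr => i _; rewrite bp_theta_sym//; exact: base_wt_sym.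
    by rewrite theta_side// addr0 ln1.
  rewrite (eq_bigr _ (fun i _ => h1 i)) (eq_bigr _ (fun i _ => h2 i)).
  by rewrite [X in _ * (_ + X)]exchange_big /=; field.
rewrite /SBr !addrA mulr_suml -big_split /=.
rewrite (eq_bigr (fun i => (1 - (N (inl i))^-1) * ln (N (inl i)) +
   \sum_j bp_mx i j * ln (N (inr j)) - \sum_j ln (1 + theta (inl i) (inr j)))); last first.
  move=> i _; rewrite mulr_suml -big_split /= (eq_bigr _ (fun j _ => ent i j)).
  by rewrite !big_split /= -mulr_suml bp_mx_row sumrN.
rewrite !big_split /= sumrN [\sum_i \sum_j bp_mx i j * _]exchange_big /=.
rewrite [\sum_j \sum_i bp_mx i j * _](eq_bigr (fun j => (1 - (N (inr j))^-1) * ln (N (inr j)))); last first.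
  by move=> j _; rewrite -mulr_suml bp_mx_col.
have hx x : xlnx (1 - (1 - (N x)^-1)) = - ((N x)^-1 * ln (N x)).
  by rewrite opprB addrC subrK xlnxE lnV ?posrE// mulrN.
have -> : \sum_i xlnx (1 - \sum_j bp_mx i j) = \sum_i - ((N (inl i))^-1 * ln (N (inl i))).
  by apply: eq_bigr => i _; rewrite bp_mx_row hx.
have -> : \sum_j xlnx (1 - \sum_i bp_mx i j) = \sum_j - ((N (inr j))^-1 * ln (N (inr j))).
  by apply: eq_bigr => j _; rewrite bp_mx_col hx.
have split_ln (F : 'I_n -> V0) : \sum_k (1 - (N (F k))^-1) * ln (N (F k)) =
    \sum_k ln (N (F k)) + \sum_k - ((N (F k))^-1 * ln (N (F k))).
  by rewrite -big_split; apply: eq_bigr => k _ /=; ring.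
rewrite (split_ln inl) (split_ln inr); ring.
Qed.

End BetheFixedPoint.

(** * The lifted matrices and the behaviour of S^B under lifting *)

Section LiftMatrix.
Variables (R : realType) (n : nat).
Local Notation sz := (lsize n).

Lemma lift_mod_lt l (r : 'I_(sz l)) : (r %% n < n)%N.
Proof. by rewrite ltn_mod; case: n r => // -[r]; rewrite /lsize muln0. Qed.

Definition lbase l (r : 'I_(sz l)) : 'I_n := Ordinal (lift_mod_lt r).

(** Also applied to the points x of M_{n,<=}. *)
Definition lift_mx l (A : 'M[R]_n) : 'M[R]_(sz l) :=
  \matrix_(r, c) if ladj n l r c then A (lbase r) (lbase c) else 0.

Lemma ncol_lt l r (j : 'I_n) : (ncol n l r j < sz l)%N.
Proof. by have [] := ncolP l r (ltn_ord j). Qed.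

Lemma nrow_lt l c (i : 'I_n) : (nrow n l c i < sz l)%N.
Proof. by have [] := nrowP l c (ltn_ord i). Qed.

Definition ncol_ord l (r : 'I_(sz l)) (j : 'I_n) : 'I_(sz l) := Ordinal (ncol_lt l r j).
Definition nrow_ord l (c : 'I_(sz l)) (i : 'I_n) : 'I_(sz l) := Ordinal (nrow_lt l c i).

Lemma ncol_ordP l (r : 'I_(sz l)) j : ladj n l r (ncol_ord r j) /\ lbase (ncol_ord r j) = j.
Proof. by have [_ h ad] := ncolP l r (ltn_ord j); split => //; apply: val_inj. Qed.

Lemma nrow_ordP l (c : 'I_(sz l)) i : ladj n l (nrow_ord c i) c /\ lbase (nrow_ord c i) = i.
Proof. by have [_ h ad] := nrowP l c (ltn_ord i); split => //; apply: val_inj. Qed.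

Lemma ncol_ordU l (r c : 'I_(sz l)) : ladj n l r c -> c = ncol_ord r (lbase c).
Proof. by move=> ad; apply: val_inj; exact: ncol_uniq (ltn_ord c) ad. Qed.

Lemma nrow_ordU l (r c : 'I_(sz l)) : ladj n l r c -> r = nrow_ord c (lbase r).
Proof. by move=> ad; apply: val_inj; exact: nrow_uniq (ltn_ord r) ad. Qed.

Lemma lift_sum_row l (r : 'I_(sz l)) (G : 'I_n -> R) :
  \sum_(c < sz l) (if ladj n l r c then G (lbase c) else 0) = \sum_j G j.
Proof.
rewrite -big_mkcond /= (reindex_onto (ncol_ord r) (@lbase l)) /=; last by move=> c /ncol_ordU.
apply: eq_big => [j|j _]; first by have [-> ->] := ncol_ordP r j; rewrite eqxx.
by have [_ ->] := ncol_ordP r j.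
Qed.

Lemma lift_sum_col l (c : 'I_(sz l)) (G : 'I_n -> R) :
  \sum_(r < sz l) (if ladj n l r c then G (lbase r) else 0) = \sum_i G i.
Proof.
rewrite -big_mkcond /= (reindex_onto (nrow_ord c) (@lbase l)) /=; last by move=> r /nrow_ordU.
apply: eq_big => [j|j _]; first by have [-> ->] := nrow_ordP c j; rewrite eqxx.
by have [_ ->] := nrow_ordP c j.
Qed.

Lemma lift_sum_fiber l (F : 'I_n -> R) :
  \sum_(r < sz l) F (lbase r) = (2 ^ l)%:R * \sum_i F i.
Proof.
pose f k : R := if insub k is Some i then F i else 0.
have -> : \sum_i F i = \sum_(0 <= k < n) f k.
  by rewrite big_mkord; apply: eq_bigr => i _; rewrite /f valK.
have -> : \sum_(r < sz l) F (lbase r) = \sum_(0 <= k < 2 ^ l * n) f (k %% n)%N.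
  rewrite big_mkord; apply: eq_bigr => r _.
  by rewrite /f insubT ?lift_mod_lt//= => lt; congr F; exact: val_inj.
elim: (2 ^ l)%N => [|m IH]; first by rewrite mul0n big_geq// mul0r.
rewrite mulSn (@big_cat_nat _ _ _ n)/= ?leq_addr//.
rewrite -natr1 addrC mulrDl mul1r -IH; congr (_ + _).
  rewrite -{1}[n]add0n big_addn addKn; apply: eq_bigr => k _; by rewrite modnDr.
by apply: eq_big_nat => k kn; rewrite modn_small.
Qed.

Variable A : 'M[R]_n.
Hypothesis A0 : forall i j, 0 <= A i j.

Lemma lift_mx_ge0 l r c : 0 <= lift_mx l A r c.
Proof. by rewrite mxE; case: ifP. Qed.

Lemma entryE p (M : 'M[R]_p) i j (hi : (i < p)%N) (hj : (j < p)%N) :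
  entry M i j = M (Ordinal hi) (Ordinal hj).
Proof. by rewrite /entry (insubT (fun t => t < p)%N hi) (insubT (fun t => t < p)%N hj). Qed.

Lemma entry_out p (M : 'M[R]_p) i j : (p <= i)%N || (p <= j)%N -> entry M i j = 0.
Proof.
rewrite /entry => /orP[|] h; first by rewrite insubF// ltnNge h.
by case: insubP => // ? _ _; rewrite insubF// ltnNge h.
Qed.

Lemma entry_lift0 i j : entry (lift_mx 0 A) i j = entry A i j.
Proof.
have sz0 : sz 0 = n by rewrite /lsize mul1n.
have [/andP[hi hj]|] := boolP ((i < n) && (j < n))%N; last first.
  by rewrite negb_and -!leqNgt => h; rewrite !entry_out ?sz0.
have hi' : (i < sz 0)%N by rewrite sz0.
have hj' : (j < sz 0)%N by rewrite sz0.
rewrite !entryE mxE /=; congr (A _ _); apply: val_inj; exact: modn_small.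
Qed.

Lemma lift_mx_2lift l : is_2lift (lift_mx l A) (lift_mx l.+1 A).
Proof.
split; first by rewrite /lsize expnS mulnA.
move=> i j; have n0 : (0 < sz l)%N by case: (sz l) i => // -[].
have adE (b b' : bool) : ladj n l.+1 (i + b * sz l) (j + b' * sz l) =
    ladj n l i j && (b (+) b' == twist n l i j).
  rewrite ladjS !bit_lift// -(@ladj_mod n l l (i + b * sz l)%N)//.
  by rewrite -(@twist_mod n l l (i + b * sz l)%N)// !mod_lift.
have md (k : 'I_(sz l)) : ((k + sz l) %% n = k %% n)%N.
  by rewrite -(modn_base n l) modnDr modn_base.
have Aij : entry (lift_mx l A) i j = lift_mx l A i j.
  by rewrite (entryE _ (ltn_ord i) (ltn_ord j)); congr (lift_mx l A _ _); exact: val_inj.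
(* b and b' select the block; the twist decides whether the entry sits in the diagonal or in the
   off-diagonal blocks. *)
have E (b b' : bool) : entry (lift_mx l.+1 A) (i + b * sz l) (j + b' * sz l) =
    if b (+) b' == twist n l i j then lift_mx l A i j else 0.
  have lt (k : 'I_(sz l)) (d : bool) : (k + d * sz l < sz l.+1)%N by exact: lt_lift.
  rewrite (entryE _ (lt i b) (lt j b')) !mxE /= adE.
  case: (ladj n l i j) => /=; last by case: ifP.
  case: ifP => // _; congr (A _ _); apply: val_inj => /=.
    by case: b; rewrite ?mul1n ?md ?mul0n ?addn0.
  by case: b'; rewrite ?mul1n ?md ?mul0n ?addn0.
have := E false false; have := E false true; have := E true false; have := E true true.
rewrite !mul0n !mul1n !addn0 /= => -> -> -> ->.
by case: (twist n l i j) => /=; [right|left].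
Qed.

Lemma lift_Mle l x : Mle n x -> Mle (sz l) (lift_mx l x).
Proof.
move=> [x0 [xr xc]]; split; first by move=> r c; rewrite mxE; case: ifP.
split => k; under eq_bigr do rewrite mxE.
  by rewrite (lift_sum_row k (fun j => x (lbase k) j)).
by rewrite (lift_sum_col k (fun i => x i (lbase k))).
Qed.

Lemma lift_row l x (r : 'I_(sz l)) : \sum_c lift_mx l x r c = \sum_j x (lbase r) j.
Proof. by under eq_bigr do rewrite mxE; rewrite (lift_sum_row r (fun j => x (lbase r) j)). Qed.

Lemma lift_col l x (c : 'I_(sz l)) : \sum_r lift_mx l x r c = \sum_i x i (lbase c).
Proof. by under eq_bigr do rewrite mxE; rewrite (lift_sum_col c (fun i => x i (lbase c))). Qed.

Lemma lift_total l x : \sum_r \sum_c lift_mx l x r c = (2 ^ l)%:R * \sum_i \sum_j x i j.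
Proof.
by under eq_bigr do rewrite lift_row; rewrite (lift_sum_fiber l (fun i => \sum_j x i j)).
Qed.

(** S^B is a sum of local terms, each repeated 2 ^ l times; entries off the lifted support
    contribute 0. *)
Lemma lift_SBr l x : SBr (lift_mx l A) (lift_mx l x) = (2 ^ l)%:R * SBr A x.
Proof.
rewrite /SBr !mulrBr; congr (_ - _ - _).
- rewrite -lift_sum_fiber; apply: eq_bigr => r _.
  rewrite -(lift_sum_row r (fun j => xlnax (A (lbase r) j) (x (lbase r) j) + xlnx (1 - x (lbase r) j))).
  apply: eq_bigr => c _; rewrite !mxE; case: ifP => // _.
  by rewrite /xlnax eqxx subr0 xlnx1 addr0.
- by rewrite -lift_sum_fiber; apply: eq_bigr => r _; rewrite lift_row.
- by rewrite -lift_sum_fiber; apply: eq_bigr => c _; rewrite lift_col.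
Qed.

Lemma lift_bethe_lower l z x : 0 < z -> Mle n x -> (forall i j, A i j = 0 -> x i j = 0) ->
  (\sum_i \sum_j x i j) * ln z + SBr A x <=
  (2 ^ l)%:R^-1 * ln (matching_gen (lift_mx l A) z).
Proof.
move=> z0 Mx Ax.
have := bethe_matching_gen (@lift_mx_ge0 l) z0 (lift_Mle l Mx).
have Axl r c : lift_mx l A r c = 0 -> lift_mx l x r c = 0.
  by rewrite !mxE; case: ifP => // _; exact: Ax.
move=> /(_ Axl); rewrite lift_total lift_SBr -mulrA -mulrDr => h.
rewrite ler_pdivlMl ?ltr0n ?expn_gt0//.
by rewrite -ler_expR lnK// posrE (lt_le_trans (expR_gt0 _) h).
Qed.

End LiftMatrix.

(** * Mean size of a random matching and convexity of ln P *)

Section Occupation.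
Variables (R : realType) (m : nat) (M : 'M[R]_m).
Hypothesis M0 : forall i j, 0 <= M i j.
Notation T := [set: 'I_m + 'I_m]%SET.
Notation P z := (msum (fun=> 1) (bip (fun i j => z * M i j))).

(** The size of a matching is the number of its matched rows, and P T - P (T :\ inl r) weighs the
    matchings that cover r. *)
Lemma matching_gen_deriv z : \sum_(k < m.+1) k%:R * per_k M k * z ^+ k =
  \sum_r (P z T - P z (T :\ inl r)).
Proof.
have PT : P z T = \sum_(f | pinj [set: 'I_m]%SET [set: 'I_m]%SET f) pwt (fun i j => z * M i j) f.
  by rewrite -msum_pinj; congr msum; apply/setP => -[i|j]; rewrite !inE.
have Pr r : P z T - P z (T :\ inl r) =
    \sum_(f | pinj [set: 'I_m]%SET [set: 'I_m]%SET f) (r \in pdom f)%:R * pwt (fun i j => z * M i j) f.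
  rewrite PT (bigID (fun f : {ffun _} => r \in pdom f)) /=.
  rewrite [in RHS](bigID (fun f : {ffun _} => r \in pdom f)) /=.
  rewrite [X in _ = _ + X]big1 ?addr0; last by move=> f /andP[_ /negbTE ->]; rewrite mul0r.
  rewrite -addrA (_ : _ - _ = 0) ?addr0; last first.
    rewrite (_ : T :\ inl r = bset ([set: 'I_m]%SET :\ r) [set: 'I_m]%SET); last first.
      by apply/setP => -[i|j]; rewrite !inE.
    rewrite msum_pinj; apply/eqP; rewrite subr_eq0; apply/eqP; apply: eq_bigl => f.
    apply/andP/pinjP => [[/pinjP[H1 H2]]|[H1 H2]].
      rewrite inE negbK => /eqP fr; split => // i j fi; rewrite !inE; split => //.
      by rewrite andbT; apply: contra_eq_neq fi => ->; rewrite fr.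
    rewrite inE negbK; split.
      by apply/pinjP; split => // i j _; rewrite !inE.
    by case E: (f r) => [j|//]; have [] := H1 _ _ E; rewrite !inE eqxx.
  by apply: eq_bigr => f /andP[_ ->]; rewrite mul1r.
under [RHS]eq_bigr do rewrite Pr.
rewrite exchange_big /= (partition_big (fun f => inord #|pdom f| : 'I_m.+1) xpredT) //=.
apply: eq_bigr => k _; rewrite per_kE mulr_sumr mulr_suml.
apply: eq_big => [f|f /andP[_ /eqP fk]].
  by congr (_ && _); rewrite -val_eqE /= inordK// ltnS -[leqRHS]card_ord max_card.
rewrite -mulr_suml -natr_sum (pwt_scale (b := fun i j => z * M i j) (b' := fun i j => M i j) (z := z))//.
have -> : (\sum_i (i \in pdom f))%N = k by rewrite -big_mkcond /= sum1_card.
by rewrite fk; ring.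
Qed.

Lemma matching_gen_gt0 z : 0 < z -> 0 < matching_gen M z.
Proof.
move=> z0; rewrite /matching_gen big_ord_recl per_k0 mul1r expr0 ltr_wpDr// sumr_ge0// => i _.
by rewrite mulr_ge0 ?per_k_ge0// exprn_ge0// ltW.
Qed.

(** Tangent at s of a function convex in t: Jensen's inequality for expR ((t - s) k) under the law
    of the matching size k, whose mean is the sum over r. *)
Lemma ln_matching_gen_convex s t : ln (matching_gen M (expR s)) - ln (matching_gen M (expR t)) <=
  (s - t) * \sum_r (1 - P (expR s) (T :\ inl r) / P (expR s) T).
Proof.
have ZP r : matching_gen M r = P r T by exact: matching_genE.
have Zs := matching_gen_gt0 (expR_gt0 s); have Zt := matching_gen_gt0 (expR_gt0 t).
set mu := \sum_r _.
have muE : mu * matching_gen M (expR s) = \sum_(k < m.+1) k%:R * per_k M k * expR s ^+ k.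
  rewrite matching_gen_deriv /mu mulr_suml; apply: eq_bigr => r _.
  by rewrite mulrBl mul1r ZP divfK// gt_eqF// -ZP.
have h : expR ((t - s) * mu) * matching_gen M (expR s) <= matching_gen M (expR t).
  apply: (@le_trans _ _ (\sum_(k < m.+1) per_k M k * expR s ^+ k *
      (expR ((t - s) * mu) * (1 + (t - s) * (k%:R - mu))))).
    have -> : \sum_(k < m.+1) per_k M k * expR s ^+ k * (expR ((t - s) * mu) * (1 + (t - s) * (k%:R - mu)))
      = expR ((t - s) * mu) * (matching_gen M (expR s) +
        (t - s) * (\sum_(k < m.+1) k%:R * per_k M k * expR s ^+ k - mu * matching_gen M (expR s))).
      rewrite /matching_gen !mulr_sumr -sumrB mulr_sumr -big_split /= mulr_sumr.
      by apply: eq_bigr => k _; ring.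
    by rewrite muE subrr mulr0 addr0.
  apply: ler_sum => k _.
  have -> : expR t ^+ k = expR s ^+ k * (expR ((t - s) * mu) * expR ((t - s) * (k%:R - mu))).
    rewrite -!expRM_natl -!expRD; congr expR; ring.
  rewrite [leRHS]mulrA ler_wpM2l ?mulr_ge0 ?per_k_ge0 ?exprn_ge0 ?expR_ge0//.
  by rewrite ler_wpM2l ?expR_ge0// expR_ge1Dx.
have : (t - s) * mu + ln (matching_gen M (expR s)) <= ln (matching_gen M (expR t)).
  by rewrite -ler_expR expRD !lnK ?posrE.
by rewrite mulrBl; rewrite mulrBl; lra.
Qed.

End Occupation.

Section LiftCover.
Variables (R : realType) (n : nat) (A : 'M[R]_n).
Hypothesis A0 : forall i j, 0 <= A i j.
Local Notation sz := (lsize n).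
Variable l : nat.
Notation V := ('I_(sz l) + 'I_(sz l))%type.
Notation B := ('I_n + 'I_n)%type.

Definition lproj (v : V) : B :=
  match v with inl r => inl (lbase r) | inr c => inr (lbase c) end.
Definition lrel (v w : V) : bool :=
  match v, w with inl r, inr c | inr c, inl r => ladj n l r c | _, _ => false end.
(** The base graph is complete bipartite; zeros of A remain as edges of weight 0. *)
Definition opposite (x y : B) : bool :=
  match x, y with inl _, inr _ | inr _, inl _ => true | _, _ => false end.
Definition lnb (v : V) (b : B) : V :=
  match v, b with
  | inl r, inr j => inr (ncol_ord r j) | inr c, inl i => inl (nrow_ord c i) | _, _ => v
  end.
Definition lcode (v : V) : bool * nat :=
  match v with inl r => (true, val r) | inr c => (false, val c) end.

Lemma lrel_sym v w : lrel v w = lrel w v.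
Proof. by case: v w => [r|c] [r'|c']. Qed.

Lemma lrel_proj v w : lrel v w -> opposite (lproj v) (lproj w).
Proof. by case: v w => [r|c] [r'|c']. Qed.

Lemma lnbE v b : opposite (lproj v) b -> lrel v (lnb v b) /\ lproj (lnb v b) = b.
Proof.
case: v b => [r|c] [i|j] //= _.
  by have [-> ->] := ncol_ordP r j.
by have [-> ->] := nrow_ordP c i.
Qed.

Lemma lnbU v w : lrel v w -> w = lnb v (lproj w).
Proof.
by case: v w => [r|c] [r'|c'] //= h; [rewrite -(ncol_ordU h) | rewrite -(nrow_ordU h)].
Qed.

Lemma lcode_inj : injective lcode.
Proof. by move=> [r|c] [r'|c'] //= [] /val_inj ->. Qed.

Lemma lift_girth D : girth_gt n l D ->
  forall p k, (0 < k <= D)%N -> cwalk lrel p k -> p k <> p 0%N.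
Proof.
move=> G p k kD [H1 H2] e; apply: (G (lcode \o p) k kD); last by rewrite /= e.
split => [t _|t tk|t tk]; first by rewrite /=; case: (p t) => x /=.
  by have := H1 t tk; rewrite /vadj /=; case: (p t) (p t.+1) => [x|x] [y|y].
by move=> /= /lcode_inj; exact: H2.
Qed.

Lemma lift_cover_wt t v w : cover_wt lproj lrel (fun x y => expR t * base_wt A x y) v w =
  bip (fun r c => expR t * lift_mx l A r c) v w.
Proof.
by case: v w => [r|c] [r'|c'] //=; rewrite /cover_wt /= mxE; case: ifP; rewrite ?mulr0.
Qed.

(* The derivative of [lift_energy l] in t = ln z: the mean size of a random matching,
   divided by 2 ^ l. *)
Definition occ t : R := (2 ^ l)%:R^-1 * \sum_(r < sz l)
  (1 - msum (fun=> 1) (bip (fun r c => expR t * lift_mx l A r c)) ([set: V]%SET :\ inl r)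
     / msum (fun=> 1) (bip (fun r c => expR t * lift_mx l A r c)) [set: V]%SET).

Lemma occ_conv t Tm D u : t <= Tm -> bp_fix (base_wt A) t u -> girth_gt n l D -> (0 < D)%N ->
  `|occ t - \sum_i \sum_j bp_mx A t u i j| <=
  n%:R * ((expR Tm * base_deg A / (1 + expR Tm * base_deg A)) ^+ D.-1 *
          ln (1 + expR Tm * base_deg A)).
Proof.
move=> tT uf G D0; set bnd := _ ^+ _ * _.
have S0 : 0 <= expR Tm * base_deg A by rewrite mulr_ge0 ?expR_ge0 ?base_deg_ge0.
have key v : `|msum (fun=> 1) (bip (fun r c => expR t * lift_mx l A r c)) ([set: V]%SET :\ v)
     / msum (fun=> 1) (bip (fun r c => expR t * lift_mx l A r c)) [set: V]%SET -
     (bp_norm (fun x y => expR t * base_wt A x y) u (lproj v))^-1| <= bnd.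
  have e U : msum (fun=> 1) (bip (fun r c => expR t * lift_mx l A r c)) U =
      msum (fun=> 1) (cover_wt lproj lrel (fun x y => expR t * base_wt A x y)) U.
    by apply: eq_msum => // x y _ _; rewrite lift_cover_wt.
  rewrite !e; apply: (@unmatched_conv _ _ _ lproj lrel opposite lnb) => //.
  - by move=> x y; rewrite mulr_ge0 ?expR_ge0 ?base_wt_ge0.
  - by move=> x y; rewrite base_wt_sym.
  - by move=> x; apply: wt_at_deg => //; [exact: base_wt_ge0 | exact: base_wt_deg].
  - by move=> [i|j] [i'|j'] //=; rewrite mulr0.
  - exact: lrel_sym.
  - exact: lrel_proj.
  - exact: lnbE.
  - exact: lnbU.
  - exact: lift_girth.
  - move=> x y; apply: bp_fix_range tT uf; [exact: base_wt_ge0|exact: base_wt_deg].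
  - by have [] := uf.
have -> : \sum_i \sum_j bp_mx A t u i j = (2 ^ l)%:R^-1 * \sum_(r < sz l)
     (1 - (bp_norm (fun x y => expR t * base_wt A x y) u (inl (lbase r)))^-1).
  rewrite (lift_sum_fiber l (fun i => 1 - (bp_norm (fun x y => expR t * base_wt A x y) u (inl i))^-1)).
  rewrite mulKf ?pnatr_eq0 ?expn_eq0//.
  by apply: eq_bigr => i _; rewrite bp_mx_row.
rewrite /occ -mulrBr -sumrB normrM ger0_norm ?invr_ge0 ?ler0n//.
rewrite ler_pdivrMl ?ltr0n ?expn_gt0//.
apply: (le_trans (ler_norm_sum _ _ _)).
apply: (@le_trans _ _ (\sum_(r < sz l) bnd)).
  apply: ler_sum => r _; rewrite opprB addrC addrA subrK distrC; exact: (key (inl r)).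
by rewrite sumr_const card_ord -[leLHS]mulr_natl /lsize natrM -mulrA.
Qed.

(** Uniform in l, and small as t -> -oo: this starts the comparison with the Bethe function. *)
Lemma ln_lift_le t : (2 ^ l)%:R^-1 * ln (matching_gen (lift_mx l A) (expR t)) <=
  2 * n%:R * (expR t * base_deg A).
Proof.
rewrite ler_pdivrMl ?ltr0n ?expn_gt0// matching_genE.
set P := msum _ _ _; have Ml := lift_mx_ge0 A0 (l := l).
have wt0 u v : 0 <= bip (fun r c => expR t * lift_mx l A r c) u v.
  by case: u v => [r|c] [r'|c'] //=; rewrite mulr_ge0 ?expR_ge0.
have P0 : 0 < P by apply: msum_gt0 => //; exact: bip_sym.
rewrite -ler_expR lnK//.
apply: (le_trans (@msum_le_prod _ _ _ _ _ wt0 _ _ _)) => //; first exact: bip_sym.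
rewrite (_ : expR ((2 ^ l)%:R * _) = \prod_(v in [set: V]%SET) expR (expR t * base_deg A)); last first.
  rewrite prodr_const cardsT card_sum card_ord -expRM_natl /lsize; congr expR.
  by rewrite natrD !natrM; ring.
apply: ler_prod => v _; rewrite addr_ge0 ?sumr_ge0//=.
apply: le_trans (expR_ge1Dx _); rewrite lerD2l.
have -> : \sum_w bip (fun r c => expR t * lift_mx l A r c) v w = expR t * \sum_w base_wt A (lproj v) w.
  case: v => [r|c]; rewrite !big_sumType /= !mulrDr.
    by rewrite [X in X + _ = _]big1// [X in _ = _ * X + _]big1// mulr0 -mulr_sumr lift_row.
  by rewrite [X in _ + X]big1// [X in _ = _ + _ * X]big1// mulr0 -mulr_sumr lift_col.
by rewrite ler_pM2l ?expR_gt0// base_wt_deg.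
Qed.

End LiftCover.

Section Telescoping.
Variable R : realType.

(** On each of the N steps, f is controlled by the slope at the right end and b by the slope at the
    left end. The differences of G telescope, leaving one step length times m. *)
Lemma telescoping_compare (f g b G : R -> R) (T0 T C eta m dl : R) (N : nat) :
  T0 <= T -> (0 < N)%N -> (T - T0) / N%:R <= dl ->
  (forall s t, s <= T -> t <= T -> f s - f t <= (s - t) * g s) ->
  (forall s, s <= T -> `|g s - G s| <= eta) ->
  (forall s, s <= T -> 0 <= G s <= m) ->
  (forall s t, s <= T -> t <= T -> `|s - t| <= dl ->
     b t + (s - t) * G t - C * (s - t) ^+ 2 <= b s) ->
  f T - f T0 <= b T - b T0 + (T - T0) * eta + (T - T0) / N%:R * (m + C * (T - T0)).
Proof.
move=> TT N0 hdl Hf Hg HG Hb; set h := (T - T0) / N%:R in hdl *.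
have Np : 0 < N%:R :> R by rewrite ltr0n.
have h0 : 0 <= h by rewrite divr_ge0 ?subr_ge0.
have hN : N%:R * h = T - T0 by rewrite mulrC divfK// gt_eqF.
pose s i := T0 + i%:R * h.
have sT i : (i <= N)%N -> s i <= T.
  by move=> iN; rewrite /s -lerBrDl -hN ler_wpM2r// ler_nat.
have main i : (i <= N)%N -> f (s i) - f T0 <= b (s i) - b T0 + i%:R * h * eta
    + h * (G (s i) - G T0) + i%:R * (C * h ^+ 2).
  elim: i => [|i IH] iN; first by rewrite /s !mul0r !addr0 !subrr mulr0 !addr0.
  have {}IH := IH (ltnW iN).
  have ss : s i.+1 - s i = h by rewrite /s -natr1; ring.
  have h1 := Hf _ _ (sT _ iN) (sT _ (ltnW iN)).
  have h2 : h * g (s i.+1) <= h * (G (s i.+1) + eta).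
    by rewrite ler_wpM2l// -lerBlDl (le_trans (ler_norm _))// Hg// sT.
  have := Hb _ _ (sT _ iN) (sT _ (ltnW iN)).
  rewrite ss ger0_norm// => /(_ hdl) h3.
  rewrite ss in h1; rewrite -natr1.
  move: IH h1 h2 h3; lra.
have := main N (leqnn _).
have -> : s N = T by rewrite /s hN addrC subrK.
rewrite hN (_ : N%:R * (C * h ^+ 2) = h * (C * (T - T0))); last by rewrite -hN; ring.
have /andP[_ g1] := HG _ (lexx T); have /andP[g2 _] := HG _ TT.
have : h * (G T - G T0) <= h * m by rewrite ler_wpM2l//; lra.
lra.
Qed.

Lemma geom_small (q M e : R) : 0 <= q < 1 -> 0 < e -> exists k, q ^+ k * M <= e.
Proof.
move=> /andP[q0 q1] e0.
have : ((fun k => M * q ^+ k) @ \oo --> (0 : R))%classic.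
  by apply: cvg_geometric; rewrite ger0_norm.
move=> /cvgrPdist_lt /(_ e e0) [k _ /(_ k (leqnn k))] /=.
rewrite sub0r normrN => h; exists k; rewrite mulrC; apply: le_trans (ltW h).
exact: ler_norm.
Qed.

End Telescoping.

Section Limit.
Variables (R : realType) (n : nat) (A : 'M[R]_n).
Hypothesis A0 : forall i j, 0 <= A i j.

Definition lift_energy l (t : R) : R := (2 ^ l)%:R^-1 * ln (matching_gen (lift_mx l A) (expR t)).

Notation a := (base_wt A).
Notation S0 := (base_deg A).
Notation B := ('I_n + 'I_n)%type.

Lemma bethe_fun_lower t u : bp_fix a t u ->
  - (2^-1 * (#|{: B}|%:R ^+ 2 * (expR t * S0))) <= bethe_fun a t u.
Proof.
move=> uf; have [u0 _] := uf.
have h1 : 0 <= \sum_x ln (bp_norm (fun x y => expR t * a x y) u x).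
  apply: sumr_ge0 => x _; rewrite ln_ge0// lerDl sumr_ge0// => y _.
  by rewrite !mulr_ge0 ?expR_ge0 ?base_wt_ge0.
have h2 : \sum_x \sum_y ln (1 + bp_theta a t u x y) <= #|{: B}|%:R ^+ 2 * (expR t * S0).
  apply: (@le_trans _ _ (\sum_(x : B) \sum_(y : B) expR t * S0)); last first.
    by rewrite !sumr_const -mulrnA -[leLHS]mulr_natl natrM expr2.
  apply: ler_sum => x _; apply: ler_sum => y _.
  have th0 : 0 <= bp_theta a t u x y by apply: bp_theta_ge0; exact: base_wt_ge0.
  rewrite -[leRHS]expRK ler_ln ?posrE ?expR_gt0 ?ltr_wpDr//.
  apply: le_trans (expR_ge1Dx _); rewrite lerD2l /bp_theta.
  rewrite -[leRHS]mulr1; apply: ler_pM; rewrite ?expR_ge0 ?mulr_ge0 ?expR_ge0 ?base_wt_ge0//.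
    rewrite ler_wpM2l ?expR_ge0//; apply: le_trans (base_wt_deg A0 x).
    by rewrite (bigD1 y)//= lerDl sumr_ge0// => z _; exact: base_wt_ge0.
  rewrite -expR0 ler_expR; have := u0 x y; have := u0 y x; lra.
rewrite /bethe_fun; move: h1 h2; lra.
Qed.

Lemma lift_energy_limit Tm u e : bp_fix a Tm u -> 0 < e ->
  exists L, forall l, (L <= l)%N -> lift_energy l Tm <= bethe_fun a Tm u + e.
Proof.
move=> uTm e0.
have aw0 := base_wt_ge0 A0; have aws := base_wt_sym A; have awd := base_wt_deg A0.
have S00 := base_deg_ge0 A0.
(* One fixed point for each t, the one at Tm being the given u. *)
have /choice[v hv] : forall t, exists v, bp_fix a t v /\ (t = Tm -> v = u).
  move=> t; have [->|tn] := eqVneq t Tm; first by exists u.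
  by have [v vf] := bp_fix_ex aw0 awd S00 t; exists v; split => // tT; rewrite tT eqxx in tn.
have vf t : bp_fix a t (v t) by have [] := hv t.
have vT : v Tm = u by have [_ ->] := hv Tm.
pose b t := bethe_fun a t (v t); pose G t := \sum_i \sum_j bp_mx A t (v t) i j.
pose S := expR Tm * S0; have SS : 0 <= S by rewrite mulr_ge0 ?expR_ge0.
(* d = (1 + S) |s - t| bounds the change of t and of the messages, so dl makes 3 d <= 1/2; C is the
   quadratic error of [bethe_fun_incr] for this d. *)
pose dl := (6 * (1 + S))^-1; have dl0 : 0 < dl by rewrite invr_gt0 mulr_gt0// ltr_wpDr.
pose C : R := 9 * #|{: B}|%:R ^+ 2 * (1 + S) ^+ 2.
have C0 : 0 <= C by rewrite /C mulr_ge0 ?sqr_ge0// mulr_ge0// sqr_ge0.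
have GE t : 2^-1 * \sum_x \sum_y bp_edge a t (v t) x y = G t.
  have e1 i : \sum_y bp_edge a t (v t) (inl i) y = \sum_j bp_mx A t (v t) i j.
    by rewrite (bp_edge_sum aw0 aws (vf t)) (bp_mx_row A0 (vf t)).
  have e2 j : \sum_y bp_edge a t (v t) (inr j) y = \sum_i bp_mx A t (v t) i j.
    by rewrite (bp_edge_sum aw0 aws (vf t)) (bp_mx_col A0 (vf t)).
  rewrite big_sumType /= (eq_bigr _ (fun i _ => e1 i)) (eq_bigr _ (fun j _ => e2 j)).
  by rewrite [X in _ + X]exchange_big /= /G; field.
have Gb t : 0 <= G t <= n%:R.
  have [x0 [xr _]] := bp_mx_Mle A0 (vf t).
  rewrite /G sumr_ge0 /= => [|i _]; last by apply: sumr_ge0.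
  apply: (@le_trans _ _ (\sum_(i < n) 1)); first by apply: ler_sum.
  by rewrite sumr_const card_ord.
have Hb s t : s <= Tm -> t <= Tm -> `|s - t| <= dl ->
     b t + (s - t) * G t - C * (s - t) ^+ 2 <= b s.
  move=> sT tT st; pose d := (1 + S) * `|s - t|.
  have h := @bethe_fun_incr _ _ a aw0 aws t (v t) (vf t) s (v s) d.
  have d1 : `|s - t| <= d by rewrite /d ler_peMl// lerDl.
  have d2 x y : `|v s x y - v t x y| <= d.
    apply: (le_trans (bp_fix_lip aw0 awd S00 x y sT tT (vf s) (vf t))).
    by rewrite /d ler_wpM2r// lerDr.
  have d3 : 3 * d <= 2^-1.
    have : d <= (1 + S) * dl by rewrite /d ler_wpM2l// addr_ge0.
    have -> : (1 + S) * dl = 6^-1 by rewrite /dl; field; rewrite gt_eqF// ltr_wpDr.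
    lra.
  have := h d1 d2 d3; rewrite GE -/(b t) -/(b s).
  rewrite (_ : 2^-1 * (#|{: B}|%:R ^+ 2 * (2 * (3 * d) ^+ 2)) = C * (s - t) ^+ 2)//.
  rewrite /d /C -[(s - t) ^+ 2]real_normK ?num_real//; by field.
(* expR T0 * K bounds the gap between the two energies at the starting point T0; the summand 1 makes
   K positive. *)
pose K := 2 * n%:R * S0 + 2^-1 * (#|{: B}|%:R ^+ 2 * S0) + 1.
have K0 : 0 < K by rewrite ltr_wpDl// addr_ge0 ?mulr_ge0 ?sqr_ge0.
pose T0 := Num.min Tm (ln (e / (4 * K))).
have T0T : T0 <= Tm by rewrite ge_min lexx.
have eT0 : expR T0 * K <= e / 4.
  have p0 : 0 < e / (4 * K) by rewrite divr_gt0// mulr_gt0.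
  apply: (@le_trans _ _ (e / (4 * K) * K)).
    by rewrite ler_pM2r// -[leRHS]lnK// ler_expR ge_min lexx orbT.
  by rewrite le_eqVlt; apply/orP; left; apply/eqP; field; rewrite gt_eqF.
have TT0 : 0 <= Tm - T0 by rewrite subr_ge0.
(* N >= W makes the grid finer than dl and the discretization error at most e / 4. *)
pose W := (Tm - T0) / dl + (Tm - T0) * (n%:R + C * (Tm - T0)) * 4 / e.
have W1 : 0 <= (Tm - T0) / dl by exact: divr_ge0 TT0 (ltW dl0).
have W2 : 0 <= (Tm - T0) * (n%:R + C * (Tm - T0)) * 4 / e.
  apply: divr_ge0 (ltW e0); rewrite mulr_ge0// mulr_ge0// addr_ge0//.
  exact: mulr_ge0.
have W0 : 0 <= W by exact: addr_ge0.
pose N := (Num.bound W).+1.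
have NW : W <= N%:R.
  by have := archi_boundP W0 => /ltW /le_trans; apply; rewrite ler_nat.
have Np : 0 < N%:R :> R by rewrite ltr0n.
have N1 : (Tm - T0) / N%:R <= dl.
  rewrite ler_pdivrMr// mulrC -ler_pdivrMr//; apply: le_trans NW.
  by rewrite lerDl.
have N2 : (Tm - T0) / N%:R * (n%:R + C * (Tm - T0)) <= e / 4.
  have e4 : 0 < e / 4 by rewrite divr_gt0.
  rewrite mulrAC ler_pdivrMr// [leRHS]mulrC -ler_pdivrMr//.
  apply: le_trans NW; rewrite (_ : _ / (e / 4) = (Tm - T0) * (n%:R + C * (Tm - T0)) * 4 / e).
    by rewrite lerDr.
  by field; rewrite gt_eqF.
have e4 : 0 < e / 4 by rewrite divr_gt0.
have [k hk] := geom_small (n%:R * ln (1 + S) * (Tm - T0)) (bp_rate SS) e4.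
have [L HL] := girth_unbounded n k.+1.
exists L => l Ll.
pose eta := n%:R * ((S / (1 + S)) ^+ k * ln (1 + S)).
have Hg s : s <= Tm -> `|occ A l s - G s| <= eta.
  by move=> sT; exact: (occ_conv A0 sT (vf s) (HL l Ll)).
have Hf s t : s <= Tm -> t <= Tm -> lift_energy l s - lift_energy l t <= (s - t) * occ A l s.
  move=> _ _; rewrite /lift_energy /occ -mulrBr mulrCA ler_wpM2l ?invr_ge0//.
  by apply: ln_matching_gen_convex => r c; exact: lift_mx_ge0.
have := telescoping_compare T0T (ltn0Sn _ : (0 < N)%N) N1 Hf Hg (fun s _ => Gb s) Hb.
have l1 := ln_lift_le A0 l T0; have l2 := bethe_fun_lower (vf T0).
have l3 : (Tm - T0) * eta <= e / 4 by rewrite /eta; move: hk; lra.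
have el : expR T0 * K = 2 * n%:R * (expR T0 * S0) +
    2^-1 * (#|{: B}|%:R ^+ 2 * (expR T0 * S0)) + expR T0 by rewrite /K; ring.
rewrite el in eT0; have := expR_ge0 T0; rewrite {1}/b vT.
move: l1 l2 l3 N2 eT0; rewrite -/(b T0) -/(lift_energy l T0) -/(lift_energy l Tm).
lra.
Qed.

End Limit.

Section BetheLimit.
Variables (R : realType) (n : nat) (A : 'M[R]_n).
Hypothesis A0 : forall i j, 0 <= A i j.

Lemma SB_fin (x : 'M[R]_n) : (forall i j, A i j = 0 -> x i j = 0) -> SB A x = (SBr A x)%:E.
Proof.
move=> Ax; rewrite /SB ifF//; apply/existsP => -[i /existsP[j /andP[/eqP/Ax ->]]].
by rewrite ltxx.
Qed.

(** A bound on S^B obtained through the lifts: the value at x is below the energy of every lift, and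
    that of a high lift is at most the Bethe value plus e. *)
Lemma bethe_sup_le t u (x : 'M[R]_n) : bp_fix (base_wt A) t u -> Mle n x ->
  (((\sum_i \sum_j x i j) * t)%:E + SB A x <= (bethe_fun (base_wt A) t u)%:E)%E.
Proof.
move=> uf Mx; have [x0 _] := Mx.
have [->|[-> Ax]] := SB_cases A x0; first by rewrite addeNy leNye.
rewrite -EFinD lee_fin; apply/ler_addgt0Pr => e e0.
have [L HL] := lift_energy_limit A0 uf e0; apply: le_trans (HL L (leqnn L)).
have := lift_bethe_lower A0 L (expR_gt0 t) Mx Ax.
by rewrite expRK.
Qed.

Lemma bethe_sup t u : bp_fix (base_wt A) t u ->
  ereal_sup [set ((\sum_i \sum_j x i j) * t)%:E + SB A x | x in (Mle n : set 'M[R]_n)]%E%classic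
  = (bethe_fun (base_wt A) t u)%:E.
Proof.
move=> uf; apply/eqP; rewrite eq_le; apply/andP; split.
  by apply: ge_ereal_sup => _ [x Mx <-]; exact: bethe_sup_le.
apply: ereal_sup_ubound; exists (bp_mx A t u); first exact: bp_mx_Mle.
by rewrite SB_fin => [|i j]; [rewrite -EFinD bethe_fun_SB | exact: bp_mx_supp].
Qed.

Lemma lift_energy_cvg t u : bp_fix (base_wt A) t u ->
  ((lift_energy A ^~ t) @ \oo --> bethe_fun (base_wt A) t u)%classic.
Proof.
move=> uf; apply/cvgrPdist_le => e e0.
have [L HL] := lift_energy_limit A0 uf e0.
exists L => // l /= Ll; rewrite ler_norml; apply/andP; split.
  by have := HL l Ll; lra.
rewrite lerBlDr; apply: (@le_trans _ _ (lift_energy A l t)); last by rewrite lerDr ltW.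
rewrite -bethe_fun_SB//.
have := lift_bethe_lower A0 l (expR_gt0 t) (bp_mx_Mle A0 uf) (bp_mx_supp t u (A := A)).
by rewrite expRK.
Qed.

End BetheLimit.

Local Open Scope classical_set_scope.

Theorem theorem2p2 (R : realType) (n : nat) (A : 'M[R]_n)
  (hA : forall i j, 0 <= A i j) :
  (forall k : nat, (k <= nu A)%N ->
     ((per_k A k)%:E >=
      (bin_b (nu A) k (k%:R / (nu A)%:R))%:E *
      expeR (ereal_sup [set SB A x | x in (Mk n k : set 'M[R]_n)]))%E)
  /\
  exists Aseq : forall l : nat, 'M[R]_(2 ^ l * n),
    (forall l i j, 0 <= Aseq l i j) /\
    (forall i j : nat, entry (Aseq 0%N) i j = entry A i j) /\
    (forall l : nat, is_2lift (Aseq l) (Aseq l.+1)) /\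
    (forall z : R, 0 < z ->
       ((fun l : nat =>
          ((2 ^ l)%:R^-1 *
           ln (\sum_(k < (nu (Aseq l)).+1) per_k (Aseq l) k * z ^+ k))%:E)
       @ \oo -->
       ereal_sup [set ((\sum_i \sum_j x i j) * ln z)%:E + SB A x
                 | x in (Mle n : set 'M[R]_n)])%E).
Proof.
split; first exact: per_k_bethe.
exists (fun l => lift_mx l A : 'M[R]_(2 ^ l * n)); split; first by move=> l i j; exact: lift_mx_ge0.
split; first exact: entry_lift0.
split; first by move=> l; exact: lift_mx_2lift.
move=> z z0.
have [u uf] := bp_fix_ex (base_wt_ge0 hA) (base_wt_deg hA) (base_deg_ge0 hA) (ln z).
rewrite (bethe_sup hA uf); apply: cvg_EFin; first by near=> l.
rewrite (_ : fine \o _ = lift_energy A ^~ (ln z)); first exact: lift_energy_cvg.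
apply/funext => l; rewrite /= /lift_energy lnK//; congr (_ * ln _).
by apply: nu_sum => i j; exact: lift_mx_ge0.
Unshelve. all: by end_near. Qed.
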